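(* Let $d\ge1$, $0<\alpha<2$, $m>0$, and let $H_0^m=(m^{2/\alpha}-\Delta)^{\alpha/2}-m$ on $\mathbb{R}^d$, with heat kernel $p_t^{(m,\alpha)}$. Suppose $V\in L^\infty(\mathbb{R}^d)\cap L^1(\mathbb{R}^d)$ is real-valued and uniformly Hölder continuous of order $\gamma$, i.e. there is a constant $M\in(0,\infty)$ such that $|V(x)-V(y)|\le M|x-y|^\gamma$ for all $x,y\in\mathbb{R}^d$, where $0<\gamma<\alpha\wedge1$ if $0<\alpha\le1$, and $0<\gamma\le1$ if $1<\alpha<2$. Let $H^m=H_0^m+V$, and let $Tr(e^{-tH^m}-e^{-tH_0^m})$ be the trace difference defined in the context. Then for all $t\in(0,1]$, $$\left|Tr(e^{-tH^m}-e^{-tH_0^m})+p_t^{(m,\alpha)}(0)\,t\int_{\mathbb{R}^d}V(x)\,dx-p_t^{(m,\alpha)}(0)\,\tfrac12t^2\int_{\mathbb{R}^d}|V(x)|^2dx\right|\le C_{\alpha,\gamma,m,d}\,\|V\|_1\,p_t^{(m,\alpha)}(0)\left(\|V\|_\infty^2e^{t\|V\|_\infty}t^3+t^{\gamma/\alpha+2}\right),$$ where the constant $C_{\alpha,\gamma,m,d}$ depends only on $\alpha$, $\gamma$, $m$ and $d$. In particular, $$Tr(e^{-tH^m}-e^{-tH_0^m})=p_t^{(m,\alpha)}(0)\left(-t\int_{\mathbb{R}^d}V(x)\,dx+\tfrac12t^2\int_{\mathbb{R}^d}|V(x)|^2dx+\mathcal{O}(t^{\gamma/\alpha+2})\right)\quad\text{as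 } t\downarrow0.$$
   Context: $a\wedge b=\min\{a,b\}$. For $0<\alpha<2$ and $m>0$, the relativistic $\alpha$-stable process $X_t^m$ in $\mathbb{R}^d$ is the Lévy process with characteristic function $E^0(e^{i\xi\cdot X_t^m})=e^{-t\left((|\xi|^2+m^{2/\alpha})^{\alpha/2}-m\right)}$. Its infinitesimal generator is $m-(m^{2/\alpha}-\Delta)^{\alpha/2}$ (Fourier multiplier $m-(|\xi|^2+m^{2/\alpha})^{\alpha/2}$), and its transition density is $p_t^{(m,\alpha)}(x,y)=p_t^{(m,\alpha)}(x-y)$, where $$p_t^{(m,\alpha)}(x)=\frac{1}{(2\pi)^d}\int_{\mathbb{R}^d}e^{-ix\cdot\xi}e^{-t\left((|\xi|^2+m^{2/\alpha})^{\alpha/2}-m\right)}\,d\xi .$$ $e^{-tH_0^m}$ is the semigroup with kernel $p_t^{(m,\alpha)}(x,y)$, and $e^{-tH^m}$ is the semigroup whose kernel is given by the Feynman–Kac formula $$p_t^{H^m}(x,y)=p_t^{(m,\alpha)}(x,y)\,E^t_{x,y}\left(e^{-\int_0^tV(X^m_s)\,ds}\right).$$ Here $E^t_{x,y}$ is expectation with respect to the bridge of $X^m$ started at $x$ and conditioned to be at $y$ at time $t$, i.e. the process with right-continuous paths with left limits whose finite-dimensional densities at times $0<s_1<\dots<s_k<t$ are $\frac{1}{p_t^{(m,\alpha)}(x,y)}\prod_{j=0}^{k}p^{(m,\alpha)}_{s_{j+1}-s_j}(y_{j+1}-y_j)$ with $s_0=0$, $s_{k+1}=t$, $y_0=x$,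 $y_{k+1}=y$. The trace difference is defined by $$Tr(e^{-tH^m}-e^{-tH_0^m})=\int_{\mathbb{R}^d}\left(p_t^{H^m}(x,x)-p_t^{(m,\alpha)}(x,x)\right)dx=p_t^{(m,\alpha)}(0)\int_{\mathbb{R}^d}E^t_{x,x}\left(e^{-\int_0^tV(X_s^m)\,ds}-1\right)dx,$$ which is absolutely convergent for $V\in L^\infty(\mathbb{R}^d)\cap L^1(\mathbb{R}^d)$. $\|\cdot\|_1$ and $\|\cdot\|_\infty$ are the norms of $L^1(\mathbb{R}^d)$ and $L^\infty(\mathbb{R}^d)$.
   Formalization: The constant C is allowed to depend on the Hölder constant M as well as on α, γ, m and d; with C independent of M the inequality fails, e.g. for V(x)=φ(x)cos(Kx) in d=1 with K→∞ and t small. *)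

(* Defs.v *)
From HB Require Import structures.
From mathcomp Require Import all_boot all_order all_algebra.
From mathcomp Require Import all_classical all_reals all_analysis.

Set Implicit Arguments.
Unset Strict Implicit.
Unset Printing Implicit Defensive.
Import Order.TTheory GRing.Theory Num.Theory.
Import numFieldNormedType.Exports.

Local Open Scope classical_set_scope.
Local Open Scope ring_scope.

Definition tuple_cons {T : Type} {n : nat} (p : T * n.-tuple T) : n.+1.-tuple T :=
  [tuple of p.1 :: p.2].

Lemma measurable_tuple_cons d (T : measurableType d) n :
  measurable_fun [set: T * n.-tuple T] (@tuple_cons T n).
Proof. exact: (measurable_cons (@measurable_fst _ _ _ _) (@measurable_snd _ _ _ _)). Qed.

Section cons_measure.
Context d (T : measurableType d) (R : realType) (n : nat).
Variable mu : {sigma_finite_measure set T -> \bar R}.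
Variable nu : {sigma_finite_measure set (n.-tuple T) -> \bar R}.

Definition cons_measure : set (n.+1.-tuple T) -> \bar R :=
  pushforward (mu \x nu)%E (@tuple_cons T n).

Let cons_measure0 : cons_measure set0 = 0%E.
Proof. by rewrite /cons_measure /pushforward preimage_set0 measure0. Qed.

Let cons_measure_ge0 A : (0 <= cons_measure A)%E.
Proof. exact: (measure_ge0 (mu \x nu)%E). Qed.

Let cons_measure_sigma_additive : semi_sigma_additive cons_measure.
Proof.
move=> F mF tF mUF; rewrite /cons_measure /pushforward preimage_bigcup.
have mcF k : measurable (@tuple_cons T n @^-1` F k).
  by rewrite -[X in measurable X]setTI; exact: measurable_tuple_cons.
apply: (@measure_semi_sigma_additive _ _ _ (mu \x nu)%E) => //.
- by apply/trivIsetP => /= i j _ _ ij; rewrite -preimage_setI;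
    move/trivIsetP : tF => /(_ _ _ _ _ ij) ->//; rewrite preimage_set0.
- exact: bigcup_measurable.
Qed.

HB.instance Definition _ := isMeasure.Build _ _ _ cons_measure
  cons_measure0 cons_measure_ge0 cons_measure_sigma_additive.

Let cons_measure_sigma_finite : sigma_finite setT cons_measure.
Proof.
have /sigma_finiteP[F [FT ndF mF]] := sigma_finiteT mu.
have /sigma_finiteP[G [GT ndG mG]] := sigma_finiteT nu.
pose H k := [set z : n.+1.-tuple T | F k (thead z) /\ G k [tuple of behead z]].
have HE k : @tuple_cons T n @^-1` H k = F k `*` G k.
  apply/seteqP; split => -[a b]; rewrite /H /tuple_cons/= theadE.
    by rewrite (_ : [tuple of _] = b)//; exact: val_inj.
  by rewrite (_ : [tuple of _] = b)//; exact: val_inj.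
exists H.
  apply/esym; rewrite -subTset => z _.
  have [i _ Fi] : (\bigcup_i F i) (thead z) by rewrite -FT.
  have [j _ Gj] : (\bigcup_j G j) [tuple of behead z] by rewrite -GT.
  exists (maxn i j) => //; split.
  - by move: (thead z) Fi; exact/subsetPset/ndF/leq_maxl.
  - by move: [tuple of behead z] Gj; exact/subsetPset/ndG/leq_maxr.
move=> k; have [mFk Fk] := mF k; have [mGk Gk] := mG k; split.
  have -> : H k = (fun z => thead z) @^-1` F k `&`
      (fun z : n.+1.-tuple T => [tuple of behead z]) @^-1` G k by [].
  apply: measurableI.
    by rewrite -[X in measurable X]setTI; exact: (@measurable_tnth _ T n.+1 ord0).
  by rewrite -[X in measurable X]setTI; exact: measurable_behead.
rewrite /cons_measure /pushforward HE product_measure1E//.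
by rewrite lte_mul_pinfty// ge0_fin_numE.
Qed.

HB.instance Definition _ := @Measure_isSigmaFinite.Build _ _ _ cons_measure
  cons_measure_sigma_finite.

End cons_measure.

(** The [n]-fold product of [mu] with itself, on [n.-tuple T]. *)
Fixpoint tuple_measure d (T : measurableType d) (R : realType)
    (mu : {sigma_finite_measure set T -> \bar R}) (n : nat) :
    {sigma_finite_measure set (n.-tuple T) -> \bar R} :=
  match n with
  | 0 => \d_([tuple] : 0.-tuple T)
  | n'.+1 => cons_measure mu (tuple_measure mu n')
  end.

Lemma tuple_measure_box d (T : measurableType d) (R : realType)
    (mu : {sigma_finite_measure set T -> \bar R}) (n : nat)
    (A : 'I_n -> set T) : (forall i, measurable (A i)) ->
  tuple_measure mu n [set z | forall i, A i (tnth z i)] =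
  (\prod_(i < n) mu (A i))%E.
Proof.
elim: n A => [|n IH] A mA /=.
  by rewrite big_ord0 diracE mem_set// => -[].
rewrite big_ord_recl/= -IH// /cons_measure /pushforward.
rewrite (_ : _ @^-1` _ = A ord0 `*`
    [set z : n.-tuple T | forall i, A (lift ord0 i) (tnth z i)]); last first.
  apply/seteqP; split => -[a b]; rewrite /tuple_cons/=.
    move=> H; split; first exact: (H ord0).
    by move=> i; have := H (lift ord0 i); rewrite tnthS.
  by case=> H0 H i; case: (unliftP ord0 i) => [j|] ->; rewrite ?tnthS//; exact: H.
rewrite product_measure1E//.
rewrite (_ : [set _ | _] = \bigcap_(i in [set: 'I_n])
    ((fun z : n.-tuple T => tnth z i) @^-1` A (lift ord0 i))); last first.
  by apply/seteqP; split => z /= H i; [move=> _; exact: H|exact: H].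
apply: fin_bigcap_measurable; first exact: finite_finset.
move=> i _.
by rewrite -[X in measurable X]setTI; exact: measurable_tnth.
Qed.

(** [R^d] is [d.-tuple R], with the sigma-algebra generated by the coordinates
    and [tuple_measure lebesgue_measure d] as Lebesgue measure. *)
Notation euclid R d := (d.-tuple (measurableTypeR R)).

Section euclidean_space.
Context {R : realType} {d : nat}.
Local Notation Rd := (euclid R d).

Definition leb : {sigma_finite_measure set Rd -> \bar R} :=
  tuple_measure lebesgue_measure d.

Definition vzero : Rd := [tuple (0 : R) | i < d].

Definition vsub (x y : Rd) : Rd := [tuple (tnth x i : R) - tnth y i | i < d].

Definition dotv (x y : Rd) : R := \sum_(i < d) (tnth x i : R) * tnth y i.

Definition enorm (x : Rd) : R := Num.sqrt (dotv x x).

Definition L1norm (V : Rd -> R) : R := fine ('N[leb]_1[EFin \o V])%E.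

Definition Linfnorm (V : Rd -> R) : R := fine ('N[leb]_(+oo)[EFin \o V])%E.

Definition rel_symbol (alpha m : R) (xi : Rd) : R :=
  (enorm xi ^+ 2 + m `^ (2 / alpha)) `^ (alpha / 2) - m.

(** The imaginary part of the Fourier integral is that of an odd function and
    vanishes, so only the real part [cos] of
    [e^{-i x . xi}] is integrated. *)
Definition heat_kernel (alpha m t : R) (x : Rd) : R :=
  ((2 * pi) ^+ d)^-1 *
  \int[leb]_xi (cos (dotv x xi) * expR (- t * rel_symbol alpha m xi)).

(** Finite-dimensional density of the bridge from [x] to [y] in time [t], at
    the times [s] and the points [z]; index [0] of the padded sequences is the
    starting point and index [k.+1] the end point. *)
Definition bridge_density (alpha m t : R) (x y : Rd) (k : nat)
    (s : k.-tuple R) (z : k.-tuple Rd) : R :=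
  let s' := nth 0 (0 :: rcons s t) in
  let y' := nth x (x :: rcons z y) in
  (heat_kernel alpha m t (vsub x y))^-1 *
  \prod_(j < k.+1) heat_kernel alpha m (s' j.+1 - s' j) (vsub (y' j.+1) (y' j)).

Definition rcll_on (t : R) (w : R -> Rd) : Prop :=
  (forall s, 0 <= s < t -> enorm (vsub (w r) (w s)) @[r --> s^'+] --> (0 : R)) /\
  (forall s, 0 < s <= t ->
     exists l, enorm (vsub (w r) l) @[r --> s^'-] --> (0 : R)).

End euclidean_space.

Record process (R : realType) (d : nat) := Process {
  process_display : measure_display ;
  process_space : measurableType process_display ;
  process_law : probability process_space R ;
  process_path : R -> process_space -> euclid R d }.
Arguments process_path {R d} p _ _.

(** Only the times [0 <= s <= t] of [X] are constrained. *)
Record is_bridge (R : realType) (d : nat) (alpha m t : R) (x y : euclid R d)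
    (X : process R d) : Prop := IsBridge {
  bridge_measurable : forall s, 0 <= s <= t ->
    measurable_fun setT (process_path X s) ;
  bridge_rcll : forall w, rcll_on t (process_path X ^~ w) ;
  bridge_start : {ae process_law X, forall w, process_path X 0 w = x} ;
  bridge_end : {ae process_law X, forall w, process_path X t w = y} ;
  bridge_fdd : forall (k : nat) (s : k.-tuple R), (0 < k)%N ->
    path <%R 0 (rcons s t) ->
    forall B : set (k.-tuple (euclid R d)), measurable B ->
    process_law X
      [set w | B [tuple process_path X (tnth s i) w | i < k]] =
    (\int[tuple_measure leb k]_(z in B) (bridge_density alpha m t x y s z)%:E)%E
}.

Section feynman_kac.
Context {R : realType} {d : nat}.
Variables (alpha m : R) (V : euclid R d -> R).
Variable bridge : R -> euclid R d -> euclid R d -> process R d.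

(** The kernel [p_t^{H^m}(x,y)] of [e^{-t H^m}], [H^m = H_0^m + V]. *)
Definition feynman_kac_kernel (t : R) (x y : euclid R d) : R :=
  heat_kernel alpha m t (vsub x y) *
  fine 'E_(process_law (bridge t x y))[
    (fun w => expR (- \int[lebesgue_measure]_(s in `[0, t])
                        V (process_path (bridge t x y) s w)))%R ]%E.

Definition trace_difference (t : R) : R :=
  \int[leb]_x
    (feynman_kac_kernel t x x - heat_kernel alpha m t (vsub x x)).

End feynman_kac.

(* Main.v *)
Require Import Defs.
From HB Require Import structures.
From mathcomp Require Import all_boot all_order all_algebra.
From mathcomp Require Import all_classical all_reals all_analysis.
From mathcomp Require Import measurable_realfun ess_sup_inf.
From mathcomp Require Import ring lra.

Set Implicit Arguments.
Unset Strict Implicit.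
Unset Printing Implicit Defensive.
Import Order.TTheory GRing.Theory Num.Theory.
Import numFieldNormedType.Exports.

Local Open Scope classical_set_scope.
Local Open Scope ring_scope.

(** The existence of bridges forces the heat kernel [p] to be a genuine positive
    transition density: the one-point marginal of a bridge has mass [1], which
    says that [p_t] never vanishes and satisfies Chapman-Kolmogorov; continuity
    along rays then gives [p > 0].

    Put [A = \int_0^t V(X_s) ds]. Then [e^{-A} - 1 = -A + A^2/2 + O(|A|^3 e^{|A|})]
    and [A^2 = t \int_0^t V(X_s)^2 ds - (1/2) \iint (V(X_s) - V(X_r))^2 ds dr].
    Integrating over the starting point, the bridge at time [s] is distributed
    according to Lebesgue measure, so the first two terms give exactly
    [- t \int V] and [(t^2/2) \int V^2]. In the double integral the pair [(X_s, X_r)]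
    has density [(p_u p_{t-u})(z' - z) / p_t(0)] with [u = |r - s|]; one of the two
    factors is at most [p_{t/2}(0) <= C p_t(0)], and the Hoelder bound reduces the
    estimate to [\int_{|z|<=1} |z|^gamma p_v(z) dz <= C v^{gamma/alpha}] and
    [\int_{|z|>=1} p_v(z) dz <= C v].

    Both follow from [\int_{|z|>=r} p_v(z) dz <= C v r^{-alpha}]. To see this, take
    [h = r^alpha] and integrate the gap [p_h(0) - p_h(z) >= c h^{-d/alpha}], valid
    for [|z| >= r], against [p_v]: by Chapman-Kolmogorov the result is at most
    [p_h(0) - p_{v+h}(0) <= C (v/h) h^{-d/alpha}]. *)

(** * Integration *)

(** Several obstacles shape the details. The mass of [p_u] is not given and Fourier inversion is
    avoided: [\int p_u <= 1] comes from multiplying by [p_n / p_n(0)], which tends to 1, and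
    applying Fatou's lemma to integrals that Chapman-Kolmogorov evaluates. The symbol does not
    scale, but it lies between [|xi|^alpha - m] and [|xi|^alpha]; for times at most 1 the value
    [p_h(0)] is therefore comparable to its stable analogue, which scales exactly. This limits the
    tail estimate to radii at most 1, whence the splitting of the increments of [V] at distance 1:
    Hoelder bound inside, twice the sup norm [N] outside. The outer part is linear in [N] and is
    absorbed through [N <= N^2 + 1], which keeps [N] out of the constant. Finally, the bridges are
    arbitrary processes, one for each [x], with no measurability in [x]: expectations are rewritten
    through densities before [x] is integrated, and the trace integrand is only enclosed between two
    integrable functions. The signed [V] enters as the difference of [|V| + V] and [|V|], so that
    Tonelli applies to each. *)

Section integral_sandwich.
Context d (T : measurableType d) (R : realType).
Variable mu : {measure set T -> \bar R}.

(** The integral of a nonnegative function is a supremum over the simple functions below it, and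
    this set grows with the function; no measurability is involved. *)
Lemma ge0_le_integral_pointwise (f g : T -> \bar R) :
  (forall x, 0 <= f x)%E -> (forall x, f x <= g x)%E ->
  (\int[mu]_x f x <= \int[mu]_x g x)%E.
Proof.
move=> f0 fg; have g0 x : (0 <= g x)%E by exact: le_trans (f0 x) (fg x).
rewrite !ge0_integralTE//; apply: ereal_sup_le => _ [h hf <-].
by exists h => // x; exact: le_trans (hf x) (fg x).
Qed.

(* [f] need not be measurable: the integrand of [trace_difference] is not known
   to be. *)
Lemma integral_sandwich (f g h : T -> R) :
  mu.-integrable setT (EFin \o g) -> mu.-integrable setT (EFin \o h) ->
  (forall x, g x <= f x <= h x) ->
  \int[mu]_x g x <= \int[mu]_x f x <= \int[mu]_x h x.
Proof.
move=> ig ih gfh.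
have gf x : g x <= f x by have /andP[] := gfh x.
have fh x : f x <= h x by have /andP[] := gfh x.
have le_pos (u v : T -> R) : (forall x, u x <= v x) ->
    (\int[mu]_x (EFin \o u)^\+ x <= \int[mu]_x (EFin \o v)^\+ x)%E.
  move=> uv; apply: ge0_le_integral_pointwise => x; first by rewrite funepos_ge0.
  by rewrite /= !funeposE ge_max !le_max/= lee_fin uv lexx orbT.
have le_neg (u v : T -> R) : (forall x, u x <= v x) ->
    (\int[mu]_x (EFin \o v)^\- x <= \int[mu]_x (EFin \o u)^\- x)%E.
  move=> uv; apply: ge0_le_integral_pointwise => x; first by rewrite funeneg_ge0.
  by rewrite /= !funenegE ge_max !le_max/= lee_fin lerN2 uv lexx orbT.
have pos_ge0 (u : T -> R) : (0 <= \int[mu]_x (EFin \o u)^\+ x)%E.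
  by apply: integral_ge0 => x _; rewrite funepos_ge0.
have neg_ge0 (u : T -> R) : (0 <= \int[mu]_x (EFin \o u)^\- x)%E.
  by apply: integral_ge0 => x _; rewrite funeneg_ge0.
have fp : (\int[mu]_x (EFin \o f)^\+ x \is a fin_num)%E.
  rewrite ge0_fin_numE//; apply: le_lt_trans (le_pos _ _ fh) _.
  exact: integral_funepos_lt_pinfty.
have fn : (\int[mu]_x (EFin \o f)^\- x \is a fin_num)%E.
  rewrite ge0_fin_numE//; apply: le_lt_trans (le_neg _ _ gf) _.
  exact: integral_funeneg_lt_pinfty.
have ff : (\int[mu]_x (EFin \o f) x \is a fin_num)%E.
  by rewrite integralE fin_numB fp fn.
have gfin := integrable_fin_num measurableT ig.
have hfin := integrable_fin_num measurableT ih.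
apply/andP; split; apply: fine_le => //.
- rewrite integralE [leRHS]integralE; apply: leeB.
    exact: le_pos.
  exact: le_neg.
- rewrite integralE [leRHS]integralE; apply: leeB.
    exact: le_pos.
  exact: le_neg.
Qed.

End integral_sandwich.

Section integral_density.
Local Open Scope ereal_scope.
Context d (T : measurableType d) (R : realType).
Variables (mu nu : {measure set T -> \bar R}) (g : T -> R).
Hypothesis g0 : forall x, (0 <= g x)%R.
Hypothesis mg : measurable_fun setT g.
Hypothesis nuE : forall A, measurable A -> nu A = \int[mu]_(x in A) (g x)%:E.

Import HBNNSimple.

(** Simple functions and monotone convergence. It turns the finite-dimensional laws of a bridge,
    which are prescribed set by set, into expectations. *)
Lemma ge0_integral_density (f : T -> \bar R) :
  measurable_fun setT f -> (forall x, 0 <= f x) ->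
  \int[nu]_x f x = \int[mu]_x (f x * (g x)%:E).
Proof.
move=> mf f0; pose f_ := nnsfun_approx measurableT mf.
have cvgf x : (f_ n x)%:E @[n --> \oo] --> f x by exact: cvg_nnsfun_approx.
have ndf x m n : (m <= n)%N -> (f_ m x <= f_ n x)%R.
  by move=> mn; exact/lefP/nd_nnsfun_approx.
transitivity (limn (fun n => \int[nu]_x (f_ n x)%:E)).
  rewrite -monotone_convergence//.
  - by apply: eq_integral => x _; apply/esym/cvg_lim => //; exact: cvgf.
  - by move=> n; exact/measurable_EFinP/measurable_funP.
  - by move=> n x _; rewrite lee_fin.
  - by move=> x _ m n mn; rewrite lee_fin ndf.
transitivity (limn (fun n => \int[mu]_x ((f_ n x)%:E * (g x)%:E))); last first.
  rewrite -monotone_convergence//.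
  - apply: eq_integral => x _; apply/cvg_lim => //.
    by apply: cvgeZr => //; exact: cvgf.
  - by move=> n; apply: emeasurable_funM; apply/measurable_EFinP => //; exact/measurable_funP.
  - by move=> n x _; rewrite mule_ge0 ?lee_fin.
  - by move=> x _ m n mn; rewrite lee_wpmul2r ?lee_fin ?ndf.
congr (limn _); apply/funext => n.
under eq_integral do rewrite fimfunE -fsumEFin//.
under [RHS]eq_integral.
  move=> x _; rewrite fimfunE -fsumEFin// ge0_mule_fsuml//; last first.
    by move=> r; rewrite nnfun_muleindic_ge0.
  over.
rewrite ge0_integral_fsum//; last 2 first.
- by move=> y; exact/measurable_EFinP/measurable_funM.
- by move=> y x _; rewrite nnfun_muleindic_ge0.
rewrite ge0_integral_fsum//; last 2 first.
- move=> y; apply: emeasurable_funM; last exact/measurable_EFinP.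
  exact/measurable_EFinP/measurable_funM.
- by move=> y x _; rewrite mule_ge0 ?lee_fin//;
    have := nnfun_muleindic_ge0 (f_ n) y x; rewrite -EFinM lee_fin.
apply: eq_fsbigr => r rf.
have r0 : (0 <= r)%R by move: rf; rewrite inE => -[x _ <-].
have mr : measurable (f_ n @^-1` [set r]) by exact: measurable_sfunP.
rewrite integralZl_indic_nnsfun// integral_indic// setIT nuE//.
under [RHS]eq_integral do rewrite EFinM -muleA.
rewrite ge0_integralZl//; last 2 first.
- by apply: emeasurable_funM; exact/measurable_EFinP.
- by move=> x _; rewrite mule_ge0 ?lee_fin.
congr (_ * _); rewrite [LHS]integral_mkcond; apply: eq_integral => x _.
by rewrite epatch_indic muleC.
Qed.

End integral_density.

Section integral_tuple.
Local Open Scope ereal_scope.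
Context d (T : measurableType d) (R : realType).
Variable mu : {sigma_finite_measure set T -> \bar R}.

Lemma ge0_integral_tuple_measureS n (f : n.+1.-tuple T -> \bar R) :
  measurable_fun setT f -> (forall z, 0 <= f z) ->
  \int[tuple_measure mu n.+1]_z f z =
  \int[mu]_x \int[tuple_measure mu n]_z f [tuple of x :: z].
Proof.
move=> mf f0.
have mc := @measurable_tuple_cons d T n.
rewrite -(fubini_tonelli1 (f \o @tuple_cons T n)); last 2 first.
- exact: measurableT_comp.
- by move=> x; exact: f0.
rewrite -[RHS](ge0_integral_pushforward mc (mu \x tuple_measure mu n) measurableT mf)//.
Qed.

Lemma integral_tuple_measure0 (f : 0.-tuple T -> \bar R) :
  \int[tuple_measure mu 0]_z f z = f [tuple].
Proof.
have -> : f = cst (f [tuple]) by apply/funext => z; rewrite tuple0.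
by rewrite /= integral_dirac// diracT mul1e.
Qed.

Lemma ge0_integral_tuple_measure1 (f : 1.-tuple T -> \bar R) :
  measurable_fun setT f -> (forall z, 0 <= f z) ->
  \int[tuple_measure mu 1]_z f z = \int[mu]_x f [tuple x].
Proof.
move=> mf f0; rewrite ge0_integral_tuple_measureS//.
apply: eq_integral => x _; rewrite integral_tuple_measure0.
by congr f; exact: val_inj.
Qed.

Lemma ge0_integral_tuple_measure2 (f : 2.-tuple T -> \bar R) :
  measurable_fun setT f -> (forall z, 0 <= f z) ->
  \int[tuple_measure mu 2]_z f z = \int[mu]_x \int[mu]_y f [tuple x; y].
Proof.
move=> mf f0; rewrite ge0_integral_tuple_measureS//.
apply: eq_integral => x _; rewrite ge0_integral_tuple_measure1//; last first.
  by apply: measurableT_comp => //; exact: measurable_cons.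
Qed.

End integral_tuple.

(** * Affine changes of variables *)

Section lebesgue_affine.
Context {R : realType}.
Local Notation mu := (@lebesgue_measure R).

Lemma measurable_affine (a b : R) :
  measurable_fun setT (fun x : measurableTypeR R => a * x + b : measurableTypeR R).
Proof.
by apply: measurable_funD => //; apply: measurable_funM.
Qed.

(** Both sides are measures that agree on half-open intervals, and these determine Lebesgue
    measure. *)
Lemma lebesgue_measure_affine (a b : R) (A : set (measurableTypeR R)) : 0 < a ->
  measurable A ->
  (a%:E * pushforward mu (fun x => (a * x + b)%R : measurableTypeR R) A = mu A)%E.
Proof.
move=> a0 mA.
pose m1 := pushforward mu (fun x => a * x + b : measurableTypeR R).
pose m2 := mscale (NngNum (ltW a0)) m1.
have mab := measurable_affine a b.
rewrite -[LHS]/(m2 mab A); apply/esym/lebesgue_measure_unique => // _ [[u v] _ <-]/=.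
rewrite /m2 /mscale/= /m1 /pushforward/=.
have -> : (fun x => a * x + b) @^-1` `]u, v]%classic =
    `](u - b) / a, (v - b) / a]%classic.
  apply/seteqP; split => x/=; rewrite !in_itv/=.
    by rewrite ltr_pdivrMr// ler_pdivlMr// ltrBlDr lerBrDr mulrC.
  by rewrite ltr_pdivrMr// ler_pdivlMr// ltrBlDr lerBrDr mulrC.
rewrite !lebesgue_measure_itv/= !lte_fin ltr_pM2r ?invr_gt0// ltrD2r.
case: ifPn => uv; last by rewrite mule0.
rewrite -!EFinD -EFinM; congr (_%:E).
by field; rewrite gt_eqF.
Qed.

Lemma ge0_integral_affine1 (a b : R) (f : measurableTypeR R -> \bar R) : 0 < a ->
  measurable_fun setT f -> (forall x, 0 <= f x)%E ->
  (a%:E * \int[mu]_x f (a * x + b)%R = \int[mu]_x f x)%E.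
Proof.
move=> a0 mf f0.
have mab := measurable_affine a b.
rewrite -[X in (_ * X)%E](ge0_integral_pushforward mab mu measurableT mf)//.
rewrite -(@ge0_integral_mscale _ _ _ _ setT measurableT (NngNum (ltW a0)))//.
apply: eq_measure_integral => A mA _.
exact: lebesgue_measure_affine.
Qed.

End lebesgue_affine.

Section euclid_affine.
Context {R : realType}.

(** One map serves as dilation ([b = vzero]), as translation ([a = 1]) and, with [a] varying, as the
    parametrisation of a ray. *)
Definition affine_map d (a : R) (b x : euclid R d) : euclid R d :=
  [tuple a * tnth x i + (tnth b i : R) | i < d].

Lemma measurable_affine_map d (a : R) (b : euclid R d) :
  measurable_fun setT (affine_map a b).
Proof.
apply/measurable_fun_tnthP => i.
rewrite (_ : _ \o _ = (fun x : measurableTypeR R => a * x + tnth b i) \o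
   (fun x : euclid R d => tnth x i)).
  apply: measurableT_comp; first exact: measurable_affine.
  exact: measurable_tnth.
by apply/funext => x /=; rewrite tnth_mktuple.
Qed.

(** Tonelli peels off the first coordinate, and each coordinate contributes one factor [a]. *)
Lemma ge0_integral_affine_map d (a : R) (b : euclid R d) (f : euclid R d -> \bar R) :
  0 < a -> measurable_fun setT f -> (forall x, 0 <= f x)%E ->
  ((a ^+ d)%:E * \int[leb]_x f (affine_map a b x) = \int[leb]_x f x)%E.
Proof.
move=> a0; elim: d b f => [|d IH] b f mf f0.
  rewrite expr0 mul1e /leb !integral_tuple_measure0.
  by congr f; rewrite [LHS]tuple0.
rewrite /leb ge0_integral_tuple_measureS//; last first.
  by apply: measurableT_comp => //; exact: measurable_affine_map.
rewrite [RHS]ge0_integral_tuple_measureS//.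
rewrite -/leb exprS EFinM -muleA.
pose g (x : measurableTypeR R) := (\int[@leb R d]_z f [tuple of x :: z])%E.
have mfc : measurable_fun setT (fun p : measurableTypeR R * euclid R d => f (tuple_cons p)).
  by apply: measurableT_comp => //; exact: measurable_tuple_cons.
have mg : measurable_fun setT g.
  apply: (measurable_fun_fubini_tonelli_F (fun p : measurableTypeR R * euclid R d => f (tuple_cons p)))=> //.
have g0 x : (0 <= g x)%E by apply: integral_ge0 => z _.
rewrite -[RHS](@ge0_integral_affine1 _ a (thead b) g)//; congr (_ * _)%E.
have mcons x : measurable_fun setT (fun z : euclid R d => f [tuple of x :: z]).
  by apply: (measurableT_comp mf); exact: measurable_cons.
rewrite -ge0_integralZl//; last first.
- by rewrite lee_fin exprn_ge0// ltW.
- move=> x _; exact: integral_ge0.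
- rewrite (_ : (fun x => _) = fun x => (\int[@leb R d]_z
      (f \o affine_map a b \o @tuple_cons _ d) (x, z))%E)//.
  apply: (measurable_fun_fubini_tonelli_F (f \o affine_map a b \o @tuple_cons _ d)).
    apply: measurableT_comp; last exact: measurable_tuple_cons.
    by apply: measurableT_comp => //; exact: measurable_affine_map.
  by move=> z; exact: f0.
apply: eq_integral => x _.
have -> : (\int[leb]_z f (affine_map a b [tuple of x :: z]) =
   \int[leb]_z f [tuple of (a * x + thead b)%R :: affine_map a [tuple of behead b] z])%E.
  apply: eq_integral => z _; congr f; apply: eq_from_tnth => i.
  rewrite tnth_mktuple; case: (unliftP ord0 i) => [j|] ->.
    have -> : tnth b (lift ord0 j) = tnth [tuple of behead b] j.
      by rewrite [in LHS](tuple_eta b) tnthS.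
    by rewrite [in LHS]tnthS [RHS]tnthS tnth_mktuple.
  by rewrite !tnth0; congr (_ + _).
by rewrite (IH [tuple of behead b] (fun z => f [tuple of (a * x + thead b)%R :: z])).
Qed.

Lemma ge0_integral_scale d (a : R) (f : euclid R d -> \bar R) :
  0 < a -> measurable_fun setT f -> (forall x, 0 <= f x)%E ->
  ((a ^+ d)%:E * \int[leb]_x f (affine_map a vzero x) = \int[leb]_x f x)%E.
Proof. exact: ge0_integral_affine_map. Qed.

Lemma ge0_integral_translate d (b : euclid R d) (f : euclid R d -> \bar R) :
  measurable_fun setT f -> (forall x, 0 <= f x)%E ->
  (\int[leb]_x f (affine_map 1 b x) = \int[leb]_x f x)%E.
Proof.
by move=> mf f0; rewrite -[RHS](ge0_integral_affine_map b ltr01)// expr1n mul1e.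
Qed.

End euclid_affine.

Section euclid_geometry.
Context {R : realType} {d : nat}.
Implicit Types (x y z : euclid R d).

Lemma vsubE x y i : tnth (vsub x y) i = (tnth x i : R) - tnth y i.
Proof. by rewrite tnth_mktuple. Qed.

Lemma vsub0 x : vsub x vzero = x.
Proof. by apply: eq_from_tnth => i; rewrite vsubE tnth_mktuple subr0. Qed.

Lemma vsubxx x : vsub x x = vzero.
Proof. by apply: eq_from_tnth => i; rewrite vsubE subrr tnth_mktuple. Qed.

Lemma dotvC x y : dotv x y = dotv y x.
Proof. by apply: eq_bigr => i _; rewrite mulrC. Qed.

Lemma dotv_affine (a : R) (b x y : euclid R d) :
  dotv x (affine_map a b y) = a * dotv x y + dotv x b.
Proof.
rewrite /dotv mulr_sumr -big_split/=; apply: eq_bigr => i _.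
by rewrite tnth_mktuple mulrDr mulrCA.
Qed.

Lemma dotv0 x : dotv x vzero = 0.
Proof. by rewrite /dotv big1// => i _; rewrite tnth_mktuple mulr0. Qed.

Lemma dotv_vsub x y z : dotv (vsub x y) z = dotv x z - dotv y z.
Proof. by rewrite /dotv -sumrB; apply: eq_bigr => i _; rewrite vsubE mulrBl. Qed.

Lemma dotvv_ge0 x : 0 <= dotv x x.
Proof. by apply: sumr_ge0 => i _; rewrite -expr2 sqr_ge0. Qed.

Lemma enorm_ge0 x : 0 <= enorm x. Proof. exact: sqrtr_ge0. Qed.

Lemma sqr_enorm x : enorm x ^+ 2 = dotv x x.
Proof. by rewrite sqr_sqrtr// dotvv_ge0. Qed.

Lemma enorm_scale (a : R) x : 0 <= a -> enorm (affine_map a vzero x) = a * enorm x.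
Proof.
move=> a0; rewrite /enorm dotv_affine dotv0 addr0 dotvC dotv_affine dotv0 addr0.
by rewrite mulrA sqrtrM ?mulr_ge0// -expr2 sqrtr_sqr ger0_norm.
Qed.

Lemma enorm_vsubC x y : enorm (vsub x y) = enorm (vsub y x).
Proof.
by congr Num.sqrt; apply: eq_bigr => i _; rewrite !vsubE -[RHS]mulrNN !opprB.
Qed.

Lemma sqr_enorm_affine1 x y :
  enorm (affine_map 1 y x) ^+ 2 <= 2 * (enorm x ^+ 2 + enorm y ^+ 2).
Proof.
rewrite !sqr_enorm /dotv -big_split/= mulr_sumr ler_sum// => i _.
rewrite tnth_mktuple mul1r; have := sqr_ge0 ((tnth x i : R) - tnth y i).
by move: (tnth x i : R) (tnth y i : R) => u v; nra.
Qed.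

Lemma enorm_box x (r : R) : 0 <= r -> (forall i, `|tnth x i : R| <= r) ->
  enorm x ^+ 2 <= d%:R * r ^+ 2.
Proof.
move=> r0 xr; rewrite sqr_enorm /dotv.
apply: (@le_trans _ _ (\sum_(i < d) r ^+ 2)).
  by apply: ler_sum => i _; rewrite -expr2 -real_normK ?num_real// lerXn2r// nnegrE.
by rewrite sumr_const card_ord -[leLHS]mulr_natl.
Qed.

Lemma ler_norm_enorm x i : `|tnth x i : R| <= enorm x.
Proof.
rewrite -sqrtr_sqr /enorm ler_wsqrtr// /dotv (bigD1 i)//= -expr2 lerDl.
by apply: sumr_ge0 => j _; rewrite -expr2 sqr_ge0.
Qed.

(* A crude substitute for Cauchy-Schwarz. *)
Lemma dotv_le x y : `|dotv x y| <= (d%:R * enorm x) * enorm y.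
Proof.
apply: le_trans (ler_norm_sum _ _ _) _.
apply: (@le_trans _ _ (\sum_(i < d) enorm x * enorm y)).
  by apply: ler_sum => i _; rewrite normrM ler_pM// ler_norm_enorm.
by rewrite sumr_const card_ord -[leLHS]mulr_natl mulrA.
Qed.

Lemma measurable_fun_dotv d' (T : measurableType d') (f g : T -> euclid R d) :
  measurable_fun setT f -> measurable_fun setT g ->
  measurable_fun setT (fun t => dotv (f t) (g t)).
Proof.
move=> mf mg; apply: measurable_sum => i; apply: measurable_funM.
- by apply: (measurableT_comp (measurable_tnth i)).
- by apply: (measurableT_comp (measurable_tnth i)).
Qed.

Lemma measurable_fun_vsub d' (T : measurableType d') (f g : T -> euclid R d) :
  measurable_fun setT f -> measurable_fun setT g ->
  measurable_fun setT (fun t => vsub (f t) (g t)).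
Proof.
move=> mf mg; apply/measurable_fun_tnthP => i.
rewrite (_ : _ \o _ = fun t => (tnth (f t) i : R) - (tnth (g t) i : R)); last first.
  by apply/funext => p /=; rewrite vsubE.
apply: measurable_funB.
- by apply: (measurableT_comp (measurable_tnth i)).
- by apply: (measurableT_comp (measurable_tnth i)).
Qed.

Lemma measurable_enorm : measurable_fun setT (@enorm R d).
Proof.
rewrite (_ : enorm = (fun x : euclid R d => dotv x x `^ 2^-1)); last first.
  by apply/funext => x; rewrite powR12_sqrt// dotvv_ge0.
apply: (measurableT_comp (measurable_powR _)).
exact: measurable_fun_dotv.
Qed.

(** Boxes with lower corner [c] stand in for balls wherever a set of known positive measure is
    needed. *)
Lemma leb_box (r : R) (c : euclid R d) : 0 < r ->
  leb [set x : euclid R d | forall i, tnth c i <= (tnth x i : R) <= tnth c i + r] =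
  (r ^+ d)%:E.
Proof.
move=> r0.
pose A (i : 'I_d) : set (measurableTypeR R) := `[(tnth c i : R), (tnth c i : R) + r]%classic.
rewrite -[LHS]/(leb [set x : euclid R d | forall i, A i (tnth x i)]).
rewrite /leb tuple_measure_box.
  transitivity (\prod_(i < d) r%:E)%E.
    apply: eq_bigr => i _.
    rewrite [LHS]lebesgue_measure_itv/= lte_fin ltrDl r0 -EFinD.
    by congr EFin; ring.
  by rewrite prodEFin prodr_const card_ord.
by move=> i; exact: measurable_itv.
Qed.

Lemma measurable_box (r : R) (c : euclid R d) :
  measurable [set x : euclid R d | forall i, tnth c i <= (tnth x i : R) <= tnth c i + r].
Proof.
rewrite (_ : [set _ | _] = \bigcap_(i in [set: 'I_d])
    ((fun z : euclid R d => tnth z i) @^-1` `[(tnth c i : R), (tnth c i : R) + r]%classic)).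
  apply: fin_bigcap_measurable; first exact: finite_finset.
  move=> i _; rewrite -[X in measurable X]setTI.
  by apply: measurable_tnth => //; exact: measurable_itv.
apply/seteqP; split => x /= H i; first by move=> _; rewrite /= in_itv/= H.
by have := H i I; rewrite /= in_itv.
Qed.

End euclid_geometry.

(** * The heat kernel *)

Section rel_symbol_theory.
Context {R : realType} {d : nat}.
Variables (alpha m : R).
Hypothesis alpha02 : 0 < alpha < 2.
Hypothesis m0 : 0 < m.
Implicit Types (x y z xi : euclid R d).
Local Notation psi := (@rel_symbol R d alpha m).

Let a0 : 0 < alpha. Proof. by case/andP: alpha02. Qed.

Lemma powR_mass : (m `^ (2 / alpha)) `^ (alpha / 2) = m.
Proof.
rewrite -powRrM (_ : _ * _ = 1) ?powRr1 ?ltW//.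
by field; rewrite gt_eqF.
Qed.

Lemma enorm_sqr_powR xi : (enorm xi ^+ 2) `^ (alpha / 2) = enorm xi `^ alpha.
Proof.
rewrite -powR_mulrn ?enorm_ge0// -powRrM; congr (_ `^ _); by field.
Qed.

Lemma powR_subadd (a b s : R) : 0 <= a -> 0 <= b -> 0 < s <= 1 ->
  (a + b) `^ s <= a `^ s + b `^ s.
Proof.
move=> a_ge0 b_ge0 /andP[s0 s1].
have [ab0|ab0] := eqVneq (a + b) 0.
  by rewrite ab0 powR0 ?gt_eqF// addr_ge0// powR_ge0.
have abp : 0 < a + b by rewrite lt_neqAle eq_sym ab0 addr_ge0.
have key (u : R) : 0 <= u -> u <= a + b -> u / (a + b) <= (u / (a + b)) `^ s.
  rewrite le_eqVlt => /predU1P[<- _|u0 uab]; first by rewrite mul0r powR_ge0.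
  rewrite -{1}[u / (a + b)]powRr1 ?divr_ge0 ?(ltW u0) ?(ltW abp)//.
  by apply: ger_powR => //; rewrite divr_gt0//= ler_pdivrMr// mul1r.
have ka := key _ a_ge0 ltac:(by rewrite lerDl).
have kb := key _ b_ge0 ltac:(by rewrite lerDr).
have E (u : R) : 0 <= u -> u `^ s = (u / (a + b)) `^ s * (a + b) `^ s.
  move=> u0; rewrite -powRM ?divr_ge0 ?(ltW abp)//.
  by rewrite divfK// gt_eqF.
rewrite (E a)// (E b)// -mulrDl -[leLHS]mul1r ler_wpM2r ?powR_ge0//.
apply: le_trans (lerD ka kb).
by rewrite -mulrDl divff// gt_eqF.
Qed.

Lemma rel_symbol_ge0 xi : 0 <= psi xi.
Proof.
rewrite subr_ge0 -{1}powR_mass ge0_ler_powR ?nnegrE ?powR_ge0 ?addr_ge0 ?sqr_ge0//.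
- by rewrite ltW// divr_gt0.
- by rewrite powR_ge0.
- by rewrite lerDr sqr_ge0.
Qed.

(** Subadditivity of the power [alpha / 2 < 1], which splits off the mass term [m]. With
    [rel_symbol_ge] it makes the weight [exp(-h psi)] comparable to the stable weight, with ratio
    between 1 and [exp(h m)]. *)
Lemma rel_symbol_le xi : psi xi <= enorm xi `^ alpha.
Proof.
rewrite lerBlDr -{2}powR_mass -enorm_sqr_powR.
apply: powR_subadd; rewrite ?sqr_ge0 ?powR_ge0//.
by case/andP: alpha02 => _ a2; rewrite divr_gt0//= ler_pdivrMr// mul1r ltW.
Qed.

Lemma rel_symbol_ge xi : enorm xi `^ alpha <= psi xi + m.
Proof.
rewrite subrK -enorm_sqr_powR ge0_ler_powR ?nnegrE ?sqr_ge0 ?addr_ge0 ?sqr_ge0 ?powR_ge0//.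
- by rewrite ltW// divr_gt0.
- by rewrite lerDl powR_ge0.
Qed.

(** This confines the weight at large times to frequencies near 0. *)
Lemma rel_symbol_coercive (delta : R) : 0 < delta ->
  exists2 a : R, 0 < a & forall xi, psi xi <= a -> enorm xi <= delta.
Proof.
move=> d0; pose b := m `^ (2 / alpha).
(* The witness is the value of [psi] on the sphere of radius [delta]; [psi] increases strictly with
   the norm. *)
exists ((delta ^+ 2 + b) `^ (alpha / 2) - m).
  rewrite subr_gt0 -{1}powR_mass gt0_ltr_powR ?nnegrE ?powR_ge0 ?addr_ge0 ?sqr_ge0 ?powR_ge0//.
  - by rewrite divr_gt0.
  - by rewrite ltrDr exprn_gt0.
move=> xi; rewrite lerD2r => le; rewrite leNgt; apply/negP => lt.
suff : (delta ^+ 2 + b) `^ (alpha / 2) < (enorm xi ^+ 2 + b) `^ (alpha / 2).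
  by rewrite ltNge le.
rewrite gt0_ltr_powR ?nnegrE ?addr_ge0 ?sqr_ge0 ?powR_ge0//.
- by rewrite divr_gt0.
- by rewrite ltrD2r ltrXn2r ?nnegrE ?ltW ?enorm_ge0.
Qed.

Lemma measurable_rel_symbol : measurable_fun setT psi.
Proof.
apply: measurable_funB => //.
apply: (measurableT_comp (measurable_powR _)).
apply: measurable_funD => //; apply: measurable_funX.
exact: measurable_enorm.
Qed.

End rel_symbol_theory.

Section heat_kernel_measurability.
Context {R : realType} {d : nat}.
Variables (alpha m : R).
Local Notation psi := (@rel_symbol R d alpha m).
Local Notation p := (@heat_kernel R d alpha m).

Lemma measurable_cos : measurable_fun setT (@cos R).
Proof. exact: continuous_measurable_fun (@continuous_cos R). Qed.

Lemma measurable_heat_integrand d' (T : measurableType d') (f : T -> R)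
    (g h : T -> euclid R d) :
  measurable_fun setT f -> measurable_fun setT g -> measurable_fun setT h ->
  measurable_fun setT (fun t => cos (dotv (g t) (h t)) * expR (- f t * psi (h t))).
Proof.
move=> mf mg mh; apply: measurable_funM.
  by apply: (measurableT_comp measurable_cos); exact: measurable_fun_dotv.
apply: (measurableT_comp (@measurable_expR R)); apply: measurable_funM.
  by apply: measurableT_comp.
by apply: (measurableT_comp (measurable_rel_symbol alpha m)).
Qed.

Lemma measurable_fun_heat_kernel d' (T : measurableType d') (f : T -> R)
    (g : T -> euclid R d) :
  measurable_fun setT f -> measurable_fun setT g ->
  measurable_fun setT (fun t => p (f t) (g t)).
Proof.
move=> mf mg; apply: measurable_funM => //.
pose F (q : T * euclid R d) : \bar R := (cos (dotv (g q.1) q.2) * expR (- f q.1 * psi q.2))%:E.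
have mF : measurable_fun setT F.
  apply/measurable_EFinP; apply: measurable_heat_integrand => //.
  - exact: measurableT_comp.
  - exact: measurableT_comp.
apply: (measurableT_comp (fine_measurable measurableT)).
rewrite (_ : (fun t => _) = (fun t => \int[leb]_xi F^\+ (t, xi) - \int[leb]_xi F^\- (t, xi))%E).
  apply: emeasurable_funB.
  - apply: (measurable_fun_fubini_tonelli_F F^\+%E) => //.
    exact: measurable_funepos.
  - apply: (measurable_fun_fubini_tonelli_F F^\-%E) => //.
    exact: measurable_funeneg.
apply/funext => t; rewrite [LHS]integralE; congr (_ - _)%E.
- by apply: eq_integral => xi _; rewrite !funeposE.
- by apply: eq_integral => xi _; rewrite !funenegE.
Qed.

End heat_kernel_measurability.

(** * Consequences of the unit mass of bridge marginals *)

Section chapman_kolmogorov.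
Context {R : realType} {d : nat}.
Variables (alpha m : R).
Hypothesis alpha02 : 0 < alpha < 2.
Hypothesis m0 : 0 < m.
Implicit Types (x y z xi : euclid R d) (s t u h : R).
Local Notation psi := (@rel_symbol R d alpha m).
Local Notation p := (@heat_kernel R d alpha m).
Local Notation w := (fun t xi => expR (- t * psi xi)).
Local Notation kappa := (((2 * pi) ^+ d)^-1 : R).

Hypothesis bridge_mass1 : forall t s x y, 0 < s < t ->
  (\int[leb]_z ((p t (vsub x y))^-1 *
     (p s (vsub z x) * p (t - s) (vsub y z)))%:E = 1)%E.

Let a0 : 0 < alpha. Proof. by case/andP: alpha02. Qed.
Let kappa0 : 0 < kappa. Proof. by rewrite invr_gt0 exprn_gt0// mulr_gt0// pi_gt0. Qed.
Let psi0 xi : 0 <= psi xi. Proof. exact: rel_symbol_ge0. Qed.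

(** Inversion sends 0 to 0, so a zero of [p t] at [y] would make the marginal density of the bridge
    from [y] to the origin vanish identically, against its mass 1. *)
Lemma heat_kernel_neq0 t y : 0 < t -> p t y != 0.
Proof.
move=> t0; apply/eqP => pty.
have := @bridge_mass1 t (t / 2) y vzero.
rewrite vsub0 pty invr0 => /(_ _)/wrap[].
  by apply/andP; split; lra.
under eq_integral do rewrite mul0r.
by rewrite integral0 => /eqP; rewrite eqe eq_sym oner_eq0.
Qed.

Lemma measurable_weight t : measurable_fun setT (w t : euclid R d -> R).
Proof.
apply: (measurableT_comp (@measurable_expR R)); apply: measurable_funM => //.
exact: measurable_rel_symbol.
Qed.

(** [fine] sends [+oo] to 0, so a divergent integral would give [p t vzero = 0]. Integrability is
    read off the existence of bridges instead of being computed. *)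
Lemma integrable_weight t : 0 < t -> leb.-integrable setT (EFin \o w t).
Proof.
move=> t0; apply/integrableP; split.
  by apply/measurable_EFinP; exact: measurable_weight.
rewrite ltey; apply/eqP => woo.
have := heat_kernel_neq0 (vzero : euclid R d) t0; rewrite /heat_kernel /Rintegral.
have -> : (\int[leb]_xi (cos (dotv vzero xi) * expR (- t * psi xi))%:E = +oo)%E.
  rewrite -woo; apply: eq_integral => xi _.
  by rewrite dotvC dotv0 cos0 mul1r/= ger0_norm// expR_ge0.
by rewrite mulr0 eqxx.
Qed.

Lemma integrable_cos_weight t x : 0 < t ->
  leb.-integrable setT (EFin \o (fun xi => cos (dotv x xi) * w t xi)).
Proof.
move=> t0; apply: (le_integrable _ _ _ (integrable_weight t0)) => //.
  by apply/measurable_EFinP; exact: measurable_heat_integrand.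
move=> xi _ /=; rewrite lee_fin normrM ler_piMl//.
exact: cos_max.
Qed.

Lemma integrable_1Bcos_weight t x : 0 < t ->
  leb.-integrable setT (EFin \o (fun xi => (1 - cos (dotv x xi)) * w t xi)).
Proof.
move=> t0.
have := integrableB measurableT (integrable_weight t0) (integrable_cos_weight x t0).
apply: eq_integrable => // xi _ /=.
by rewrite -EFinB mulrBl mul1r.
Qed.

Lemma heat_kernel0E t : p t vzero = kappa * \int[leb]_xi w t xi.
Proof.
congr (_ * _); apply: eq_Rintegral => xi _.
by rewrite dotvC dotv0 cos0 mul1r.
Qed.

Lemma heat_kernel0B t x : 0 < t ->
  p t vzero - p t x = kappa * \int[leb]_xi ((1 - cos (dotv x xi)) * w t xi).
Proof.
move=> t0; rewrite heat_kernel0E /heat_kernel -mulrBr; congr (_ * _).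
rewrite -RintegralB//; [|exact: integrable_weight|exact: integrable_cos_weight].
by apply: eq_Rintegral => xi _; rewrite mulrBl mul1r.
Qed.

Lemma heat_kernel0_gt0 t : 0 < t -> 0 < p t vzero.
Proof.
move=> t0; rewrite lt_neqAle eq_sym heat_kernel_neq0// heat_kernel0E.
rewrite mulr_ge0 ?(ltW kappa0)//=; apply: Rintegral_ge0 => xi _; exact: expR_ge0.
Qed.

Lemma heat_kernel_le0 t x : 0 < t -> p t x <= p t vzero.
Proof.
move=> t0; rewrite -subr_ge0 heat_kernel0B// mulr_ge0 ?(ltW kappa0)//.
apply: Rintegral_ge0 => xi _; rewrite mulr_ge0 ?expR_ge0// subr_ge0 cos_le1.
Qed.

(** Dominated convergence with the weight as dominating function. The open interval is only meant to
    contain [0, 1], where the intermediate value theorem is applied. *)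
Lemma continuous_heat_kernel_ray t x : 0 < t ->
  {in `]-1, 2[%classic, continuous (fun r : R => p t (affine_map r vzero x))}.
Proof.
move=> t0 r rI.
have E r' : p t (affine_map r' vzero x) =
    kappa * \int[leb]_xi (cos (r' * dotv x xi) * w t xi).
  congr (_ * _); apply: eq_Rintegral => xi _.
  by rewrite dotvC dotv_affine dotv0 addr0 dotvC.
rewrite (_ : (fun _ => _) = (fun r' => kappa * \int[leb]_xi (cos (r' * dotv x xi) * w t xi))); last first.
  by apply/funext => r'; rewrite E.
apply: cvgM; first exact: cvg_cst.
apply: (continuity_under_integral measurableT _ _ (integrable_weight t0) _ rI).
- move=> r' _; have := integrable_cos_weight (affine_map r' vzero x) t0.
  apply: eq_integrable => // xi _ /=.
  by rewrite dotvC dotv_affine dotv0 addr0 dotvC.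
- apply/aeW => xi _ r' _; apply: cvgM; last exact: cvg_cst.
  apply: (@continuous_comp _ _ _ (fun l : R => l * dotv x xi) (@cos R)).
    by apply: cvgM; [exact: cvg_id|exact: cvg_cst].
  exact: continuous_cos.
- move=> r' _; apply/aeW => xi _.
  by rewrite normrM (ger0_norm (expR_ge0 _)) ler_piMl ?expR_ge0// cos_max.
Qed.

Lemma heat_kernel_gt0 t x : 0 < t -> 0 < p t x.
Proof.
move=> t0; rewrite ltNge; apply/negP => ptx.
pose f r := p t (affine_map r vzero x).
have f0 : f 0 = p t vzero.
  by congr p; apply: eq_from_tnth => i; rewrite !tnth_mktuple mul0r add0r.
have f1 : f 1 = p t x.
  by congr p; apply: eq_from_tnth => i; rewrite !tnth_mktuple mul1r addr0.
have cf : {within `[0, 1], continuous f}.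
  apply: continuous_in_subspaceT => r; rewrite inE/= in_itv/= => /andP[r0 r1].
  apply: continuous_heat_kernel_ray => //; rewrite inE/= in_itv/=.
  by apply/andP; split; lra.
have [|c _ fc] := IVT (v := 0) ler01 cf.
  rewrite f0 f1; have p0 := heat_kernel0_gt0 t0.
  by rewrite ge_min ptx orbT/= le_max (ltW p0).
by have := heat_kernel_neq0 (affine_map c vzero x) t0; rewrite -/(f c) fc eqxx.
Qed.

Lemma heat_kernel_sym t x y : p t (vsub x y) = p t (vsub y x).
Proof.
congr (_ * _); apply: eq_Rintegral => xi _.
by rewrite !dotv_vsub -cosN opprB.
Qed.

Lemma heat_kernel0_anti s t : 0 < s -> s <= t -> p t vzero <= p s vzero.
Proof.
move=> s0 st; have t0 := lt_le_trans s0 st.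
rewrite !heat_kernel0E ler_pM2l//; apply: le_Rintegral => //.
- exact: integrable_weight.
- exact: integrable_weight.
- by move=> xi _; rewrite ler_expR !mulNr lerN2 ler_wpM2r.
Qed.

Lemma heat_kernel_CK t s x y : 0 < s < t ->
  (\int[leb]_z (p s (vsub z x) * p (t - s) (vsub y z))%:E = (p t (vsub x y))%:E)%E.
Proof.
move=> st; have t0 : 0 < t by case/andP: st; exact: lt_trans.
have := bridge_mass1 x y st.
under eq_integral do rewrite EFinM.
rewrite ge0_integralZl//.
- move=> /(congr1 (fun e => (p t (vsub x y))%:E * e)%E); rewrite mule1 muleA -EFinM.
  by rewrite divff ?heat_kernel_neq0// mul1e.
- apply/measurable_EFinP; apply: measurable_funM.
    by apply: measurable_fun_heat_kernel => //; exact: measurable_fun_vsub.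
  by apply: measurable_fun_heat_kernel => //; exact: measurable_fun_vsub.
- move=> z _; case/andP: st => s0 st.
  by rewrite lee_fin mulr_ge0// ltW// heat_kernel_gt0// subr_gt0.
- by rewrite lee_fin invr_ge0 ltW// heat_kernel_gt0.
Qed.

(* [p n y / p n 0] tends to 1 because the weight concentrates at frequency 0. *)
Lemma cvg_heat_kernel_ratio y :
  (fun n : nat => p n.+1%:R y / p n.+1%:R vzero) @ \oo --> (1 : R).
Proof.
pose c : R := d%:R * enorm y + 1.
have c0 : 0 < c by rewrite ltr_wpDl// mulr_ge0// enorm_ge0.
apply/cvgrPdist_le => e e0.
have [eta eta0 ceta] : exists2 eta : R, 0 < eta &
    forall v : R, `|v| <= eta -> 1 - cos v <= e / 2.
  have e20 : 0 < e / 2 by rewrite divr_gt0.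
  have /cvgrPdist_le/(_ _ e20) := @continuous_cos R 0.
  case/nbhs_ballP => r /= r0 H; exists (r / 2); first by rewrite divr_gt0.
  move=> v vr; have : ball (0 : R) r v.
    rewrite /ball/= sub0r normrN (le_lt_trans vr)// ltr_pdivrMr// ltr_pMr// ltr1n//.
  by move=> /H /=; rewrite cos0 => /(le_trans (ler_norm _)).
(* Where [psi <= a], the frequency is so small that [1 - cos] is at most [e / 2]. *)
have [a a_gt0 Ha] := @rel_symbol_coercive R d _ _ alpha02 m0 _ (divr_gt0 eta0 c0).
have small xi : psi xi <= a -> 1 - cos (dotv y xi) <= e / 2.
  move=> /Ha xie; apply: ceta; apply: le_trans (dotv_le _ _) _.
  apply: (@le_trans _ _ (c * enorm xi)).
    by rewrite ler_wpM2r ?enorm_ge0// lerDl.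
  by rewrite mulrC -ler_pdivlMr.
(* With this side, every [xi] of the box has [|xi|^2 <= d r^2 <= (a / 2)^(2 / alpha)], hence
   [psi xi <= a / 2]. *)
pose r := (a / 2) `^ alpha^-1 / (d%:R + 1).
have r0 : 0 < r by rewrite divr_gt0// powR_gt0// divr_gt0.
pose B : set (euclid R d) :=
  [set x | forall i, tnth (vzero : euclid R d) i <= (tnth x i : R) <= tnth (vzero : euclid R d) i + r].
have psiB xi : B xi -> psi xi <= a / 2.
  move=> Bxi; apply: le_trans (rel_symbol_le _ m0 _) _ => //.
  apply: (@le_trans _ _ (((a / 2) `^ alpha^-1) `^ alpha)); last first.
    by rewrite -powRrM mulVf ?gt_eqF// powRr1// ltW// divr_gt0.
  rewrite ge0_ler_powR ?nnegrE ?enorm_ge0 ?powR_ge0 ?(ltW a0)//.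
  rewrite -(@ler_pXn2r _ 2) ?nnegrE ?enorm_ge0 ?powR_ge0//.
  apply: le_trans (enorm_box (ltW r0) _) _.
    move=> i; have := Bxi i; rewrite tnth_mktuple add0r => /andP[u0 ur].
    by rewrite ger0_norm.
  rewrite /r expr_div_n mulrCA ler_piMr ?sqr_ge0//.
  rewrite ler_pdivrMr ?exprn_gt0 ?ltr_wpDl// mul1r.
  by have : 0 <= d%:R :> R by []; nra.
(* [K] is the ratio that makes the high-frequency bound [2 exp(-n a) p_1(0)] equal to
   [K exp(-(n+1) a / 2)] times the lower bound for [p_(n+1)(0)] proved next. *)
pose K := 2 * expR a * p 1 vzero / (kappa * r ^+ d).
have K0 : 0 <= K.
  have p1 : 0 <= p 1 (vzero : euclid R d) by apply: ltW; exact: heat_kernel0_gt0.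
  apply: divr_ge0; first by rewrite mulr_ge0// mulr_ge0// expR_ge0.
  by apply: mulr_ge0; [exact: ltW|rewrite exprn_ge0// ltW].
have lower n : kappa * r ^+ d * expR (- n.+1%:R * (a / 2)) <= p n.+1%:R vzero.
  rewrite heat_kernel0E -mulrA ler_pM2l// -lee_fin.
  have iw := integrable_weight (ltr0Sn R n).
  rewrite [leRHS](fineK (integrable_fin_num measurableT iw)) EFinM muleC.
  rewrite -(leb_box vzero r0) -integral_cst; last exact: measurable_box.
  rewrite integral_mkcond; apply: ge0_le_integral => //.
  - move=> xi _; rewrite patchE; case: ifPn => // _.
    by rewrite lee_fin expR_ge0.
  - by apply/measurable_restrict => //; exact: measurable_box.
  - by apply/measurable_EFinP; exact: measurable_weight.
  - move=> xi _; rewrite patchE; case: ifPn => [/set_mem/psiB Bxi|_]; last first.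
      by rewrite lee_fin expR_ge0.
    by rewrite lee_fin ler_expR !mulNr lerN2 ler_wpM2l.
(* Frequencies with [psi > a] contribute at most [2 exp(-n a) w_1]: one of the [n + 1] units of time
   is kept for integrability. This decays like [exp(-n a)], while [p_(n+1)(0)] is at least of order
   [exp(-(n+1) a / 2)] because of the box where [psi <= a / 2]. *)
have upper n : p n.+1%:R vzero - p n.+1%:R y <=
    (e / 2 + K * expR (- n.+1%:R * (a / 2))) * p n.+1%:R vzero.
  rewrite mulrDl.
  apply: (@le_trans _ _ (e / 2 * p n.+1%:R vzero + 2 * expR (- n%:R * a) * p 1 vzero)).
    rewrite heat_kernel0B// !heat_kernel0E !(mulrCA _ kappa) -mulrDr ler_pM2l//.
    rewrite -!RintegralZl//; [|exact: integrable_weight..].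
    rewrite -RintegralD//; last 2 first.
    - exact: (integrableZl measurableT _ (integrable_weight _)).
    - exact: (integrableZl measurableT _ (integrable_weight _)).
    apply: le_Rintegral => //.
    - exact: integrable_1Bcos_weight.
    - have iZ k t : 0 < t -> leb.-integrable setT (EFin \o (fun xi => k * w t xi)).
        by move=> t0; exact: (integrableZl measurableT _ (integrable_weight t0)).
      by have := integrableD measurableT (iZ (e / 2) _ (ltr0Sn R n))
        (iZ (2 * expR (- n%:R * a)) _ ltr01); apply: eq_integrable.
    move=> xi _; have [pa|pa] := leP (psi xi) a.
      rewrite ler_wpDr ?mulr_ge0 ?expR_ge0// ler_wpM2r ?expR_ge0//.
      exact: small.
    rewrite ler_wpDl ?mulr_ge0 ?expR_ge0 ?divr_ge0 ?(ltW e0)//.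
    rewrite -[leRHS]mulrA -expRD.
    apply: ler_pM; rewrite ?expR_ge0 ?subr_ge0 ?cos_le1//.
      by have := cos_geN1 (dotv y xi); lra.
    rewrite ler_expR -natr1 !mulNr mulrDl mul1r opprD lerD2r lerN2 ler_wpM2l//; exact: ltW.
  rewrite lerD2l.
  apply: (@le_trans _ _ (K * expR (- n.+1%:R * (a / 2)) *
      (kappa * r ^+ d * expR (- n.+1%:R * (a / 2))))); last first.
    by rewrite ler_wpM2l// mulr_ge0// expR_ge0.
  rewrite -subr_ge0 (_ : _ - _ = 0)//; apply/eqP; rewrite subr_eq0; apply/eqP.
  have -> : expR (- n%:R * a) = expR a * (expR (- n.+1%:R * (a / 2)) * expR (- n.+1%:R * (a / 2))).
    by rewrite -!expRD; congr expR; rewrite -natr1; field.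
  have kr : kappa * r ^+ d != 0 by rewrite mulf_neq0 ?gt_eqF// exprn_gt0.
  rewrite /K; move: (expR _) (p 1 _) (kappa * _) kr (expR a) => E P k k0 A.
  by field.
near=> n.
have pn0 := heat_kernel0_gt0 (ltr0Sn R n).
rewrite ger0_norm; last first.
  by rewrite subr_ge0 ler_pdivrMr// mul1r heat_kernel_le0.
have -> : 1 - p n.+1%:R y / p n.+1%:R vzero =
    (p n.+1%:R vzero - p n.+1%:R y) / p n.+1%:R vzero.
  by rewrite mulrBl divff// gt_eqF.
rewrite ler_pdivrMr//; apply: le_trans (upper n) _; rewrite ler_wpM2r ?(ltW pn0)//.
suff : K * expR (- n.+1%:R * (a / 2)) <= e / 2 by lra.
rewrite mulNr expRN ler_pdivrMr ?expR_gt0//.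
apply: (@le_trans _ _ (e / 2 * (1 + n.+1%:R * (a / 2)))); last first.
  by rewrite ler_wpM2l ?expR_ge1Dx// divr_ge0 ?ltW.
suff : K / (e / 2 * (a / 2)) <= n%:R.
  rewrite ler_pdivrMr ?mulr_gt0 ?divr_gt0// => /le_trans; apply.
  rewrite -[n.+1%:R]natr1.
  have : 0 <= e * a by rewrite mulr_ge0 ?ltW.
  move: (n%:R) (ltW e0) => N; nra.
by near: n; exact: nbhs_infty_ger.
Unshelve. all: by end_near. Qed.

Let measurable_hk_shift t x :
  measurable_fun setT (fun z : euclid R d => p t (vsub z x)).
Proof. by apply: measurable_fun_heat_kernel => //; exact: measurable_fun_vsub. Qed.

Let hk_ge0 t x : 0 < t -> 0 <= p t x.
Proof. by move=> t0; rewrite ltW// heat_kernel_gt0. Qed.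

Lemma heat_kernel_CKsym s t x : 0 < s -> 0 < t ->
  (\int[leb]_z (p s (vsub z x) * p t (vsub z x))%:E = (p (s + t) vzero)%:E)%E.
Proof.
move=> s0 t0; have := @heat_kernel_CK (s + t) s x x; rewrite vsubxx => <-.
  by apply: eq_integral => z _; rewrite addrAC subrr add0r (heat_kernel_sym t z x).
by rewrite s0 ltrDl.
Qed.

(** Along the approximating sequence Chapman-Kolmogorov gives [p_(u+n)(0) / p_n(0)] with [n >= 1],
    which is at most 1 since [p] at the origin decreases in time. *)
Lemma heat_kernel_mass_le1 u x : 0 < u ->
  (\int[leb]_z (p u (vsub z x))%:E <= 1)%E.
Proof.
move=> u0; pose q (n : nat) (z : euclid R d) := p n.+1%:R z / p n.+1%:R vzero.
have q0 n z : 0 <= q n z by rewrite divr_ge0 ?hk_ge0.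
have := @fatou _ _ _ leb setT measurableT
  (fun n z => (p u (vsub z x) * q n (vsub z x))%:E) _ _.
have -> : (\int[leb]_z limn_einf ((fun n z => (p u (vsub z x) * q n (vsub z x))%:E)^~ z) =
    \int[leb]_z (p u (vsub z x))%:E)%E.
  apply: eq_integral => z _; apply: (cvg_limn_einf_sup _).1.
  rewrite -[X in _ --> X%:E]mulr1; apply: cvg_EFin; first exact: nearW.
  by apply: cvgM; [exact: cvg_cst|exact: cvg_heat_kernel_ratio].
move=> /(_ _ _)/le_trans; apply.
- move=> n; apply/measurable_EFinP; apply: measurable_funM => //.
  by apply: measurable_funM.
- by move=> n z _; rewrite lee_fin mulr_ge0// hk_ge0.
rewrite limn_einf_lim; apply: lime_le; first exact: is_cvg_einfs.
apply: nearW => n; apply: le_trans (ereal_inf_lbound _) _.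
  by exists n => /=.
rewrite (_ : (\int[leb]_z _)%E = (\int[leb]_z ((p n.+1%:R vzero)^-1%:E *
   (p u (vsub z x) * p n.+1%:R (vsub z x))%:E))%E); last first.
  by apply: eq_integral => z _; rewrite -EFinM /q; congr EFin; ring.
rewrite ge0_integralZl//; last 3 first.
- by apply/measurable_EFinP; exact: measurable_funM.
- by move=> z _; rewrite lee_fin mulr_ge0// hk_ge0.
- by rewrite lee_fin invr_ge0 hk_ge0.
rewrite heat_kernel_CKsym// -EFinM lee_fin mulrC ler_pdivrMr ?heat_kernel0_gt0// mul1r.
by apply: heat_kernel0_anti => //; rewrite lerDr ltW.
Qed.

(** * Stable scaling: [rho h] is the frequency scale at time [h] *)

Local Notation rho := (fun h : R => h `^ (- alpha^-1)).

Let rho_gt0 h : 0 < h -> 0 < rho h. Proof. exact: powR_gt0. Qed.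

Let rho_powa h : 0 < h -> h * rho h `^ alpha = 1.
Proof.
move=> h0; rewrite -powRrM mulNr mulVf ?gt_eqF// powR_inv1 ?ltW// divff ?gt_eqF//.
Qed.

Local Notation J := (fun h : R => \int[leb]_(xi in [set: euclid R d]) expR (- h * enorm xi `^ alpha)).

Let measurable_stable h :
  measurable_fun setT (fun xi : euclid R d => expR (- h * enorm xi `^ alpha)).
Proof.
apply: (measurableT_comp (@measurable_expR R)); apply: measurable_funM => //.
by apply: (measurableT_comp (measurable_powR _)); exact: measurable_enorm.
Qed.

Let integrable_stable h : 0 < h -> leb.-integrable setT
  (EFin \o (fun xi : euclid R d => expR (- h * enorm xi `^ alpha))).
Proof.
move=> h0; apply: (le_integrable _ _ _ (integrable_weight h0)) => //.
  by apply/measurable_EFinP.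
move=> xi _ /=; rewrite lee_fin !ger0_norm ?expR_ge0// ler_expR !mulNr lerN2.
by rewrite ler_wpM2l ?(ltW h0)// rel_symbol_le.
Qed.

Lemma stable_scaling h : 0 < h -> J h = rho h ^+ d * J 1.
Proof.
move=> h0; have r0 := rho_gt0 h0.
pose f (xi : euclid R d) := (expR (- h * enorm xi `^ alpha))%:E.
have mf : measurable_fun setT f by apply/measurable_EFinP.
have f0 xi : (0 <= f xi)%E by rewrite lee_fin expR_ge0.
rewrite -[LHS]/(fine (\int[leb]_xi f xi)%E) -(ge0_integral_scale r0 mf f0).
have E : (\int[leb]_xi f (affine_map (rho h) vzero xi) = (J 1)%:E)%E.
  rewrite [RHS](fineK (integrable_fin_num measurableT (integrable_stable ltr01))).
  apply: eq_integral => xi _; rewrite /f enorm_scale ?(ltW r0)//.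
  rewrite powRM ?enorm_ge0 ?(ltW r0)// mulrA mulNr rho_powa//.
by rewrite E.
Qed.

Lemma stable_le_heat_kernel h : 0 < h -> kappa * J h <= p h vzero.
Proof.
move=> h0; rewrite heat_kernel0E ler_pM2l//; apply: le_Rintegral => //.
- exact: integrable_stable.
- exact: integrable_weight.
- move=> xi _; rewrite ler_expR !mulNr lerN2.
  by rewrite ler_wpM2l ?(ltW h0)// rel_symbol_le.
Qed.

(** The loss is [exp(h m)], which [h <= 1] turns into a constant. *)
Lemma heat_kernel_le_stable h : 0 < h <= 1 -> p h vzero <= expR m * (kappa * J h).
Proof.
move=> /andP[h0 h1]; rewrite heat_kernel0E mulrCA ler_pM2l//.
rewrite -RintegralZl//; last exact: integrable_stable.
apply: le_Rintegral => //.
- exact: integrable_weight.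
- exact: (integrableZl measurableT _ (integrable_stable h0)).
- move=> xi _; rewrite -expRD ler_expR.
  by have := rel_symbol_ge m alpha02 xi; have := m0; nra.
Qed.

(** Pass to the stable weight, where halving the time costs exactly [rho (1 / 2) ^+ d], and come
    back; only the first passage costs [exp m]. *)
Lemma heat_kernel0_half t : 0 < t <= 1 ->
  p (t / 2) vzero <= expR m * rho (1 / 2) ^+ d * p t vzero.
Proof.
move=> /andP[t0 t1]; have t20 : 0 < t / 2 by rewrite divr_gt0.
apply: le_trans (heat_kernel_le_stable _) _.
  by rewrite t20/= ler_pdivrMr//; lra.
rewrite -mulrA ler_pM2l ?expR_gt0//.
apply: (@le_trans _ _ (rho (1 / 2) ^+ d * (kappa * J t))).
  rewrite stable_scaling// (stable_scaling t0).
  rewrite (_ : rho (t / 2) = rho (1 / 2) * rho t).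
    have aux (k A B j : R) : k * (A * B * j) = A * (k * (B * j)) by ring.
    by rewrite (exprMn d (rho (1 / 2))) aux.
  by rewrite -powRM ?ltW// mul1r mulrC.
by rewrite ler_wpM2l ?exprn_ge0 ?powR_ge0// stable_le_heat_kernel.
Qed.

Definition gap_constant : R := kappa * expR (- Num.sqrt (2 * (d%:R + pi ^+ 2)) `^ alpha).

Lemma gap_constant_gt0 : 0 < gap_constant. Proof. by rewrite mulr_gt0// expR_gt0. Qed.

(* Shifting the frequency by [pi y / |y|^2] flips the sign of the cosine, so
   that [1 - cos] has average at least 1 over a box and its translate. *)
Lemma heat_kernel_gap h y : 0 < h -> h <= enorm y `^ alpha ->
  gap_constant * rho h ^+ d <= p h vzero - p h y.
Proof.
move=> h0 hy; have r0 := rho_gt0 h0.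
have y0 : 0 < enorm y.
  rewrite lt_neqAle enorm_ge0 andbT eq_sym; apply: contraTneq hy => ->.
  by rewrite powR0 ?gt_eqF// -ltNge.
(* The hypothesis on [y] says that [|y|] is at least [1 / rho h]; thus the shift, of length
   [pi / |y|], does not exceed [pi * rho h]. *)
have rhoy : 1 <= rho h * enorm y.
  rewrite powRN -ler_pdivrMl ?invr_gt0 ?powR_gt0// mulr1 invrK.
  apply: (@le_trans _ _ ((enorm y `^ alpha) `^ alpha^-1)).
    by rewrite ge0_ler_powR ?nnegrE ?powR_ge0 ?invr_ge0 ?(ltW a0) ?(ltW h0).
  by rewrite -powRrM divff ?gt_eqF// powRr1 ?enorm_ge0.
pose S : set (euclid R d) := [set xi | forall i,
  tnth (vzero : euclid R d) i <= (tnth xi i : R) <= tnth (vzero : euclid R d) i + rho h].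
pose v : euclid R d := affine_map (pi / enorm y ^+ 2) vzero y.
have yv : dotv y v = pi.
  by rewrite dotv_affine dotv0 addr0 -sqr_enorm divfK// gt_eqF// exprn_gt0.
have nv : enorm v <= pi * rho h.
  rewrite enorm_scale ?divr_ge0 ?pi_ge0 ?sqr_ge0// expr2 -mulrA ler_pM2l ?pi_gt0//.
  rewrite invfM -mulrA mulVf ?gt_eqF// mulr1.
  by rewrite -[leLHS]mul1r ler_pdivrMr.
pose f xi := (1 - cos (dotv y xi)) * w h xi.
have f0 xi : 0 <= f xi by rewrite mulr_ge0 ?expR_ge0// subr_ge0 cos_le1.
have mf : measurable_fun setT (EFin \o f) by case/integrableP : (integrable_1Bcos_weight y h0).
pose e := expR (- Num.sqrt (2 * (d%:R + pi ^+ 2)) `^ alpha).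
have we xi : enorm xi ^+ 2 <= 2 * (d%:R * rho h ^+ 2 + (pi * rho h) ^+ 2) -> e <= w h xi.
  move=> nxi; rewrite ler_expR mulNr lerN2.
  apply: (@le_trans _ _ (h * enorm xi `^ alpha)).
    by rewrite ler_wpM2l ?(ltW h0)// rel_symbol_le.
  apply: (@le_trans _ _ (h * (Num.sqrt (2 * (d%:R + pi ^+ 2)) * rho h) `^ alpha)).
    rewrite ler_wpM2l ?(ltW h0)// ge0_ler_powR ?nnegrE ?enorm_ge0 ?mulr_ge0 ?sqrtr_ge0 ?(ltW a0) ?(ltW r0)//.
    rewrite -(@ler_pXn2r _ 2) ?nnegrE ?enorm_ge0 ?mulr_ge0 ?sqrtr_ge0 ?(ltW r0)//.
    apply: le_trans nxi _; rewrite [leRHS]exprMn.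
    have -> : Num.sqrt (2 * (d%:R + pi ^+ 2)) ^+ 2 = 2 * (d%:R + pi ^+ 2) :> R.
      by rewrite sqr_sqrtr// mulr_ge0// addr_ge0// sqr_ge0.
    by rewrite (_ : 2 * _ = 2 * (d%:R + pi ^+ 2) * rho h ^+ 2)//; ring.
  rewrite powRM ?sqrtr_ge0 ?(ltW r0)// mulrCA rho_powa// mulr1//.
have nS xi : S xi -> enorm xi ^+ 2 <= d%:R * rho h ^+ 2.
  move=> Sxi; apply: enorm_box; first exact: ltW.
  by move=> i; have := Sxi i; rewrite tnth_mktuple add0r => /andP[? ?]; rewrite ger0_norm.
have key : ((2 * e * rho h ^+ d)%:E <= \int[leb]_xi (f xi + f (affine_map 1 v xi))%:E)%E.
  rewrite EFinM -(leb_box vzero r0) -integral_cst; last exact: measurable_box.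
  rewrite integral_mkcond; apply: ge0_le_integral => //.
  - move=> xi _; rewrite patchE; case: ifPn => // _.
    by rewrite lee_fin mulr_ge0// expR_ge0.
  - by apply/measurable_restrict => //; exact: measurable_box.
  - apply/measurable_EFinP; apply: measurable_funD; first exact/measurable_EFinP.
    apply: measurableT_comp; first exact/measurable_EFinP.
    exact: measurable_affine_map.
  - move=> xi _; rewrite patchE; case: ifPn => [/set_mem Sxi|_]; last first.
      by rewrite lee_fin addr_ge0.
    rewrite lee_fin /f dotv_affine mul1r yv cosDpi opprK.
    apply: (@le_trans _ _ ((1 - cos (dotv y xi)) * e + (1 + cos (dotv y xi)) * e)).
      by rewrite -mulrDl ler_wpM2r ?expR_ge0//; lra.
    apply: lerD; rewrite ler_wpM2l ?subr_ge0 ?cos_le1//.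
    - apply: we; apply: le_trans (nS _ Sxi) _.
      have : 0 <= d%:R * rho h ^+ 2 by rewrite mulr_ge0// sqr_ge0.
      have := sqr_ge0 (pi * rho h); lra.
    - apply: we; apply: le_trans (sqr_enorm_affine1 _ _) _.
      rewrite ler_pM2l// lerD ?nS// lerXn2r ?nnegrE ?enorm_ge0 ?mulr_ge0 ?pi_ge0 ?(ltW r0)//.
(* By translation invariance the shifted copy of [f] has the same integral, so the factors 2
   cancel. *)
have : ((2 * e * rho h ^+ d)%:E <= 2%:E * \int[leb]_xi (f xi)%:E)%E.
  apply: le_trans key _; pose F := EFin \o f; pose G := F \o affine_map 1 v.
  have F0 xi : setT xi -> (0 <= F xi)%E by move=> _; rewrite lee_fin.
  have G0 xi : setT xi -> (0 <= G xi)%E by move=> _; rewrite lee_fin.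
  have mG : measurable_fun setT G.
    by apply: (measurableT_comp mf); exact: measurable_affine_map.
  have := @ge0_integralD _ _ _ leb setT measurableT F G F0 mf G0 mG.
  rewrite [X in _ = (_ + X)%E -> _](ge0_integral_translate v mf) => [FG|xi].
    rewrite [leLHS](_ : _ = (\int[leb]_xi (F xi + G xi))%E)// FG.
    by rewrite (_ : 2%:E = 1%:E + 1%:E)%E// ge0_muleDl ?lee_fin// mul1e.
  exact: F0.
have ifin := integrable_fin_num measurableT (integrable_1Bcos_weight y h0).
rewrite -[X in (_ <= _ * X)%E](fineK ifin) -EFinM lee_fin => H.
by rewrite heat_kernel0B// -[leLHS]mulrA ler_pM2l// -(@ler_pM2l _ 2)// mulrA.
Qed.

(** Use [1 - exp(-u q) <= u q = 2 (u / h) (h q / 2)]. Half of the weight at time [h] absorbs the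
    factor [h q / 2], since [x exp(-x) <= 1]; the other half integrates to [p_(h/2)(0)]. *)
Lemma heat_kernel0_decrease u h : 0 < u -> 0 < h ->
  p h vzero - p (u + h) vzero <= 2 * (u / h) * p (h / 2) vzero.
Proof.
move=> u0 h0; have h20 : 0 < h / 2 by rewrite divr_gt0.
rewrite !heat_kernel0E -mulrBr mulrCA ler_pM2l//.
rewrite -RintegralB//; last 2 first.
- exact: integrable_weight.
- by apply: integrable_weight; rewrite addr_gt0.
rewrite -RintegralZl//; last exact: integrable_weight.
apply: le_Rintegral => //.
- have := integrableB measurableT (integrable_weight h0) (integrable_weight (addr_gt0 u0 h0)).
  by apply: eq_integrable.
- exact: (integrableZl measurableT _ (integrable_weight h20)).
move=> xi _; set q := psi xi; have q0 : 0 <= q by exact: psi0.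
have -> : expR (- (u + h) * q) = expR (- (u * q)) * expR (- h * q).
  by rewrite -expRD; congr expR; ring.
have -> : expR (- h * q) = expR (- (h / 2 * q)) * expR (- (h / 2 * q)).
  by rewrite -expRD; congr expR; field.
rewrite mulNr.
have E1 := expR_ge1Dx (- (u * q)).
have E2 := expR_ge1Dx (h / 2 * q).
have E2E : expR (h / 2 * q) * expR (- (h / 2 * q)) = 1 by rewrite -expRD subrr expR0.
have P := expR_gt0 (- (h / 2 * q)).
move: E1 E2 E2E P; move: (expR (- (u * q))) (expR (h / 2 * q)) (expR (- (h / 2 * q))) => A B E E1 E2 BE E0.
apply: (@le_trans _ _ (u * q * (E * E))).
  by rewrite -{1}[E * E]mul1r -mulrBl ler_wpM2r ?mulr_ge0 ?(ltW E0)//; lra.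
rewrite mulrA ler_wpM2r ?(ltW E0)//.
have -> : u * q = 2 * (u / h) * (h / 2 * q) by field; rewrite gt_eqF.
have uh0 : 0 <= 2 * (u / h) by rewrite mulr_ge0// divr_ge0 ?(ltW u0) ?(ltW h0).
rewrite -[leLHS]mulrA -[leRHS]mulr1 ler_wpM2l// -[X in _ <= X]BE ler_wpM2r ?(ltW E0)//; lra.
Qed.

(** The factor 2 of [heat_kernel0_decrease], the halving constant, and [exp m * p_1(0)], which
    bounds [p_h(0) / rho(h)^d] for [h <= 1]. *)
Definition decrease_constant : R :=
  2 * expR m * rho (1 / 2) ^+ d * expR m * p 1 vzero.

Lemma decrease_constant_ge0 : 0 <= decrease_constant.
Proof.
apply: mulr_ge0; last exact: hk_ge0.
by rewrite !mulr_ge0 ?expR_ge0// exprn_ge0 ?powR_ge0.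
Qed.

Lemma heat_kernel0_decrease_le u h : 0 < u -> 0 < h <= 1 ->
  p h vzero - p (u + h) vzero <= decrease_constant * (u / h) * rho h ^+ d.
Proof.
move=> u0 h01; have /andP[h0 h1] := h01.
apply: le_trans (heat_kernel0_decrease u0 h0) _.
have -> : decrease_constant * (u / h) * rho h ^+ d = 2 * (u / h) *
    (expR m * rho (1 / 2) ^+ d * (expR m * (rho h ^+ d * p 1 vzero))).
  rewrite /decrease_constant; move: (p 1 _) (rho h ^+ d) (rho (1 / 2) ^+ d) => A B E; ring.
apply: ler_wpM2l.
  by apply: mulr_ge0 => //; rewrite divr_ge0 ?(ltW u0) ?(ltW h0).
apply: le_trans (heat_kernel0_half h01) _; apply: ler_wpM2l.
  by apply: mulr_ge0; [exact: expR_ge0|rewrite exprn_ge0 ?powR_ge0].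
apply: le_trans (heat_kernel_le_stable h01) _; apply: ler_wpM2l; first exact: expR_ge0.
rewrite stable_scaling// mulrCA; apply: ler_wpM2l; first by rewrite exprn_ge0 ?powR_ge0.
exact: stable_le_heat_kernel.
Qed.

End chapman_kolmogorov.

(** * Tails and moments of the heat kernel *)

Section kernel_moments.
Context {R : realType} {d : nat}.
Variables (alpha c0 K0 : R) (p : R -> euclid R d -> R) (e : R -> R).
Hypothesis a0 : 0 < alpha.
Hypothesis c0_gt0 : 0 < c0.
Hypothesis K0_ge0 : 0 <= K0.
Hypothesis e_gt0 : forall h, 0 < h -> 0 < e h.
Hypothesis p_gt0 : forall t x, 0 < t -> 0 < p t x.
Hypothesis p_le0 : forall t x, 0 < t -> p t x <= p t vzero.
Hypothesis measurable_p_shift : forall t x,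
  measurable_fun setT (fun z : euclid R d => p t (vsub z x)).
Hypothesis p_mass : forall u x, 0 < u -> (\int[leb]_z (p u (vsub z x))%:E <= 1)%E.
Hypothesis p_CK : forall s t x, 0 < s -> 0 < t ->
  (\int[leb]_z (p s (vsub z x) * p t (vsub z x))%:E = (p (s + t) vzero)%:E)%E.
Hypothesis p_gap : forall h y, 0 < h -> h <= enorm y `^ alpha ->
  c0 * e h <= p h vzero - p h y.
Hypothesis p_decrease : forall u h, 0 < u -> 0 < h <= 1 ->
  p h vzero - p (u + h) vzero <= K0 * (u / h) * e h.
Implicit Types (x y z : euclid R d) (u t h r : R).

Let p_ge0 t x : 0 < t -> 0 <= p t x.
Proof. by move=> t0; rewrite ltW// p_gt0. Qed.

Let indic_ge0 (A : set (euclid R d)) z : 0 <= \1_A z :> R.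
Proof. by rewrite indicE ler0n. Qed.

Ltac nneg := repeat first [done | by apply: p_ge0 | exact: indic_ge0
  | exact: powR_ge0 | exact: enorm_ge0 | exact: ltW | apply: mulr_ge0 | apply: addr_ge0
  | apply: exprn_ge0 | apply: divr_ge0].

Definition tail_constant : R := K0 / c0.

Lemma tail_constant_ge0 : 0 <= tail_constant.
Proof. by rewrite divr_ge0// ltW. Qed.

Lemma kernel_tail u r x : 0 < u -> 0 < r <= 1 ->
  (\int[leb]_z (\1_[set z | (r <= enorm (vsub z x))%R] z * p u (vsub z x))%:E
    <= (tail_constant * u * r `^ (- alpha))%:E)%E.
Proof.
move=> u0 /andP[r0 r1]; pose h := r `^ alpha.
have h0 : 0 < h by rewrite powR_gt0.
have h1 : h <= 1.
  have {1}<- : 1 `^ alpha = 1 :> R by rewrite powR1.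
  by rewrite ge0_ler_powR ?nnegrE ?(ltW a0) ?(ltW r0).
have eh := e_gt0 h0; pose c := c0 * e h.
have cp : 0 < c by rewrite mulr_gt0.
set A := [set z | _].
have mA : measurable A.
  rewrite (_ : A = (fun z => enorm (vsub z x)) @^-1` `[r, +oo[%classic); last first.
    by apply/seteqP; split => z/=; rewrite in_itv/= andbT.
  rewrite -[X in measurable X]setTI; apply: (measurableT_comp measurable_enorm) => //.
  exact: measurable_fun_vsub.
have mp := measurable_p_shift u x.
have mph := measurable_p_shift h x.
(* The gap inequality is kept in the additive form [c 1_A p_u + p_u p_h <= p_h(0) p_u], so that all
   integrands are nonnegative. *)
have key : (\int[leb]_z (c%:E * (\1_A z * p u (vsub z x))%:E) +
    (p (u + h) vzero)%:E <= (p h vzero)%:E)%E.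
  rewrite -(p_CK x u0 h0) -ge0_integralD//; last 4 first.
  - move=> z _; rewrite -EFinM lee_fin; nneg.
  - apply: emeasurable_funM => //; apply/measurable_EFinP.
    by apply: measurable_funM => //; exact: measurable_indic.
  - by move=> z _; rewrite lee_fin; nneg.
  - by apply/measurable_EFinP; exact: measurable_funM.
  apply: (@le_trans _ _ (\int[leb]_z ((p h vzero)%:E * (p u (vsub z x))%:E))%E).
    apply: ge0_le_integral => //.
    - move=> z _; rewrite -EFinM -EFinD lee_fin; nneg.
    - apply: emeasurable_funD; last by apply/measurable_EFinP; exact: measurable_funM.
      apply: emeasurable_funM => //; apply/measurable_EFinP.
      by apply: measurable_funM => //; exact: measurable_indic.
    - by apply: emeasurable_funM => //; exact/measurable_EFinP.
    move=> z _; rewrite -!EFinM -EFinD lee_fin.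
    rewrite [in X in X + _]mulrA [X in _ + X]mulrC -mulrDl ler_wpM2r ?p_ge0//.
    rewrite indicE; case: (boolP (z \in A)) => [/set_mem zA|_]; last first.
      by rewrite mulr0 add0r p_le0.
    rewrite mulr1 -lerBrDr; apply: p_gap => //.
    by rewrite ge0_ler_powR ?nnegrE ?enorm_ge0 ?(ltW a0) ?(ltW r0).
  rewrite ge0_integralZl//; last 3 first.
  - exact/measurable_EFinP.
  - by move=> z _; rewrite lee_fin p_ge0.
  - by rewrite lee_fin p_ge0.
  by rewrite -[leRHS]mule1 lee_wpmul2l ?lee_fin ?p_ge0// p_mass.
move: key; rewrite ge0_integralZl//; last 3 first.
- apply/measurable_EFinP.
  by apply: measurable_funM => //; exact: measurable_indic.
- by move=> z _; rewrite lee_fin; nneg.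
- by rewrite lee_fin ltW.
rewrite -leeBrDr// -EFinB => key.
rewrite -(@lee_pmul2l _ c%:E) ?lte_fin//.
apply: le_trans key _; rewrite -EFinM lee_fin.
have hr : r `^ (- alpha) = h^-1 by rewrite powRN.
apply: le_trans (p_decrease u0 _) _; first by rewrite h0.
rewrite hr /tail_constant /c -subr_ge0 (_ : _ - _ = 0)//; field.
by rewrite !gt_eqF.
Qed.

(** The 1 pays for the ball of radius [u^(1/alpha)]. The fraction sums the dyadic scales beyond it:
    a geometric series of ratio [2^(gamma - alpha)], convergent for [gamma < alpha], with [2^gamma]
    coming from the outer radius of each scale. *)
Definition moment_constant (gamma : R) : R :=
  1 + 2 `^ gamma * tail_constant / (1 - 2 `^ (gamma - alpha)).

(** If [2^k r < v <= 2^(k+1) r], the term of index [k] alone dominates. Indicators of [v >= 2^k r]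
    replace those of shells, to match the tail estimate. *)
Lemma dyadic_bound (gamma r : R) (K : nat) (v : R) : 0 < gamma -> 0 < r ->
  0 <= v -> v <= 2 ^+ K * r ->
  v `^ gamma <= r `^ gamma +
    \sum_(k < K) (2 ^+ k.+1 * r) `^ gamma * (2 ^+ k * r <= v)%R%:R.
Proof.
move=> g0 r0 v0; elim: K => [|K IH] vK.
  rewrite big_ord0 addr0 ge0_ler_powR ?nnegrE ?(ltW g0) ?(ltW r0)//.
  by rewrite expr0 mul1r in vK.
rewrite big_ord_recr/= addrA.
have [vK'|vK'] := leP v (2 ^+ K * r).
  by apply: le_trans (IH vK') _; rewrite lerDl mulr_ge0// powR_ge0.
rewrite (ltW vK') mulr1 ler_wpDl ?addr_ge0 ?powR_ge0//.
  by apply: sumr_ge0 => k _; rewrite mulr_ge0// powR_ge0.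
rewrite ge0_ler_powR ?nnegrE ?(ltW g0) ?mulr_ge0 ?exprn_ge0 ?(ltW r0)//.
Qed.

Lemma kernel_moment gamma u x : 0 < gamma < alpha -> 0 < u <= 1 ->
  (\int[leb]_z (enorm (vsub z x) `^ gamma * \1_[set z | (enorm (vsub z x) <= 1)%R] z
      * p u (vsub z x))%:E <= (moment_constant gamma * u `^ (gamma / alpha))%:E)%E.
Proof.
move=> /andP[g0 ga] /andP[u0 u1].
pose r := u `^ alpha^-1; have r0 : 0 < r by rewrite powR_gt0.
pose K := Num.bound r^-1.
have Kr : 1 <= 2 ^+ K * r.
  rewrite -ler_pdivrMr// mul1r; apply: le_trans (ltW (archi_boundP _)) _.
    by rewrite invr_ge0 ltW.
  by rewrite -natrX ler_nat; exact/ltnW/ltn_expl.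
set B := [set z | _].
have mne : measurable_fun setT (fun z : euclid R d => enorm (vsub z x)).
  by apply: (measurableT_comp measurable_enorm) => //; exact: measurable_fun_vsub.
have mB : measurable B.
  rewrite (_ : B = (fun z => enorm (vsub z x)) @^-1` `]-oo, 1]%classic); last first.
    by apply/seteqP; split => z/=; rewrite in_itv/=.
  by rewrite -[X in measurable X]setTI; exact: mne.
pose A k := [set z : euclid R d | (2 ^+ k * r <= enorm (vsub z x))%R].
have mA k : measurable (A k).
  rewrite (_ : A k = (fun z => enorm (vsub z x)) @^-1` `[2 ^+ k * r, +oo[%classic); last first.
    by apply/seteqP; split => z/=; rewrite in_itv/= andbT.
  by rewrite -[X in measurable X]setTI; exact: mne.
have mp := measurable_p_shift u x.
pose F k (z : euclid R d) := ((2 ^+ k.+1 * r) `^ gamma * (\1_(A k `&` B) z * p u (vsub z x)))%:E.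
have mF k : measurable_fun setT (F k).
  apply/measurable_EFinP; apply: measurable_funM => //; apply: measurable_funM => //.
  by apply: measurable_indic; exact: measurableI.
have F0 k z : (0 <= F k z)%E by rewrite lee_fin; nneg.
apply: (@le_trans _ _ (\int[leb]_z ((r `^ gamma)%:E * (p u (vsub z x))%:E +
    \sum_(k < K) F k z))%E).
  apply: ge0_le_integral => //.
  - by move=> z _; rewrite lee_fin; nneg.
  - apply/measurable_EFinP; apply: measurable_funM => //; apply: measurable_funM => //.
    by apply: (measurableT_comp (measurable_powR _)).
  - apply: emeasurable_funD; last exact: emeasurable_sum.
    by apply: emeasurable_funM => //; exact/measurable_EFinP.
  move=> z _; rewrite sumEFin -EFinM -EFinD lee_fin.
  rewrite indicE; case: (boolP (z \in B)) => [/set_mem zB|zB]; last first.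
    rewrite mulr0 mul0r addr_ge0//; first by nneg.
    by apply: sumr_ge0 => k _; nneg.
  rewrite mulr1; under eq_bigr do rewrite mulrA.
  rewrite -mulr_suml -mulrDl ler_wpM2r ?p_ge0//.
  apply: le_trans (dyadic_bound (K := K) g0 r0 (enorm_ge0 _) _) _.
    exact: le_trans Kr.
  rewrite lerD2l; apply: ler_sum => k _; rewrite ler_wpM2l ?powR_ge0//.
  rewrite indicE in_setI [_ \in B]mem_set// andbT ler_nat.
  by case: (boolP (_ <= _)%R) => //= Ak; rewrite mem_set.
rewrite ge0_integralD//; last 4 first.
- by move=> z _; rewrite -EFinM lee_fin; nneg.
- by apply: emeasurable_funM => //; exact/measurable_EFinP.
- by move=> z _; apply: sume_ge0 => k _.
- exact: emeasurable_sum.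
rewrite ge0_integralZl//; last 3 first.
- exact/measurable_EFinP.
- by move=> z _; rewrite lee_fin p_ge0.
- by rewrite lee_fin powR_ge0.
have rg : r `^ gamma = u `^ (gamma / alpha) by rewrite -powRrM mulrC.
have ra : u * r `^ (- alpha) = 1.
  rewrite -powRrM mulrN mulVf ?gt_eqF// powR_inv1 ?(ltW u0)// divff// gt_eqF//.
pose q : R := 2 `^ (gamma - alpha).
have q0 : 0 < q by rewrite powR_gt0.
have q1 : q < 1.
  rewrite /q -opprB powRN invf_lt1 ?powR_gt0//.
  have {1}<- : 1 `^ (alpha - gamma) = 1 :> R by rewrite powR1.
  by rewrite gt0_ltr_powR ?nnegrE ?subr_gt0// ltr1n.
have term k : (\int[leb]_z F k z <= (2 `^ gamma * tail_constant * r `^ gamma * q ^+ k)%:E)%E.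
  rewrite /F; under eq_integral do rewrite EFinM.
  rewrite ge0_integralZl//; last 3 first.
  - apply/measurable_EFinP; apply: measurable_funM => //.
    by apply: measurable_indic; exact: measurableI.
  - by move=> z _; rewrite lee_fin; nneg.
  - by rewrite lee_fin powR_ge0.
  (* The tail estimate covers radii at most 1 only; beyond that, [A k] does not meet the unit ball
     [B] and the term is 0. *)
  have [kr|kr] := leP (2 ^+ k * r) 1; last first.
    rewrite [X in (_ * X)%E](_ : _ = 0%E).
      have := tail_constant_ge0; rewrite mule0 lee_fin => ?.
      by nneg.
    apply: integral0_eq => z _; rewrite indicE memNset ?mul0r//.
    by move=> [] /=; rewrite /A/B/= => /(lt_le_trans kr) /lt_le_trans H /H; rewrite ltxx.
  have kr0 : 0 < 2 ^+ k * r by rewrite mulr_gt0// exprn_gt0.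
  apply: (@le_trans _ _ (((2 ^+ k.+1 * r) `^ gamma)%:E *
      (tail_constant * u * (2 ^+ k * r) `^ (- alpha))%:E)%E).
    rewrite lee_wpmul2l ?lee_fin ?powR_ge0//.
    apply: le_trans (kernel_tail x u0 _); last by rewrite kr0.
    apply: ge0_le_integral => //.
    - by move=> z _; rewrite lee_fin; nneg.
    - apply/measurable_EFinP; apply: measurable_funM => //.
      by apply: measurable_indic; exact: measurableI.
    - apply/measurable_EFinP; apply: measurable_funM => //.
      exact: measurable_indic (mA k).
    move=> z _; rewrite lee_fin ler_wpM2r ?p_ge0// !indicE ler_nat in_setI.
    by rewrite -/(A k); case: (_ \in A k) => //=; case: (_ \in B).
  rewrite -EFinM lee_fin exprS -mulrA.
  rewrite (powRM gamma) ?(ltW kr0)// (powRM gamma) ?exprn_ge0 ?(ltW r0)//.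
  rewrite (powRM (- alpha)) ?exprn_ge0 ?(ltW r0)//.
  have -> : q ^+ k = (2 ^+ k) `^ gamma * (2 ^+ k) `^ (- alpha).
    rewrite -powRD; last by apply/implyP => _; rewrite expf_neq0.
    by rewrite /q -(powR_mulrn k (powR_ge0 2 _)) -(powR_mulrn k (ler0n R 2)) -!powRrM mulrC.
  rewrite -[leRHS]mulr1 -ra; move: (_ `^ _) => X.
  rewrite -subr_ge0 (_ : _ - _ = 0)//; ring.
rewrite ge0_integral_sum//.
apply: (@le_trans _ _ ((r `^ gamma)%:E * 1 + \sum_(k < K) (2 `^ gamma * tail_constant * r `^ gamma * q ^+ k)%:E)%E).
  apply: leeD; first by rewrite lee_wpmul2l ?lee_fin ?powR_ge0// p_mass.
  by apply: lee_sum => k _; exact: term.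
rewrite sumEFin mule1 -EFinD lee_fin -mulr_sumr rg /moment_constant mulrDl mul1r lerD2l.
rewrite -/q [leLHS]mulrAC ler_wpM2r ?powR_ge0//.
rewrite ler_wpM2l//; first by have := tail_constant_ge0; nneg.
rewrite -[leRHS]mul1r ler_pdivlMr ?subr_gt0// mulrC -opprB mulNr -subrX1 opprB.
by rewrite lerBlDr lerDl exprn_ge0// ltW.
Qed.

End kernel_moments.

(** * Functionals of a bridge *)

Section taylor_expR.
Context {R : realType}.
Implicit Types x : R.

Lemma expR_sub1_bound x : `|expR x - 1| <= `|x| * expR `|x|.
Proof.
have H1 := expR_ge1Dx x; have H2 := expR_ge1Dx (- x).
have E : expR x * expR (- x) = 1 by rewrite -expRD subrr expR0.
have P := expR_gt0 x; have Q := expR_gt0 (- x).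
have [x0|x0] := leP 0 x.
  rewrite (ger0_norm x0) ger0_norm ?subr_ge0; last by lra.
  by move: H1 H2 E P Q; move: (expR x) (expR (- x)) => a b; nra.
rewrite (ltr0_norm x0) ler0_norm; last by have := expR_ge0 x; nra.
have : 1 <= expR (- x) by lra.
nra.
Qed.

(** Mean value theorem on the segment from 0 to [x]. Each use raises the power by one; the
    factorials of the sharp Taylor remainder are given up. *)
Lemma taylor_step (f df : R -> R) (n : nat) x :
  (forall y, is_derive y (1 : R) f (df y)) -> f 0 = 0 ->
  (forall y, `|df y| <= `|y| ^+ n * expR `|y|) ->
  `|f x| <= `|x| ^+ n.+1 * expR `|x|.
Proof.
move=> fdf f0 dfn.
have cf : continuous f.
  by move=> y; apply: differentiable_continuous; apply/derivable1_diffP; have [] := fdf y.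
have bnd c : `|c| <= `|x| -> `|df c * x| <= `|x| ^+ n.+1 * expR `|x|.
  move=> cx; rewrite normrM exprSr mulrAC ler_wpM2r//; apply: le_trans (dfn c) _.
  by rewrite ler_pM ?expR_ge0// ?lerXn2r ?nnegrE// ler_expR.
have [x0|x0|<-] := ltgtP 0 x; last first.
- by rewrite f0 normr0 mulr_ge0// expR_ge0.
- have [c] := @MVT _ f df _ _ x0 (fun y _ => fdf y) (continuous_subspaceT cf).
  rewrite in_itv/= f0 => /andP[xc c0] E.
  have -> : f x = df c * x by lra.
  by apply: bnd; rewrite !ltr0_norm// lerN2 ltW.
- have [c] := @MVT _ f df _ _ x0 (fun y _ => fdf y) (continuous_subspaceT cf).
  rewrite in_itv/= f0 => /andP[c0 cx] E.
  have -> : f x = df c * x by lra.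
  by apply: bnd; rewrite !gtr0_norm// ltW.
Qed.

Lemma expR_taylor2 x :
  `|expR x - 1 - x - x ^+ 2 / 2| <= `|x| ^+ 3 * expR `|x|.
Proof.
apply: (taylor_step (f := fun x => expR x - 1 - x - x ^+ 2 / 2)
  (df := fun x => expR x - 1 - x)).
- move=> y; apply: is_derive_eq => //.
  rewrite /GRing.scale/=; lra.
- by rewrite expR0; lra.
move=> y; apply: (taylor_step (f := fun x => expR x - 1 - x)
  (df := fun x => expR x - 1)).
- by move=> z; apply: is_derive_eq => //; rewrite /GRing.scale/=; lra.
- by rewrite expR0; lra.
by move=> z; rewrite expr1; exact: expR_sub1_bound.
Qed.

End taylor_expR.

(** * Time integrals against the indicator of an open interval *)

Section open_interval_indicator.
Context {R : realType}.
Local Notation mu := (@lebesgue_measure R).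

(** The interval is open so that [s] and [t - s] are both positive on its support, where the bridge
    densities are positive. Time integrals run over the whole line against this factor. *)
Definition itvI (t s : R) : R := (0 < s < t)%R%:R.

Lemma itvI_indic t : (itvI t : measurableTypeR R -> R) = \1_(`]0, t[%classic : set (measurableTypeR R)).
Proof.
apply/funext => s; rewrite /itvI indicE; congr (_%:R); congr nat_of_bool.
by apply/idP/idP; rewrite inE/= in_itv.
Qed.

Lemma itvIE t s : itvI t s = if 0 < s < t then 1 else 0.
Proof. by rewrite /itvI; case: (_ && _). Qed.

Lemma itvI_idem t s : itvI t s * itvI t s = itvI t s.
Proof. by rewrite /itvI; case: (_ && _); rewrite ?mulr1 ?mulr0. Qed.

Lemma itvI_ge0 t s : 0 <= itvI t s.
Proof. exact: ler0n. Qed.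

Lemma measurable_itvI t : measurable_fun setT (itvI t : measurableTypeR R -> R).
Proof. by rewrite itvI_indic; apply: measurable_indic; exact: measurable_itv. Qed.

Lemma integral_itvI t : 0 < t -> (\int[mu]_s (itvI t s)%:E = t%:E)%E.
Proof.
move=> t0; rewrite (_ : (fun s => _) = EFin \o (itvI t : measurableTypeR R -> R))// itvI_indic.
rewrite [LHS]integral_indic ?setIT//.
by rewrite [LHS]lebesgue_measure_itv/= lte_fin t0 -EFinD subr0.
Qed.

Lemma integrable_itvI t : 0 < t -> mu.-integrable setT (EFin \o (itvI t : measurableTypeR R -> R)).
Proof.
move=> t0; apply/integrableP; split.
  by apply/measurable_EFinP; exact: measurable_itvI.
have -> : (\int[mu]_x `|(EFin \o (itvI t : measurableTypeR R -> R)) x| = t%:E)%E.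
  rewrite -(integral_itvI t0); apply: eq_integral => s _ /=.
  by rewrite ger0_norm// itvI_ge0.
exact: ltry.
Qed.

End open_interval_indicator.

Section bounded_support.
Context {R : realType}.
Local Notation mu := (@lebesgue_measure R).
Variables (t N : R).
Hypothesis t0 : 0 < t.
Local Notation I := (itvI t : measurableTypeR R -> R).

Lemma integrable_le_itvI (f : measurableTypeR R -> R) (c : R) :
  measurable_fun setT f -> (forall s, `|f s| <= c * I s) ->
  mu.-integrable setT (EFin \o f).
Proof.
move=> mf fc.
have := integrableZl measurableT c (integrable_itvI t0).
apply: le_integrable => //; first exact/measurable_EFinP.
by move=> s _ /=; rewrite lee_fin (le_trans (fc s))// ler_norm.
Qed.

Lemma Rintegral_le_itvI (f : measurableTypeR R -> R) (c : R) :
  measurable_fun setT f -> (forall s, `|f s| <= c * I s) ->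
  `|\int[mu]_s f s| <= c * t.
Proof.
move=> mf fc; have fi := integrable_le_itvI mf fc.
apply: le_trans (le_normr_Rintegral measurableT fi) _.
have -> : c * t = \int[mu]_s (c * I s).
  rewrite RintegralZl//; last exact: integrable_itvI.
  by rewrite /Rintegral integral_itvI.
apply: le_Rintegral => //.
- exact: (integrable_norm fi).
- exact: (integrableZl measurableT c (integrable_itvI t0)).
Qed.

Lemma double_integral_sqrB (v : measurableTypeR R -> R) :
  measurable_fun setT v -> (forall s, `|v s| <= N * I s) ->
  (\int[mu]_s \int[mu]_r (I s * I r * (v s - v r) ^+ 2)%:E =
   (2 * t * (\int[mu]_s (v s ^+ 2))%R - 2 * (\int[mu]_s v s)%R ^+ 2)%:E)%E.
Proof.
move=> mv vN.
have mI := measurable_itvI t.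
have II := itvI_idem t.
have IvE s : I s * v s = v s.
  have := vN s; rewrite /itvI; case: (_ && _); first by rewrite mul1r.
  by rewrite mulr0 normr_le0 => /eqP ->; rewrite mulr0.
have iI := integrable_itvI t0.
have iv := integrable_le_itvI mv vN.
have mv2 : measurable_fun setT (fun s => v s ^+ 2) by exact: measurable_funX.
have v2N s : `|v s ^+ 2| <= N ^+ 2 * I s.
  rewrite normrX -(II s) -expr2 -exprMn lerXn2r ?nnegrE//.
  exact: le_trans (vN s).
have iv2 := integrable_le_itvI mv2 v2N.
set A := \int[mu]_s v s; set S := \int[mu]_s (v s ^+ 2).
(* The inner and the outer integrand are both combinations of the indicator, [v] and [v ^+ 2], so
   one computation serves twice. *)
have lin (a b c : R) :
  mu.-integrable setT (EFin \o (fun s => a * I s + b * v s + c * v s ^+ 2)) /\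
  \int[mu]_s (a * I s + b * v s + c * v s ^+ 2) = a * t + b * A + c * S.
  have i1 := integrableZl measurableT a iI.
  have i2 := integrableZl measurableT b iv.
  have i3 := integrableZl measurableT c iv2.
  have i12 : mu.-integrable setT (EFin \o (fun s => a * I s + b * v s)).
    exact: (integrableD measurableT i1 i2).
  split; first exact: (integrableD measurableT i12 i3).
  rewrite RintegralD// RintegralD// !RintegralZl//.
  by congr (_ * _ + _ + _); rewrite /Rintegral integral_itvI.
have inner s : (\int[mu]_r (I s * I r * (v s - v r) ^+ 2)%:E =
   (S * I s + (- 2 * A) * v s + t * v s ^+ 2)%:E)%E.
  have E r : I s * I r * (v s - v r) ^+ 2 =
      (v s ^+ 2) * I r + (- 2 * v s) * v r + I s * v r ^+ 2.
    have e1 := IvE s; have e2 := IvE r.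
    have -> : I s * I r * (v s - v r) ^+ 2 = I r * (I s * v s) * v s
      - 2 * (I s * v s) * (I r * v r) + I s * (I r * v r) * v r by ring.
    by rewrite e1 e2; ring.
  under eq_integral do rewrite E.
  have [il H] := lin (v s ^+ 2) (- 2 * v s) (I s).
  rewrite -(fineK (integrable_fin_num measurableT il)); congr EFin.
  by rewrite [LHS]H; ring.
under eq_integral do rewrite inner.
have [il H] := lin S (- 2 * A) t.
rewrite -(fineK (integrable_fin_num measurableT il)); congr EFin.
by rewrite [LHS]H; ring.
Qed.

End bounded_support.

(** * Joint measurability of [V] along right-continuous paths *)

Section path_measurability.
Context {R : realType} {d : nat} d' (T : measurableType d').
Variables (t M gamma : R) (V : euclid R d -> R) (X : R -> T -> euclid R d).
Hypothesis t0 : 0 < t.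
Hypothesis gamma0 : 0 < gamma.
Hypothesis mV : measurable_fun setT V.
Hypothesis Vholder : forall x y, `|V x - V y| <= M * enorm (vsub x y) `^ gamma.
Hypothesis mX : forall s, 0 <= s <= t -> measurable_fun setT (X s).
Hypothesis Xrc : forall w s, 0 <= s < t ->
  enorm (vsub (X r w) (X s w)) @[r --> s^'+] --> (0 : R).

Lemma cvg_right_comp_path w s : 0 <= s < t -> V (X r w) @[r --> s^'+] --> V (X s w).
Proof.
move=> st; apply/cvgrPdist_le => e e0.
(* Positive whatever the sign of [M], hence a legitimate divisor. *)
pose M' := `|M| + 1; have M'0 : 0 < M' by rewrite ltr_wpDl.
pose delta := (e / M') `^ gamma^-1.
have delta0 : 0 < delta by rewrite powR_gt0// divr_gt0.
have /cvgrPdist_le/(_ _ delta0) := Xrc w st.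
apply: filterS => r; rewrite sub0r normrN ger0_norm ?enorm_ge0// => rd.
rewrite distrC; apply: le_trans (Vholder _ _) _.
apply: (@le_trans _ _ (M' * enorm (vsub (X r w) (X s w)) `^ gamma)).
  by rewrite ler_wpM2r ?powR_ge0// (le_trans (ler_norm M))// lerDl.
rewrite mulrC -ler_pdivlMr//.
apply: (@le_trans _ _ (delta `^ gamma)).
  by rewrite ge0_ler_powR ?nnegrE ?enorm_ge0 ?powR_ge0// ltW.
by rewrite -powRrM mulVf ?gt_eqF// powRr1// ltW// divr_gt0.
Qed.

(** On a grid of mesh [t / (n + 1)] the path is sampled at the right end of the cell containing [s].
    The samples approach [s] from the right, so right continuity of the path and continuity of [V]
    give the limit. *)
Lemma measurable_path :
  measurable_fun setT (fun q : measurableTypeR R * T => V (X q.1 q.2) * itvI t q.1).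
Proof.
pose h (n : nat) := t / n.+1%:R.
have h0 n : 0 < h n by rewrite divr_gt0.
have hn n : n.+1%:R * h n = t by rewrite mulrC divfK.
pose J n k : set (measurableTypeR R) := `[(k%:R * h n), (k.+1%:R * h n)[%classic.
pose f n (q : measurableTypeR R * T) := (\sum_(k < n.+1)
    \1_(J n k) q.1 * V (X (k.+1%:R * h n) q.2)) * itvI t q.1.
apply: (measurable_fun_cvg (h := f)).
  move=> n; apply: measurable_funM.
    apply: measurable_sum => k; apply: measurable_funM.
      rewrite (_ : (fun x => _) = (\1_(J n k) : measurableTypeR R -> R) \o fst)//.
      apply: measurableT_comp => //.
      by apply: measurable_indic; exact: measurable_itv.
    apply: (measurableT_comp mV); apply: measurableT_comp => //.
    apply: mX; rewrite mulr_ge0 ?(ltW (h0 _))//= -[leRHS](hn n) ler_wpM2r ?(ltW (h0 _))//.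
    by rewrite ler_nat.
  rewrite (_ : (fun x => _) = itvI t \o fst)//.
  by apply: measurableT_comp => //; exact: measurable_itvI.
move=> [s w] _; rewrite /f/=.
have [/andP[s0 st]|sI] := boolP (0 < s < t); last first.
  rewrite /itvI (negbTE sI) mulr0.
  by under eq_fun do rewrite mulr0; exact: cvg_cst.
rewrite /itvI s0 st mulr1; under eq_fun do rewrite mulr1.
(* A single cell contains [s]. Cells are closed on the left and open on the right, so the sampling
   time is strictly larger than [s], as a right-hand limit requires. *)
have sumE n : exists r, [/\ s < r, r <= s + h n &
    \sum_(k < n.+1) \1_(J n k) s * V (X (k.+1%:R * h n) w) = V (X r w)].
  have sh0 : 0 <= s / h n by rewrite divr_ge0 ?(ltW s0) ?(ltW (h0 n)).
  have /andP[k1 k2] := truncn_itv sh0.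
  set k := Num.trunc (s / h n) in k1 k2.
  rewrite ler_pdivlMr// in k1; rewrite ltr_pdivrMr// in k2.
  have kn : (k < n.+1)%N.
    by rewrite -(ltr_nat R) -(ltr_pM2r (h0 n)) hn; exact: le_lt_trans st.
  exists (k.+1%:R * h n); split => //.
    by rewrite -natr1 mulrDl mul1r lerD2r.
  rewrite (bigD1 (Ordinal kn))//= big1 ?addr0.
    rewrite indicE mem_set ?mul1r//.
    by rewrite /J/= in_itv/= k1 k2.
  move=> j jk; rewrite indicE memNset ?mul0r// /J/= in_itv/= => /andP[j1 j2].
  move/negP: jk; apply; apply/eqP/val_inj => /=; apply/eqP.
  have lt1 : (j < k.+1)%N.
    by rewrite -(ltr_nat R) -(ltr_pM2r (h0 n)); exact: le_lt_trans k2.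
  have lt2 : (k < j.+1)%N.
    by rewrite -(ltr_nat R) -(ltr_pM2r (h0 n)); exact: le_lt_trans j2.
  by rewrite eqn_leq; apply/andP; split; rewrite -ltnS.
have st' : 0 <= s < t by rewrite (ltW s0).
apply/cvgrPdist_le => e e0.
have /cvgrPdist_le/(_ _ e0) := cvg_right_comp_path (w := w) st'.
case/nbhs_ballP => /= delta delta0 H.
near=> n; have [r [sr rs ->]] := sumE n.
apply: H => //=.
rewrite /ball/= ltr0_norm ?subr_lt0// opprB ltrBlDl.
apply: le_lt_trans rs _; rewrite ltrD2l /h ltr_pdivrMr// -ltr_pdivrMl//.
rewrite -natr1 ltr_pwDr//.
by near: n; exact: nbhs_infty_ger.
Unshelve. all: by end_near. Qed.

End path_measurability.

(** * Tonelli for products of several factors *)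

Section sigma_finite_product.
Local Open Scope ereal_scope.
Context d1 d2 (X : measurableType d1) (Y : measurableType d2) (R : realType).
Variables (mX : {sigma_finite_measure set X -> \bar R})
  (mY : {sigma_finite_measure set Y -> \bar R}).

(* An alias of [mX \x mY] on which the sigma-finite structure is inferred. *)
Definition sfprod : set (X * Y) -> \bar R := (mX \x mY).

HB.instance Definition _ := Measure.copy sfprod (mX \x mY).

Let sfprod_sigma_finite : sigma_finite setT sfprod.
Proof.
have /sigma_finiteP[F [FT ndF mF]] := sigma_finiteT mX.
have /sigma_finiteP[G [GT ndG mG]] := sigma_finiteT mY.
exists (fun k => F k `*` G k).
  apply/esym; rewrite -subTset => -[x y] _.
  have [i _ Fi] : (\bigcup_i F i) x by rewrite -FT.
  have [j _ Gj] : (\bigcup_j G j) y by rewrite -GT.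
  exists (maxn i j) => //; split.
  - by move: (x) Fi; exact/subsetPset/ndF/leq_maxl.
  - by move: (y) Gj; exact/subsetPset/ndG/leq_maxr.
move=> k; have [mFk Fk] := mF k; have [mGk Gk] := mG k.
split; first exact: measurableX.
by rewrite /sfprod product_measure1E// lte_mul_pinfty// ge0_fin_numE.
Qed.

HB.instance Definition _ := @Measure_isSigmaFinite.Build _ _ _ sfprod
  sfprod_sigma_finite.

Variable f : X * Y -> \bar R.
Hypothesis mf : measurable_fun setT f.
Hypothesis f0 : forall q, 0 <= f q.

Lemma sfprod_tonelli1 : \int[sfprod]_q f q = \int[mX]_x \int[mY]_y f (x, y).
Proof. by rewrite -[RHS]fubini_tonelli1. Qed.

Lemma sfprod_tonelli2 : \int[sfprod]_q f q = \int[mY]_y \int[mX]_x f (x, y).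
Proof. by rewrite -[RHS]fubini_tonelli2. Qed.

End sigma_finite_product.

Section tonelli3.
Local Open Scope ereal_scope.
Context d1 d2 d3 (X : measurableType d1) (Y : measurableType d2)
  (Z : measurableType d3) (R : realType).
Variables (mX : {sigma_finite_measure set X -> \bar R})
  (mY : {sigma_finite_measure set Y -> \bar R})
  (mZ : {sigma_finite_measure set Z -> \bar R}).
Variable f : X * Y * Z -> \bar R.
Hypothesis mf : measurable_fun setT f.
Hypothesis f0 : forall q, 0 <= f q.

Lemma measurable_integral3 :
  measurable_fun setT (fun x => \int[mY]_y \int[mZ]_z f (x, y, z)).
Proof.
apply: (measurable_fun_fubini_tonelli_F (fun q => \int[mZ]_z f (q, z))).
- exact: measurable_fun_fubini_tonelli_F.
- by move=> q; exact: integral_ge0.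
Qed.

(** This moves the starting point of the bridge to the innermost integral, where Chapman-Kolmogorov
    applies. *)
Lemma tonelli3 : \int[mX]_x \int[mY]_y \int[mZ]_z f (x, y, z) =
  \int[mY]_y \int[mZ]_z \int[mX]_x f (x, y, z).
Proof.
rewrite (fubini_tonelli (fun q => \int[mZ]_z f (q, z))).
- apply: eq_integral => y _.
  apply: (fubini_tonelli (fun q : X * Z => f (q.1, y, q.2))) => //.
  apply: (measurableT_comp mf).
  by apply: measurable_fun_pair => //; exact: measurable_fun_pair.
- exact: measurable_fun_fubini_tonelli_F.
- by move=> q; exact: integral_ge0.
Qed.

End tonelli3.

(** * One- and two-time marginals of loops *)

Section bridge_integrals.
Context {R : realType} {d : nat}.
Variables (alpha m t : R) (p : R -> euclid R d -> R).
Hypothesis t0 : 0 < t.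
Hypothesis pE : forall s x, heat_kernel alpha m s x = p s x.
Hypothesis p_gt0 : forall s x, 0 < s -> 0 < p s x.
Hypothesis p_sym : forall s x y, p s (vsub x y) = p s (vsub y x).
Hypothesis measurable_p : forall d' (T : measurableType d') (f : T -> R)
    (g : T -> euclid R d), measurable_fun setT f -> measurable_fun setT g ->
  measurable_fun setT (fun q => p (f q) (g q)).
Hypothesis p_CK : forall t s x y, 0 < s < t ->
  (\int[leb]_z (p s (vsub z x) * p (t - s) (vsub y z))%:E = (p t (vsub x y))%:E)%E.
Implicit Types (x y z w : euclid R d) (s r : R).
Local Notation mu := (@lebesgue_measure R).

(** Start and end point coincide, so the normalisation is the value of the kernel at the origin. *)
Definition bridge_density1 s x z : R :=
  (p t vzero)^-1 * (p s (vsub z x) * p (t - s) (vsub x z)).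

Definition bridge_density2 s r x z w : R :=
  (p t vzero)^-1 * (p s (vsub z x) * (p (r - s) (vsub w z) * p (t - r) (vsub x w))).

Lemma bridge_density1_ge0 s x z : 0 < s < t -> 0 <= bridge_density1 s x z.
Proof.
move=> /andP[s0 st]; apply: mulr_ge0; first by rewrite invr_ge0 ltW ?p_gt0.
by rewrite mulr_ge0 ?ltW ?p_gt0 ?subr_gt0.
Qed.

Lemma bridge_density2_ge0 s r x z w : 0 < s -> s < r -> r < t ->
  0 <= bridge_density2 s r x z w.
Proof.
move=> s0 sr rt; apply: mulr_ge0; first by rewrite invr_ge0 ltW ?p_gt0.
apply: mulr_ge0; first by rewrite ltW ?p_gt0.
by apply: mulr_ge0; rewrite ltW ?p_gt0 ?subr_gt0.
Qed.

Lemma measurable_bridge_density1 d' (T : measurableType d') (f : T -> R)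
    (g h : T -> euclid R d) :
  measurable_fun setT f -> measurable_fun setT g -> measurable_fun setT h ->
  measurable_fun setT (fun q => bridge_density1 (f q) (g q) (h q)).
Proof.
move=> mf mg mh; apply: measurable_funM => //; apply: measurable_funM.
- by apply: measurable_p => //; exact: measurable_fun_vsub.
- by apply: measurable_p; [exact: measurable_funB|exact: measurable_fun_vsub].
Qed.

Lemma measurable_bridge_density2 d' (T : measurableType d') (f f' : T -> R)
    (g h h' : T -> euclid R d) :
  measurable_fun setT f -> measurable_fun setT f' ->
  measurable_fun setT g -> measurable_fun setT h -> measurable_fun setT h' ->
  measurable_fun setT (fun q => bridge_density2 (f q) (f' q) (g q) (h q) (h' q)).
Proof.
move=> mf mf' mg mh mh'; apply: measurable_funM => //; apply: measurable_funM.
  by apply: measurable_p => //; exact: measurable_fun_vsub.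
apply: measurable_funM.
- by apply: measurable_p; [exact: measurable_funB|exact: measurable_fun_vsub].
- by apply: measurable_p; [exact: measurable_funB|exact: measurable_fun_vsub].
Qed.

(** By symmetry of the kernel, a loop at [x] through [z] has the weight of a loop at [z] through
    [x]; integrating over [x] is then Chapman-Kolmogorov at [z]. *)
Lemma integral_bridge_density1 s z : 0 < s < t ->
  (\int[leb]_x (bridge_density1 s x z)%:E = 1)%E.
Proof.
move=> st; have pt0 := p_gt0 (vzero : euclid R d) t0.
under eq_integral do rewrite EFinM p_sym [p (t - s) _]p_sym.
have /andP[s0 st'] := st.
rewrite ge0_integralZl//.
- by rewrite p_CK// vsubxx -EFinM mulVf// gt_eqF.
- apply/measurable_EFinP; apply: measurable_funM.
  + by apply: measurable_p => //; exact: measurable_fun_vsub.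
  + by apply: measurable_p => //; exact: measurable_fun_vsub.
- by move=> x _; rewrite lee_fin mulr_ge0// ltW// p_gt0// subr_gt0.
- by rewrite lee_fin invr_ge0 ltW.
Qed.

(** The legs from [x] to [z] and from [w] back to [x] merge into one leg of duration
    [t - (r - s)]. *)
Lemma integral_bridge_density2 s r z w : 0 < s -> s < r -> r < t ->
  (\int[leb]_x (bridge_density2 s r x z w)%:E =
   ((p t vzero)^-1 * (p (r - s) (vsub w z) * p (t - (r - s)) (vsub w z)))%:E)%E.
Proof.
move=> s0 sr rt; have pt0 := p_gt0 (vzero : euclid R d) t0.
have E x : bridge_density2 s r x z w = ((p t vzero)^-1 * p (r - s) (vsub w z)) *
    (p s (vsub x z) * p (t - (r - s) - s) (vsub w x)).
  rewrite /bridge_density2 (p_sym s z) (p_sym _ x w).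
  rewrite (_ : t - (r - s) - s = t - r); last by ring.
  by move: (p (r - s) _) (p s _) (p (t - r) _) => a b c; ring.
under eq_integral do rewrite E EFinM.
have rs0 : 0 < r - s by rewrite subr_gt0.
rewrite ge0_integralZl//.
- rewrite p_CK; last by rewrite s0/=; lra.
  by rewrite -EFinM -mulrA (p_sym _ z w).
- apply/measurable_EFinP; apply: measurable_funM.
  + by apply: measurable_p => //; exact: measurable_fun_vsub.
  + by apply: measurable_p => //; exact: measurable_fun_vsub.
- by move=> x _; rewrite lee_fin mulr_ge0// ltW// p_gt0//; lra.
- by rewrite lee_fin mulr_ge0 ?invr_ge0 ?ltW// p_gt0.
Qed.

Section one_bridge.
Variables (x : euclid R d) (B : process R d).
Hypothesis bridgeB : is_bridge alpha m t x x B.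
Local Notation P := (process_law B).
Local Notation X := (process_path B).

Let mX s : 0 < s < t -> measurable_fun setT (X s).
Proof.
move=> /andP[s0 st]; apply: (bridge_measurable bridgeB).
by rewrite (ltW s0) (ltW st).
Qed.

(** The path value is viewed as a 1-tuple, whose law has density [bridge_density1] by the
    finite-dimensional axiom. *)
Lemma bridge_integral1 s (f : euclid R d -> \bar R) : 0 < s < t ->
  measurable_fun setT f -> (forall z, 0 <= f z)%E ->
  (\int[P]_w f (X s w) = \int[leb]_z (f z * (bridge_density1 s x z)%:E))%E.
Proof.
move=> st mf f0; have /andP[s0 st'] := st.
pose phi (w : process_space B) : 1.-tuple (euclid R d) := [tuple X s w].
have mphi : measurable_fun setT phi.
  apply/measurable_fun_tnthP => i; rewrite (_ : _ \o _ = X s); first exact: mX.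
  by apply/funext => w; rewrite /= ord1.
pose g (q : 1.-tuple (euclid R d)) : \bar R := f (tnth q ord0).
have mg : measurable_fun setT g.
  by apply: (measurableT_comp mf); exact: measurable_tnth.
pose k (q : 1.-tuple (euclid R d)) : R := bridge_density1 s x (tnth q ord0).
have mk : measurable_fun setT k.
  by apply: measurable_bridge_density1 => //; exact: measurable_tnth.
have k0 q : 0 <= k q by exact: bridge_density1_ge0.
have nuE A : measurable A -> pushforward P phi A =
    (\int[tuple_measure leb 1]_(q in A) (k q)%:E)%E.
  move=> mA; have := bridge_fdd bridgeB (s := [tuple s]) isT _ mA.
  rewrite /= s0 st'/= => /(_ isT) H.
  rewrite /pushforward (_ : phi @^-1` A = [set w | A [tuple X (tnth [tuple s] i) w | i < 1]]).
    rewrite H; apply: eq_integral => q _; congr EFin.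
    rewrite /bridge_density /k /bridge_density1 vsubxx pE.
    rewrite !big_ord_recl big_ord0/= !pE subr0 mulr1 (tnth_nth x).
    by case: q => -[|z []].
  by apply/seteqP; split => w /=; rewrite (_ : [tuple _ | _ < _] = phi w)//;
    apply: eq_from_tnth => i; rewrite tnth_mktuple ord1.
have := ge0_integral_pushforward mphi P measurableT mg.
move=> /(_ _)/wrap[]; first by move=> q _; exact: f0.
rewrite preimage_setT => <-.
rewrite (ge0_integral_density k0 mk nuE mg)//; last by move=> q; exact: f0.
rewrite ge0_integral_tuple_measure1//.
- by apply: emeasurable_funM => //; exact/measurable_EFinP.
- by move=> q; apply: mule_ge0; [exact: f0|rewrite lee_fin].
Qed.

Lemma bridge_integral2 s r (f : euclid R d -> euclid R d -> \bar R) :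
  0 < s -> s < r -> r < t ->
  measurable_fun setT (fun q : euclid R d * euclid R d => f q.1 q.2) ->
  (forall z w, 0 <= f z w)%E ->
  (\int[P]_w f (X s w) (X r w) =
   \int[leb]_z \int[leb]_z' (f z z' * (bridge_density2 s r x z z')%:E))%E.
Proof.
move=> s0 sr rt mf f0.
pose phi (w : process_space B) : 2.-tuple (euclid R d) := [tuple X s w; X r w].
have mphi : measurable_fun setT phi.
  apply: measurable_cons; first by apply: mX; rewrite s0 (lt_trans sr).
  apply/measurable_fun_tnthP => i; rewrite (_ : _ \o _ = X r).
    by apply: mX; rewrite rt (lt_trans s0).
  by apply/funext => w; rewrite /= ord1.
pose i1 : 'I_2 := lift ord0 ord0.
pose g (q : 2.-tuple (euclid R d)) : \bar R := f (tnth q ord0) (tnth q i1).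
have mpair : measurable_fun setT
    (fun q : 2.-tuple (euclid R d) => (tnth q ord0, tnth q i1)).
  by apply: measurable_fun_pair; exact: measurable_tnth.
have mg : measurable_fun setT g by exact: (measurableT_comp mf mpair).
pose k (q : 2.-tuple (euclid R d)) : R := bridge_density2 s r x (tnth q ord0) (tnth q i1).
have mk : measurable_fun setT k.
  by apply: measurable_bridge_density2 => //; exact: measurable_tnth.
have k0 q : 0 <= k q by exact: bridge_density2_ge0.
have nuE A : measurable A -> pushforward P phi A =
    (\int[tuple_measure leb 2]_(q in A) (k q)%:E)%E.
  move=> mA; have := bridge_fdd bridgeB (s := [tuple s; r]) isT _ mA.
  rewrite /= s0 sr rt/= => /(_ isT) H.
  rewrite /pushforward (_ : phi @^-1` A = [set w | A [tuple X (tnth [tuple s; r] i) w | i < 2]]).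
    rewrite H; apply: eq_integral => q _; congr EFin.
    rewrite /bridge_density /k /bridge_density2 vsubxx pE.
    rewrite !big_ord_recl big_ord0/= !pE subr0 mulr1 !(tnth_nth x).
    by case: q => -[|z [|z' []]].
  have E (w : process_space B) : [tuple X (tnth [tuple s; r] i) w | i < 2] = phi w.
    apply: eq_from_tnth => i; rewrite tnth_mktuple.
    by case: i => -[|[|]].
  by apply/seteqP; split => w /=; rewrite E.
have := ge0_integral_pushforward mphi P measurableT mg.
move=> /(_ _)/wrap[]; first by move=> q _; exact: f0.
rewrite preimage_setT => <-.
rewrite (ge0_integral_density k0 mk nuE mg)//; last by move=> q; exact: f0.
rewrite ge0_integral_tuple_measure2//.
- by apply: emeasurable_funM => //; exact/measurable_EFinP.
- by move=> q; apply: mule_ge0; [exact: f0|rewrite lee_fin].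
Qed.

End one_bridge.

Section occupation.
Variable phi : euclid R d -> R.
Hypothesis mphi : measurable_fun setT phi.
Hypothesis phi0 : forall z, 0 <= phi z.

Definition occupation_integrand (q : euclid R d * measurableTypeR R * euclid R d) : \bar R :=
  (itvI t q.1.2 * (phi q.2 * bridge_density1 q.1.2 q.1.1 q.2))%:E.

(** Expectation of the time integral of [phi] along the loop at [x], but written with densities: it
    is measurable in [x], which the family of bridges need not be. *)
Definition occupation x : \bar R :=
  (\int[mu]_s \int[leb]_z occupation_integrand (x, s, z))%E.

Let mF : measurable_fun setT occupation_integrand.
Proof.
apply/measurable_EFinP; apply: measurable_funM.
  by apply: (measurableT_comp (measurable_itvI t)); exact: measurableT_comp.
apply: measurable_funM; first exact: measurableT_comp.
by apply: measurable_bridge_density1 => //; exact: measurableT_comp.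
Qed.

Let F0 q : (0 <= occupation_integrand q)%E.
Proof.
rewrite lee_fin itvIE; case: ifPn => [st|_]; last by rewrite mul0r.
by rewrite mul1r mulr_ge0// bridge_density1_ge0.
Qed.

Lemma measurable_occupation : measurable_fun setT occupation.
Proof. exact: measurable_integral3. Qed.

Lemma occupation_ge0 x : (0 <= occupation x)%E.
Proof. by apply: integral_ge0 => s _; exact: integral_ge0. Qed.

Lemma bridge_occupation x (B : process R d) : is_bridge alpha m t x x B ->
  measurable_fun setT (fun q : measurableTypeR R * process_space B =>
    itvI t q.1 * phi (process_path B q.1 q.2)) ->
  (\int[process_law B]_w \int[mu]_s (itvI t s * phi (process_path B s w))%:E =
   occupation x)%E.
Proof.
move=> bB mJ.
rewrite -(fubini_tonelli (fun q : measurableTypeR R * process_space B =>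
  (itvI t q.1 * phi (process_path B q.1 q.2))%:E)); last 2 first.
- exact/measurable_EFinP.
- by move=> q; rewrite lee_fin mulr_ge0// itvI_ge0.
apply: eq_integral => s _; rewrite /occupation_integrand/= itvIE.
case: ifPn => [st|_]; last first.
  by rewrite !integral0_eq// => z _; rewrite mul0r.
under eq_integral do rewrite mul1r.
rewrite (bridge_integral1 bB st (f := EFin \o phi))//; last exact/measurable_EFinP.
by apply: eq_integral => z _; rewrite mul1r EFinM.
Qed.

Lemma integral_occupation :
  (\int[leb]_x occupation x = t%:E * \int[leb]_z (phi z)%:E)%E.
Proof.
rewrite /occupation tonelli3//.
transitivity (\int[mu]_s ((itvI t s)%:E * \int[leb]_z (phi z)%:E))%E.
  apply: eq_integral => s _.
  rewrite -ge0_integralZl//; last 3 first.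
  - exact/measurable_EFinP.
  - by move=> z _; rewrite lee_fin.
  - by rewrite lee_fin itvI_ge0.
  apply: eq_integral => z _; rewrite /occupation_integrand/=.
  rewrite itvIE; case: ifPn => [st|_]; last first.
    by rewrite mul0e integral0_eq// => x _; rewrite mul0r.
  under eq_integral do rewrite mul1r EFinM.
  rewrite ge0_integralZl//.
  - by rewrite integral_bridge_density1// mule1 mul1e.
  - by apply/measurable_EFinP; exact: measurable_bridge_density1.
  - by move=> x _; rewrite lee_fin bridge_density1_ge0.
  - by rewrite lee_fin.
rewrite ge0_integralZr//.
- by rewrite integral_itvI.
- by apply/measurable_EFinP; exact: measurable_itvI.
- by move=> s _; rewrite lee_fin itvI_ge0.
- by apply: integral_ge0 => z _; rewrite lee_fin.
Qed.

End occupation.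

Section increments.
Let mu2 := sfprod mu mu.
Let leb2 := sfprod (@leb R d) (@leb R d).
Variable V : euclid R d -> R.
Hypothesis mV : measurable_fun setT V.

(** The minimum and the maximum put the two times in the order that the density expects; the factor
    [s != r] removes the diagonal, where the middle leg would have duration 0. *)
Definition increment_integrand
    (q : euclid R d * (measurableTypeR R * measurableTypeR R) * (euclid R d * euclid R d)) : \bar R :=
  let: (x, (s, r), (z, w)) := q in
  (itvI t s * itvI t r * (s != r)%R%:R * ((V z - V w) ^+ 2 *
     bridge_density2 (Num.min s r) (Num.max s r) x z w))%:E.

Definition increments x : \bar R :=
  (\int[mu2]_y \int[leb2]_z increment_integrand (x, y, z))%E.

Let mF : measurable_fun setT increment_integrand.
Proof.
pose T : measurableType _ := (euclid R d * (measurableTypeR R * measurableTypeR R)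
  * (euclid R d * euclid R d))%type.
pose fs (q : T) : R := q.1.2.1; pose fr (q : T) : R := q.1.2.2.
pose gx (q : T) : euclid R d := q.1.1.
pose gz (q : T) : euclid R d := q.2.1; pose gw (q : T) : euclid R d := q.2.2.
have mfs : measurable_fun setT fs by do 2 apply: measurableT_comp => //.
have mfr : measurable_fun setT fr by do 2 apply: measurableT_comp => //.
have mgx : measurable_fun setT gx by apply: measurableT_comp.
have mgz : measurable_fun setT gz by apply: measurableT_comp.
have mgw : measurable_fun setT gw by apply: measurableT_comp.
rewrite (_ : increment_integrand = EFin \o (fun q : T => itvI t (fs q) * itvI t (fr q) *
  (\1_(~` [set 0%R]) (fs q - fr q)) * ((V (gz q) - V (gw q)) ^+ 2 *
     bridge_density2 (Num.min (fs q) (fr q)) (Num.max (fs q) (fr q)) (gx q) (gz q) (gw q)))).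
  apply/measurable_EFinP; apply: measurable_funM; first apply: measurable_funM.
  - apply: measurable_funM.
      exact: (measurableT_comp (measurable_itvI t) mfs).
    exact: (measurableT_comp (measurable_itvI t) mfr).
  - rewrite (_ : (fun q : T => _) = (\1_(~` [set 0%R]) : R -> R) \o (fun q => fs q - fr q))//.
    apply: measurableT_comp; last exact: measurable_funB.
    by apply: measurable_indic; exact: measurableC.
  - apply: measurable_funM.
      apply: measurable_funX; apply: measurable_funB.
        exact: (measurableT_comp mV mgz).
      exact: (measurableT_comp mV mgw).
    apply: measurable_bridge_density2 => //.
      exact: measurable_minr.
    exact: measurable_maxr.
apply/funext => -[[x [s r]] [z w]]; rewrite /increment_integrand/= /fs/fr/gx/gz/gw/=.
congr ((_ * _ * _)%:E); rewrite indicE; congr (_%:R); congr nat_of_bool.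
rewrite -subr_eq0; apply/idP/idP; first by move/eqP => ?; rewrite mem_set.
by rewrite inE/= => /eqP.
Qed.

Let minmax s r : itvI t s * itvI t r * (s != r)%R%:R != 0 ->
  [/\ 0 < Num.min s r, Num.min s r < Num.max s r & Num.max s r < t].
Proof.
rewrite !itvIE; case: ifPn => [/andP[s0 st]|_]; last by rewrite !mul0r eqxx.
case: ifPn => [/andP[r0 rt]|_]; last by rewrite mulr0 mul0r eqxx.
have [sr|rs|->] := ltgtP s r => //=; last by rewrite mulr0 eqxx.
Qed.

Let F0 q : (0 <= increment_integrand q)%E.
Proof.
case: q => -[x [s r]] [z w]; rewrite /increment_integrand lee_fin.
have [->|/minmax[a b c]] := eqVneq (itvI t s * itvI t r * (s != r)%R%:R) 0.
  by rewrite mul0r.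
apply: mulr_ge0; first by rewrite mulr_ge0// mulr_ge0 ?itvI_ge0.
by rewrite mulr_ge0 ?sqr_ge0// bridge_density2_ge0.
Qed.

Lemma measurable_increments : measurable_fun setT increments.
Proof. exact: (measurable_integral3 mu2 leb2 mF F0). Qed.

Lemma increments_ge0 x : (0 <= increments x)%E.
Proof. by apply: integral_ge0 => s _; apply: integral_ge0 => z _; exact: F0. Qed.

Lemma bridge_increments x (B : process R d) : is_bridge alpha m t x x B ->
  measurable_fun setT (fun q : measurableTypeR R * process_space B =>
    itvI t q.1 * V (process_path B q.1 q.2)) ->
  (\int[process_law B]_w \int[mu]_s \int[mu]_r
     (itvI t s * itvI t r * (V (process_path B s w) - V (process_path B r w)) ^+ 2)%:E =
   increments x)%E.
Proof.
move=> bB mJ; set P := process_law B; set X := process_path B.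
pose g (q : (measurableTypeR R * measurableTypeR R) * process_space B) : R :=
  itvI t q.1.1 * itvI t q.1.2 * (V (X q.1.1 q.2) - V (X q.1.2 q.2)) ^+ 2.
have mg : measurable_fun setT g.
  have m1 : measurable_fun setT (fun q : (measurableTypeR R * measurableTypeR R) * process_space B =>
      itvI t q.1.1 * V (X q.1.1 q.2)).
    have mpr : measurable_fun setT (fun q : (measurableTypeR R * measurableTypeR R) * process_space B => (q.1.1, q.2)).
      by apply: measurable_fun_pair => //; exact: measurableT_comp.
    exact: (measurableT_comp mJ mpr).
  have m2 : measurable_fun setT (fun q : (measurableTypeR R * measurableTypeR R) * process_space B =>
      itvI t q.1.2 * V (X q.1.2 q.2)).
    have mpr : measurable_fun setT (fun q : (measurableTypeR R * measurableTypeR R) * process_space B => (q.1.2, q.2)).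
      by apply: measurable_fun_pair => //; exact: measurableT_comp.
    exact: (measurableT_comp mJ mpr).
  have i1 : measurable_fun setT (fun q : (measurableTypeR R * measurableTypeR R) * process_space B =>
      itvI t q.1.1).
    by apply: (measurableT_comp (measurable_itvI t)); exact: measurableT_comp.
  have i2 : measurable_fun setT (fun q : (measurableTypeR R * measurableTypeR R) * process_space B =>
      itvI t q.1.2).
    by apply: (measurableT_comp (measurable_itvI t)); exact: measurableT_comp.
  rewrite (_ : g = (fun q => (itvI t q.1.2 * (itvI t q.1.1 * V (X q.1.1 q.2)) -
      itvI t q.1.1 * (itvI t q.1.2 * V (X q.1.2 q.2))) ^+ 2)).
    by apply: measurable_funX; apply: measurable_funB; exact: measurable_funM.
  apply/funext => q; rewrite /g.
  have := itvI_idem t q.1.1; have := itvI_idem t q.1.2.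
  move: (itvI t q.1.1) (itvI t q.1.2) (V _) (V _) => a b u v bb aa.
  rewrite (_ : b * (a * v) - a * (b * u) = (a * b) * (v - u)); last by ring.
  have -> : (a * b * (v - u)) ^+ 2 = (a * a) * (b * b) * (v - u) ^+ 2 by ring.
  by rewrite aa bb.
have g0 q : (0 <= (g q)%:E)%E.
  by rewrite lee_fin /g; apply: mulr_ge0; [apply: mulr_ge0; exact: itvI_ge0|exact: sqr_ge0].
transitivity (\int[P]_w \int[mu2]_y (g (y, w))%:E)%E.
  apply: eq_integral => w _.
  rewrite (sfprod_tonelli1 mu mu (f := fun q => (g (q, w))%:E))//.
  apply/measurable_EFinP; apply: (measurableT_comp mg).
  exact: measurable_fun_pair.
rewrite -(fubini_tonelli (fun q => (g q)%:E))//; last exact/measurable_EFinP.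
apply: eq_integral => -[s r] _; rewrite /g/=.
have [st|st] := boolP (0 < s < t); last first.
  rewrite (itvIE t s) (negbTE st) !integral0_eq//.
  - by move=> [z w] _; rewrite !mul0r.
  - by move=> w _; rewrite !mul0r.
have [rt|rt] := boolP (0 < r < t); last first.
  rewrite (itvIE t r) (negbTE rt) !integral0_eq//.
  - by move=> [z w] _; rewrite mulr0 !mul0r.
  - by move=> w _; rewrite mulr0 !mul0r.
rewrite !itvIE st rt !mul1r.
have key a b : 0 < a -> a < b -> b < t ->
   (\int[P]_w ((V (X a w) - V (X b w)) ^+ 2)%:E = \int[leb2]_z
      ((V z.1 - V z.2) ^+ 2 * bridge_density2 a b x z.1 z.2)%:E)%E.
  move=> a0 ab bt.
  have m12 : measurable_fun setT (fun q : euclid R d * euclid R d => (V q.1 - V q.2) ^+ 2).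
    by apply: measurable_funX; apply: measurable_funB; exact: measurableT_comp.
  rewrite (bridge_integral2 bB (f := fun z w => ((V z - V w) ^+ 2)%:E))//.
  - rewrite sfprod_tonelli1//.
      by apply/measurable_EFinP; apply: measurable_funM => //; exact: measurable_bridge_density2.
    by move=> q; rewrite lee_fin mulr_ge0 ?sqr_ge0 ?bridge_density2_ge0.
  - exact/measurable_EFinP.
  - by move=> z w; rewrite lee_fin sqr_ge0.
move: st rt => /andP[s0 st] /andP[r0 rt].
(* For [r < s] the difference is reversed inside the square, since the first point of the density
   belongs to the earlier time. On the diagonal the left side vanishes with the difference, the
   right side by the factor [s != r]. *)
have [sr|rs|sr] := ltgtP s r.
- under eq_integral do rewrite mul1r.
  rewrite key//; apply: eq_integral => -[z w] _.
  by rewrite mul1r.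
- under eq_integral do rewrite mul1r -sqrrN opprB.
  rewrite key//; apply: eq_integral => -[z w] _.
  by rewrite mul1r.
- rewrite sr !integral0_eq//.
  + by move=> [z w] _; rewrite mul0r.
  + by move=> w _; rewrite subrr expr0n mulr0.
Qed.

Variables (kap : euclid R d -> R) (Q L : R).
Hypothesis mkap : measurable_fun setT kap.
Hypothesis kap0 : forall y, 0 <= kap y.
Hypothesis kap_sym : forall z w, kap (vsub z w) = kap (vsub w z).
Hypothesis V_kap : forall z w, `|V z - V w| <= kap (vsub w z).
Hypothesis Q0 : 0 <= Q.
Hypothesis kapQ : forall u z, 0 < u < t ->
  (\int[leb]_w (kap (vsub w z) * (p u (vsub w z) * p (t - u) (vsub w z)))%:E <=
   (Q * p t vzero)%:E)%E.
Hypothesis VL : (\int[leb]_z `|V z|%:E = L%:E)%E.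

(** In [(V z - V w)^2] one factor is bounded by [|V z| + |V w|], which produces the norm [L], and
    the other by the modulus, which produces [Q]. The two summands contribute equally, whence the 2;
    the times contribute [t ^+ 2]. *)
Lemma integral_increments_le :
  (\int[leb]_x increments x <= (2 * Q * L * t ^+ 2)%:E)%E.
Proof.
have pt0 := p_gt0 (vzero : euclid R d) t0.
have -> : (\int[leb]_x increments x = \int[mu2]_y \int[leb2]_z
    \int[leb]_x increment_integrand (x, y, z))%E.
  exact: (tonelli3 leb mu2 leb2 mF F0).
have L0 : 0 <= L by rewrite -lee_fin -VL; apply: integral_ge0 => z _; rewrite lee_fin.
have mI2 : measurable_fun setT (fun y : measurableTypeR R * measurableTypeR R =>
    (itvI t y.1)%:E * (itvI t y.2)%:E)%E.
  apply: emeasurable_funM; apply/measurable_EFinP;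
    exact: (measurableT_comp (measurable_itvI t)).
apply: (@le_trans _ _ (\int[mu2]_y ((2 * Q * L)%:E * ((itvI t y.1)%:E * (itvI t y.2)%:E)))%E); last first.
  rewrite ge0_integralZl//; last 2 first.
  - by move=> y _; rewrite -EFinM lee_fin mulr_ge0 ?itvI_ge0.
  - by rewrite lee_fin !mulr_ge0.
  rewrite sfprod_tonelli1//=; last by move=> y; rewrite -EFinM lee_fin mulr_ge0 ?itvI_ge0.
  under eq_integral.
    move=> s _; rewrite ge0_integralZl//; first over.
    - by apply/measurable_EFinP; exact: measurable_itvI.
    - by move=> r _; rewrite lee_fin itvI_ge0.
    - by rewrite lee_fin itvI_ge0.
  rewrite ge0_integralZr//.
  - by rewrite integral_itvI// -!EFinM expr2.
  - by apply/measurable_EFinP; exact: measurable_itvI.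
  - by move=> s _; rewrite lee_fin itvI_ge0.
  - by rewrite integral_itvI// lee_fin ltW.
apply: ge0_le_integral_pointwise => [y|[s r]].
  by apply: integral_ge0 => z _; apply: integral_ge0 => x _; exact: F0.
rewrite -!EFinM (_ : itvI t (s, r).1 * itvI t (s, r).2 = itvI t s * itvI t r)//.
have [E0|srt] := eqVneq (itvI t s * itvI t r * (s != r)%R%:R) 0.
  rewrite integral0_eq; first by rewrite lee_fin !mulr_ge0 ?itvI_ge0.
  by move=> [z w] _; rewrite integral0_eq// => x _; rewrite /increment_integrand E0 mul0r.
have [a0 ab bt] := minmax srt.
have -> : itvI t s * itvI t r = 1.
  move: srt; rewrite !itvIE; case: ifPn => _; last by rewrite !mul0r eqxx.
  by case: ifPn => _; [rewrite mulr1|rewrite mulr0 mul0r eqxx].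
have srt1 : itvI t s * itvI t r * (s != r)%R%:R = 1.
  move: srt; rewrite !itvIE; case: ifPn => _; last by rewrite !mul0r eqxx.
  case: ifPn => _; last by rewrite mulr0 mul0r eqxx.
  by case: (s != r); rewrite ?mulr0 ?eqxx// !mulr1.
rewrite mulr1; set u := Num.max s r - Num.min s r.
have u0 : 0 < u < t by rewrite subr_gt0 ab/= /u; lra.
pose k z w := (p t vzero)^-1 * (kap (vsub w z) * (p u (vsub w z) * p (t - u) (vsub w z))).
have k0 z w : 0 <= k z w.
  case/andP: u0 => u0 ut; rewrite mulr_ge0 ?invr_ge0 ?(ltW pt0)// mulr_ge0// mulr_ge0// ltW// p_gt0// subr_gt0//.
have ksym z w : k z w = k w z.
  by rewrite /k kap_sym (p_sym u) (p_sym (t - u)).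
have mk : measurable_fun setT (fun q : euclid R d * euclid R d => k q.1 q.2).
  have mv : measurable_fun setT (fun q : euclid R d * euclid R d => vsub q.2 q.1).
    exact: measurable_fun_vsub.
  apply: measurable_funM => //; apply: measurable_funM; first exact: (measurableT_comp mkap).
  by apply: measurable_funM; exact: measurable_p.
have mk1 z : measurable_fun setT (k z).
  have mpr : measurable_fun setT (fun w : euclid R d => (z, w)) by exact: measurable_fun_pair.
  exact: (measurableT_comp mk mpr).
have kQ z : (\int[leb]_w (k z w)%:E <= Q%:E)%E.
  rewrite /k; under eq_integral do rewrite EFinM.
  rewrite ge0_integralZl//.
  - apply: (@le_trans _ _ ((p t vzero)^-1%:E * (Q * p t vzero)%:E)%E).
      by rewrite lee_wpmul2l ?lee_fin ?invr_ge0 ?(ltW pt0)//; exact: kapQ.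
    by rewrite -EFinM lee_fin mulrCA mulVf ?mulr1// gt_eqF.
  - apply/measurable_EFinP; have mv : measurable_fun setT (fun w => vsub w z) by exact: measurable_fun_vsub.
    apply: measurable_funM; first exact: (measurableT_comp mkap).
    by apply: measurable_funM; exact: measurable_p.
  - move=> w _; case/andP: u0 => u0 ut.
    by rewrite lee_fin mulr_ge0// mulr_ge0// ltW// p_gt0// subr_gt0.
  - by rewrite lee_fin invr_ge0 ltW.
have mVa : measurable_fun setT (fun z => `|V z|%:E).
  by apply/measurable_EFinP; exact: measurableT_comp.
have half : (\int[leb2]_q (`|V q.1| * k q.1 q.2)%:E <= (Q * L)%:E)%E.
  rewrite sfprod_tonelli1//=; last 2 first.
  - apply/measurable_EFinP; apply: measurable_funM => //.
    by apply: (measurableT_comp (@normr_measurable R setT)); exact: measurableT_comp.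
  - by move=> q; rewrite lee_fin mulr_ge0.
  apply: (@le_trans _ _ (\int[leb]_z (Q%:E * `|V z|%:E))%E).
    apply: ge0_le_integral_pointwise => z.
      by apply: integral_ge0 => w _; rewrite lee_fin mulr_ge0.
    under eq_integral do rewrite EFinM.
    rewrite ge0_integralZl//; last 2 first.
    - exact/measurable_EFinP.
    - by move=> w _; rewrite lee_fin.
    by rewrite muleC lee_wpmul2r// lee_fin.
  by rewrite ge0_integralZl// VL -EFinM.
apply: (@le_trans _ _ (\int[leb2]_q ((`|V q.1| * k q.1 q.2)%:E + (`|V q.2| * k q.1 q.2)%:E))%E).
  apply: ge0_le_integral_pointwise => -[z w].
    by apply: integral_ge0 => x _; exact: F0.
  rewrite /increment_integrand.
  under eq_integral do rewrite srt1 mul1r EFinM.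
  rewrite ge0_integralZl//; last 3 first.
  - by apply/measurable_EFinP; exact: measurable_bridge_density2.
  - by move=> x _; rewrite lee_fin bridge_density2_ge0.
  - by rewrite lee_fin sqr_ge0.
  rewrite integral_bridge_density2// -EFinM -EFinD lee_fin /= -mulrDl -/u.
  rewrite /k mulrCA [leRHS]mulrCA ler_wpM2l ?invr_ge0 ?(ltW pt0)//.
  rewrite [leRHS]mulrA ler_wpM2r//.
    by case/andP: u0 => u0 ut; rewrite mulr_ge0// ltW// p_gt0// subr_gt0.
  rewrite -real_normK ?num_real// expr2 ler_pM//.
  exact: ler_normB.
rewrite ge0_integralD//; last 4 first.
- by move=> q _; rewrite lee_fin mulr_ge0.
- apply/measurable_EFinP; apply: measurable_funM => //.
  by apply: (measurableT_comp (@normr_measurable R setT)); exact: measurableT_comp.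
- by move=> q _; rewrite lee_fin mulr_ge0.
- apply/measurable_EFinP; apply: measurable_funM => //.
  by apply: (measurableT_comp (@normr_measurable R setT)); exact: measurableT_comp.
have -> : (2 * Q * L)%:E = ((Q * L)%:E + (Q * L)%:E)%E.
  by rewrite -EFinD; congr EFin; ring.
(* Since [k] is symmetric, exchanging [z] and [w] reduces the second half to the first. *)
apply: leeD => //; apply: le_trans half.
rewrite sfprod_tonelli2; last 2 first.
- apply/measurable_EFinP; apply: measurable_funM => //.
  by apply: (measurableT_comp (@normr_measurable R setT)); exact: measurableT_comp.
- by move=> q; rewrite lee_fin mulr_ge0.
rewrite sfprod_tonelli1; last 2 first.
- apply/measurable_EFinP; apply: measurable_funM => //.
  by apply: (measurableT_comp (@normr_measurable R setT)); exact: measurableT_comp.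
- by move=> q; rewrite lee_fin mulr_ge0.
rewrite le_eqVlt; apply/orP; left; apply/eqP.
apply: eq_integral => z _; apply: eq_integral => w _; by rewrite ksym.
Qed.

End increments.

End bridge_integrals.

(** * Second-order expansion of an exponential time functional *)

Section exponential_functional.
Context {R : realType} d (T : measurableType d) (P : probability T R).
Variables (t N : R).
Hypothesis t0 : 0 < t.
Hypothesis N0 : 0 <= N.
Local Notation mu := (@lebesgue_measure R).

Lemma integrable_bounded (f : T -> R) (c : R) :
  measurable_fun setT f -> (forall w, `|f w| <= c) -> P.-integrable setT (EFin \o f).
Proof.
move=> mf fc; apply: measurable_bounded_integrable => //.
  exact: le_lt_trans (probability_le1 P measurableT) (ltry 1).
exists c; split; first exact: num_real.
by move=> x cx w _ /=; rewrite (le_trans (fc w))// ltW.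
Qed.

Section time_integral.
Variables (f : measurableTypeR R * T -> R) (c : R).
Hypothesis mf : measurable_fun setT f.
Hypothesis f0 : forall q, 0 <= f q.
Hypothesis fc : forall q, f q <= c * itvI t q.1.

Definition time_integral (w : T) : R := \int[mu]_s f (s, w).

Let msect w : measurable_fun setT (fun s : measurableTypeR R => f (s, w)).
Proof. by apply: (measurableT_comp mf); exact: measurable_fun_pair. Qed.

Let bound w (s : measurableTypeR R) : `|f (s, w)| <= c * itvI t s.
Proof. by rewrite ger0_norm//; exact: fc. Qed.

Lemma measurable_time_integral : measurable_fun setT time_integral.
Proof.
apply: measurableT_comp => //.
apply: (measurable_fun_fubini_tonelli_G (fun q => (f q)%:E)).
- exact/measurable_EFinP.
- by move=> q; rewrite lee_fin.
Qed.

Lemma time_integralE w : (\int[mu]_s (f (s, w))%:E = (time_integral w)%:E)%E.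
Proof.
have i := integrable_le_itvI t0 (msect w) (bound w).
by rewrite -(fineK (integrable_fin_num measurableT i)).
Qed.

Lemma time_integral_ge0 w : 0 <= time_integral w.
Proof. by rewrite -lee_fin -time_integralE integral_ge0// => s _; rewrite lee_fin. Qed.

Lemma time_integral_le w : `|time_integral w| <= c * t.
Proof. exact: Rintegral_le_itvI. Qed.

Lemma integrable_time_integral : P.-integrable setT (EFin \o time_integral).
Proof. exact: integrable_bounded measurable_time_integral time_integral_le. Qed.

Lemma expectation_time_integral :
  (\int[P]_w \int[mu]_s (f (s, w))%:E = (\int[P]_w time_integral w)%:E)%E.
Proof.
under eq_integral do rewrite time_integralE.
by rewrite -(fineK (integrable_fin_num measurableT integrable_time_integral)).
Qed.

End time_integral.

Variable v : measurableTypeR R * T -> R.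
Hypothesis mv : measurable_fun setT v.
Hypothesis vN : forall q, `|v q| <= N * itvI t q.1.

Let vabs q := `|v q|.
(** [v] is the difference of the nonnegative functions [vplus] and [vabs], which brings the signed
    first-order term within reach of Tonelli. *)
Let vplus q := `|v q| + v q.
Let vsqr q := v q ^+ 2.

Let mabs : measurable_fun setT vabs. Proof. exact: measurableT_comp. Qed.
Let mplus : measurable_fun setT vplus. Proof. exact: measurable_funD. Qed.
Let msqr : measurable_fun setT vsqr. Proof. exact: measurable_funX. Qed.

Let abs0 q : 0 <= vabs q. Proof. exact: normr_ge0. Qed.
Let plus0 q : 0 <= vplus q. Proof. by rewrite /vplus; have := ler_norm (- v q); rewrite normrN; lra. Qed.
Let sqr0 q : 0 <= vsqr q. Proof. exact: sqr_ge0. Qed.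
Let plusc q : vplus q <= 2 * N * itvI t q.1.
Proof. by rewrite /vplus; have := vN q; have := ler_norm (v q); lra. Qed.
Let sqrc q : vsqr q <= N ^+ 2 * itvI t q.1.
Proof.
rewrite /vsqr -real_normK ?num_real// -itvI_idem -expr2 -exprMn.
by rewrite lerXn2r ?nnegrE// (le_trans _ (vN q)).
Qed.

Let A w := \int[mu]_s v (s, w).

Let AE w : A w = time_integral vplus w - time_integral vabs w.
Proof.
have ms g : measurable_fun setT g -> measurable_fun setT (fun s : measurableTypeR R => g (s, w) : R).
  by move=> mg; apply: (measurableT_comp mg); exact: measurable_fun_pair.
rewrite /time_integral -RintegralB//.
- by apply: eq_Rintegral => s _; rewrite /vplus /vabs addrAC subrr add0r.
- apply: (integrable_le_itvI t0 (ms _ mplus) (c := 2 * N)) => s.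
  by rewrite ger0_norm//; exact: plusc.
- apply: (integrable_le_itvI t0 (ms _ mabs) (c := N)) => s.
  by rewrite ger0_norm//; exact: vN.
Qed.

Let mA : measurable_fun setT A.
Proof.
rewrite (_ : A = (fun w => time_integral vplus w - time_integral vabs w)); last exact/funext.
by apply: measurable_funB; exact: measurable_time_integral.
Qed.

Let Aabs w : `|A w| <= time_integral vabs w.
Proof.
rewrite AE ler_norml; apply/andP; split.
  by rewrite lerBrDr addrC subrr; exact: time_integral_ge0.
rewrite lerBlDr -lee_fin EFinD.
rewrite -(time_integralE mplus plus0 plusc) -(time_integralE mabs abs0 vN).
have ma : measurable_fun setT (fun s : measurableTypeR R => (vabs (s, w))%:E).
  by apply/measurable_EFinP; apply: (measurableT_comp mabs); exact: measurable_fun_pair.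
rewrite -ge0_integralD//; last 2 first.
- by move=> s _; rewrite lee_fin.
- by move=> s _; rewrite lee_fin.
apply: ge0_le_integral_pointwise => s; first by rewrite lee_fin.
by rewrite -EFinD lee_fin /vplus lerD2l ler_norm.
Qed.

Let A_le w : `|A w| <= N * t.
Proof. by apply: le_trans (Aabs w) _; apply: le_trans (ler_norm _) (time_integral_le _ _ _ _). Qed.

Let D w := 2 * t * time_integral vsqr w - 2 * A w ^+ 2.

Lemma expectation_squared_increments :
  (\int[P]_w \int[mu]_s \int[mu]_r
     (itvI t s * itvI t r * (v (s, w) - v (r, w)) ^+ 2)%:E =
   (\int[P]_w D w)%:E)%E.
Proof.
have H w : (\int[mu]_s \int[mu]_r
     (itvI t s * itvI t r * (v (s, w) - v (r, w)) ^+ 2)%:E = (D w)%:E)%E.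
  apply: (double_integral_sqrB (N := N)) => //.
  by apply: (measurableT_comp mv); exact: measurable_fun_pair.
under eq_integral do rewrite H.
have iD : P.-integrable setT (EFin \o D).
  apply: (@integrable_bounded _ (2 * t * (N ^+ 2 * t) + 2 * (N * t) ^+ 2)).
    apply: measurable_funB; apply: measurable_funM => //.
      exact: measurable_time_integral.
    exact: measurable_funX.
  move=> w; rewrite /D; apply: le_trans (ler_normB _ _) _; apply: lerD.
    rewrite normrM ger0_norm ?mulr_ge0 ?(ltW t0)// ler_wpM2l ?mulr_ge0 ?(ltW t0)//.
    exact: time_integral_le.
  rewrite normrM ger0_norm// ler_wpM2l// normrX lerXn2r ?nnegrE// ?mulr_ge0//.
  exact: ltW.
by rewrite -(fineK (integrable_fin_num measurableT iD)).
Qed.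

(** By definition of [D], [A^2 / 2] is [t / 2] times the integral of [v^2], minus [D / 4]; hence the
    left side is the mean Taylor remainder. In [|A|^3 exp|A|] two factors are bounded by [N t], and
    the third is kept as the integral of [|v|], which later yields the L1 norm of [V]. *)
Lemma expectation_expR_expansion :
  `|fine 'E_P[(fun w => expR (- \int[mu]_s v (s, w))%R)]%E - 1
    + \int[P]_w time_integral vplus w - \int[P]_w time_integral vabs w
    - t / 2 * \int[P]_w time_integral vsqr w + 4^-1 * \int[P]_w D w| <=
  N ^+ 2 * t ^+ 2 * expR (t * N) * \int[P]_w time_integral vabs w.
Proof.
pose r w := expR (- A w) - (1 - A w + A w ^+ 2 / 2).
have rbound w : `|r w| <= N ^+ 2 * t ^+ 2 * expR (t * N) * time_integral vabs w.
  have := expR_taylor2 (- A w); rewrite normrN sqrrN opprK.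
  rewrite (_ : _ - 1 + _ - _ = r w); last by rewrite /r; ring.
  move=> H; apply: le_trans H _.
  rewrite (_ : `|A w| ^+ 3 * _ = `|A w| ^+ 2 * expR `|A w| * `|A w|); last by ring.
  apply: ler_pM (Aabs w) => //.
  rewrite -exprMn; apply: ler_pM; rewrite ?expR_ge0 ?exprn_ge0//.
    by rewrite lerXn2r ?nnegrE ?mulr_ge0 ?(ltW t0).
  by rewrite ler_expR mulrC.
have i1 := integrable_time_integral mplus plus0 plusc.
have ib := integrable_time_integral mabs abs0 vN.
have i2 := integrable_time_integral msqr sqr0 sqrc.
have iA : P.-integrable setT (EFin \o (fun w => A w ^+ 2)).
  apply: (@integrable_bounded _ ((N * t) ^+ 2)); first exact: measurable_funX.
  by move=> w; rewrite normrX lerXn2r ?nnegrE ?mulr_ge0 ?(ltW t0).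
have i2' := integrableZl measurableT (2 * t) i2.
have iA' := integrableZl measurableT 2 iA.
have iD : P.-integrable setT (EFin \o D) := integrableB measurableT i2' iA'.
have ie : P.-integrable setT (EFin \o (fun w => expR (- A w))).
  apply: (@integrable_bounded _ (expR (N * t))).
    by apply: measurableT_comp => //; exact: measurableT_comp.
  move=> w; rewrite ger0_norm ?expR_ge0// ler_expR.
  by apply: le_trans (A_le w); rewrite -normrN ler_norm.
have i0 : P.-integrable setT (EFin \o (fun=> 1 : R)).
  by apply: (@integrable_bounded _ 1) => // w; rewrite normr1.
have ir1 := integrableB measurableT ie i0.
have ir2 := integrableD measurableT ir1 i1.
have ir3 := integrableB measurableT ir2 ib.
have i2'' := integrableZl measurableT (t / 2) i2.
have ir4 := integrableB measurableT ir3 i2''.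
have iD' := integrableZl measurableT 4^-1 iD.
have ir5 := integrableD measurableT ir4 iD'.
have rE : r = (fun w => expR (- A w) - 1 + time_integral vplus w - time_integral vabs w
    - t / 2 * time_integral vsqr w + 4^-1 * D w).
  by apply/funext => w; rewrite /r /D; have := AE w; lra.
have <- : \int[P]_w r w = fine 'E_P[(fun w => expR (- \int[mu]_s v (s, w))%R)]%E - 1
    + \int[P]_w time_integral vplus w - \int[P]_w time_integral vabs w
    - t / 2 * \int[P]_w time_integral vsqr w + 4^-1 * \int[P]_w D w.
  rewrite rE RintegralD// RintegralB// RintegralB// RintegralD// RintegralB//.
  rewrite RintegralZl// RintegralZl// Rintegral_cst// [X in _ * fine X]probability_setT mulr1.
  by rewrite unlock.
have ir : P.-integrable setT (EFin \o r) by rewrite rE.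
apply: le_trans (le_normr_Rintegral measurableT ir) _.
rewrite -RintegralZl//; apply: le_Rintegral => //.
- exact: (integrable_norm ir).
- exact: (integrableZl measurableT _ ib).
Qed.
End exponential_functional.

Section bridge_expansion.
Context {R : realType} {d : nat}.
Variables (alpha m gamma M t N : R) (V : euclid R d -> R) (p : R -> euclid R d -> R).
Hypothesis t0 : 0 < t.
Hypothesis gamma0 : 0 < gamma.
Hypothesis mV : measurable_fun setT V.
Hypothesis Vholder : forall x y, `|V x - V y| <= M * enorm (vsub x y) `^ gamma.
Hypothesis VN : forall x, `|V x| <= N.
Hypothesis pE : forall s x, heat_kernel alpha m s x = p s x.
Hypothesis p_gt0 : forall s x, 0 < s -> 0 < p s x.
Hypothesis measurable_p : forall d' (T : measurableType d') (f : T -> R)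
    (g : T -> euclid R d), measurable_fun setT f -> measurable_fun setT g ->
  measurable_fun setT (fun q => p (f q) (g q)).
Local Notation mu := (@lebesgue_measure R).

Let mabs : measurable_fun setT (fun z => `|V z|).
Proof. exact: measurableT_comp. Qed.
Let mplus : measurable_fun setT (fun z => `|V z| + V z).
Proof. exact: measurable_funD. Qed.
Let msqr : measurable_fun setT (fun z => V z ^+ 2).
Proof. exact: measurable_funX. Qed.

Variables (x : euclid R d) (B : process R d).
Hypothesis bridgeB : is_bridge alpha m t x x B.
Local Notation P := (process_law B).
Local Notation X := (process_path B).

(** The four quantities on the left of the equations do not involve the bridge [B]. The existential
    reals record that they are finite at this particular [x]. *)
Lemma bridge_expansion : exists l1 lb l2 D : R,
  [/\ occupation t p (fun z => `|V z| + V z) x = l1%:E,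
      occupation t p (fun z => `|V z|) x = lb%:E,
      occupation t p (fun z => V z ^+ 2) x = l2%:E,
      increments t p V x = D%:E &
  `|fine 'E_P[(fun w => expR (- \int[mu]_(s in `[0, t]) V (X s w)))%R]%E - 1
     + l1 - lb - t / 2 * l2 + 4^-1 * D| <=
   N ^+ 2 * t ^+ 2 * expR (t * N) * lb].
Proof.
have N0 : 0 <= N by apply: le_trans (VN vzero).
pose v (q : measurableTypeR R * process_space B) := itvI t q.1 * V (X q.1 q.2).
have mv : measurable_fun setT v.
  rewrite (_ : v = fun q => V (X q.1 q.2) * itvI t q.1); last first.
    by apply/funext => q; exact: mulrC.
  apply: (measurable_path t0 gamma0 mV Vholder).
  - exact: (bridge_measurable bridgeB).
  - by move=> w; have [] := bridge_rcll bridgeB w.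
have normv q : `|v q| = itvI t q.1 * `|V (X q.1 q.2)|.
  by rewrite normrM ger0_norm// itvI_ge0.
have vN q : `|v q| <= N * itvI t q.1.
  by rewrite normv mulrC ler_wpM2r// itvI_ge0.
have plusE q : `|v q| + v q = itvI t q.1 * (`|V (X q.1 q.2)| + V (X q.1 q.2)).
  by rewrite normv mulrDr.
have sqrE q : v q ^+ 2 = itvI t q.1 * V (X q.1 q.2) ^+ 2.
  by rewrite exprMn expr2 itvI_idem.
have sqrv0 q : 0 <= v q ^+ 2 by exact: sqr_ge0.
have plus0 q : 0 <= `|v q| + v q by have := ler_norm (- v q); rewrite normrN; lra.
have plusc q : `|v q| + v q <= 2 * N * itvI t q.1.
  by have := vN q; have := ler_norm (v q); lra.
have sqrc q : v q ^+ 2 <= N ^+ 2 * itvI t q.1.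
  rewrite sqrE mulrC ler_wpM2r ?itvI_ge0// -real_normK ?num_real//.
  by rewrite lerXn2r ?nnegrE.
have occE (phi : euclid R d -> R) : measurable_fun setT phi -> (forall z, 0 <= phi z) ->
    forall (f : measurableTypeR R * process_space B -> R) c, measurable_fun setT f -> (forall q, 0 <= f q) ->
    (forall q, f q <= c * itvI t q.1) ->
    (forall q, f q = itvI t q.1 * phi (X q.1 q.2)) ->
    occupation t p phi x = (\int[P]_w time_integral f w)%:E.
  move=> mphi phi0 f c mf f0 fc fE.
  rewrite -(expectation_time_integral P t0 mf f0 fc).
  rewrite -(bridge_occupation t0 pE p_gt0 measurable_p mphi phi0 bridgeB).
    by apply: eq_integral => w _; apply: eq_integral => s _; rewrite fE.
  by rewrite (_ : (fun q => _) = f)//; apply/funext => q; rewrite fE.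
have mabsv : measurable_fun setT (fun q => `|v q|) by exact: measurableT_comp.
have mplusv : measurable_fun setT (fun q => `|v q| + v q) by exact: measurable_funD.
have msqrv : measurable_fun setT (fun q => v q ^+ 2) by exact: measurable_funX.
have exp := expectation_expR_expansion P t0 N0 mv vN.
(* The endpoints form a null set, so the closed interval of the Feynman-Kac exponent may be replaced
   by the open one. *)
have EE : (fun w => expR (- \int[mu]_(s in `[0, t]) V (X s w))) =
    (fun w => expR (- \int[mu]_s v (s, w))).
  apply/funext => w; congr (expR (- _)).
  rewrite /Rintegral; congr fine.
  have mvw : measurable_fun setT (fun s : measurableTypeR R => v (s, w)).
    by apply: (measurableT_comp mv); exact: measurable_fun_pair.
  have vE (s : R) : `]0, t[%classic s -> v (s, w) = V (X s w).
    by rewrite /= in_itv/= /v itvIE/= => ->; rewrite mul1r.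
  rewrite integral_itv_bndoo; last first.
    apply/measurable_EFinP; apply: (eq_measurable_fun (fun s => v (s, w))).
      by move=> s /set_mem; exact: vE.
    exact: measurable_funTS.
  rewrite [LHS]integral_mkcond; apply: eq_integral => s _; rewrite patchE.
  case: ifPn => [/set_mem/vE->//|/negP ns].
  rewrite /v itvIE; case: ifPn => [st|_]; last by rewrite mul0r.
  by exfalso; apply: ns; rewrite inE/= in_itv.
rewrite EE; exists (\int[P]_w time_integral (fun q => `|v q| + v q) w),
  (\int[P]_w time_integral (fun q => `|v q|) w),
  (\int[P]_w time_integral (fun q => v q ^+ 2) w),
  (\int[P]_w (2 * t * time_integral (fun q => v q ^+ 2) w
     - 2 * (\int[mu]_s v (s, w)) ^+ 2)); split; last exact: exp; last first.
- rewrite -(bridge_increments t0 pE p_gt0 measurable_p mV bridgeB)//.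
  rewrite -(expectation_squared_increments P t0 N0 mv vN).
  apply: eq_integral => w _; apply: eq_integral => s _; apply: eq_integral => r _.
  congr EFin; rewrite /v !itvIE /=.
  by case: ifP => _; case: ifP => _; rewrite ?mul0r ?mulr0 ?mul0r// !mul1r.
- exact: (occE _ msqr (fun z => sqr_ge0 (V z)) _ _ msqrv sqrv0 sqrc sqrE).
- exact: (occE _ mabs (fun z => normr_ge0 (V z)) _ _ mabsv (fun q => normr_ge0 (v q)) vN normv).
- apply: (occE _ mplus _ _ _ mplusv plus0 plusc plusE) => z.
  by have := ler_norm (- V z); rewrite normrN; lra.
Qed.

End bridge_expansion.

Lemma Rintegral_lincomb4 d (T : measurableType d) (R : realType)
    (mu : {measure set T -> \bar R}) (f1 f2 f3 f4 : T -> R) (a1 a2 a3 a4 : R) :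
  mu.-integrable setT (EFin \o f1) -> mu.-integrable setT (EFin \o f2) ->
  mu.-integrable setT (EFin \o f3) -> mu.-integrable setT (EFin \o f4) ->
  mu.-integrable setT (EFin \o (fun x => a1 * f1 x + a2 * f2 x + a3 * f3 x + a4 * f4 x)) /\
  \int[mu]_x (a1 * f1 x + a2 * f2 x + a3 * f3 x + a4 * f4 x) =
  a1 * \int[mu]_x f1 x + a2 * \int[mu]_x f2 x + a3 * \int[mu]_x f3 x + a4 * \int[mu]_x f4 x.
Proof.
move=> i1 i2 i3 i4.
have j1 := integrableZl measurableT a1 i1.
have j2 := integrableZl measurableT a2 i2.
have j3 := integrableZl measurableT a3 i3.
have j4 := integrableZl measurableT a4 i4.
have j12 := integrableD measurableT j1 j2.
have j123 := integrableD measurableT j12 j3.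
split; first exact: (integrableD measurableT j123 j4).
by rewrite !RintegralD// !RintegralZl.
Qed.

(** * The trace *)

Section trace_bound.
Context {R : realType} {d : nat}.
Variables (alpha m gamma M t N Q : R) (V kap : euclid R d -> R) (p : R -> euclid R d -> R).
Variable bridge : R -> euclid R d -> euclid R d -> process R d.
Hypothesis t0 : 0 < t.
Hypothesis gamma0 : 0 < gamma.
Hypothesis Vholder : forall x y, `|V x - V y| <= M * enorm (vsub x y) `^ gamma.
Hypothesis iV : leb.-integrable setT (EFin \o V).
Hypothesis VN : forall x, `|V x| <= N.
Hypothesis pE : forall s x, heat_kernel alpha m s x = p s x.
Hypothesis p_gt0 : forall s x, 0 < s -> 0 < p s x.
Hypothesis p_sym : forall s x y, p s (vsub x y) = p s (vsub y x).
Hypothesis measurable_p : forall d' (T : measurableType d') (f : T -> R)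
    (g : T -> euclid R d), measurable_fun setT f -> measurable_fun setT g ->
  measurable_fun setT (fun q => p (f q) (g q)).
Hypothesis p_CK : forall t s x y, 0 < s < t ->
  (\int[leb]_z (p s (vsub z x) * p (t - s) (vsub y z))%:E = (p t (vsub x y))%:E)%E.
Hypothesis mkap : measurable_fun setT kap.
Hypothesis kap0 : forall y, 0 <= kap y.
Hypothesis kap_sym : forall z w, kap (vsub z w) = kap (vsub w z).
Hypothesis V_kap : forall z w, `|V z - V w| <= kap (vsub w z).
Hypothesis Q0 : 0 <= Q.
Hypothesis kapQ : forall u z, 0 < u < t ->
  (\int[leb]_w (kap (vsub w z) * (p u (vsub w z) * p (t - u) (vsub w z)))%:E <=
   (Q * p t vzero)%:E)%E.
Hypothesis bridgeP : forall x, is_bridge alpha m t x x (bridge t x x).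

Let L := \int[leb]_x `|V x|.

Let mV : measurable_fun setT V.
Proof. by apply/measurable_EFinP; exact: (measurable_int leb). Qed.

Let iabs : leb.-integrable setT (EFin \o (fun x => `|V x|)).
Proof. exact: (integrable_norm iV). Qed.

Let iplus : leb.-integrable setT (EFin \o (fun x => `|V x| + V x)).
Proof. exact: (integrableD measurableT iabs iV). Qed.

Let isqr : leb.-integrable setT (EFin \o (fun x => V x ^+ 2)).
Proof.
apply: (le_integrable _ _ _ (integrableZl measurableT N iabs)) => //.
  by apply/measurable_EFinP; exact: measurable_funX.
move=> x _ /=; rewrite lee_fin normrX expr2 [leRHS]ger0_norm ?ler_wpM2r//.
by rewrite mulr_ge0// (le_trans _ (VN x)).
Qed.

Let integrable_fine (g : euclid R d -> \bar R) (c : R) : measurable_fun setT g ->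
  (forall x, exists r : R, g x = r%:E) -> (forall x, (0 <= g x)%E) ->
  (\int[leb]_x g x <= c%:E)%E ->
  leb.-integrable setT (EFin \o (fine \o g)) /\
  (\int[leb]_x g x = (\int[leb]_x fine (g x))%:E)%E.
Proof.
move=> mg fg g0 gc; have E : EFin \o (fine \o g) = g.
  by apply/funext => x /=; have [r ->] := fg x.
have ig : leb.-integrable setT g.
  apply/integrableP; split=> //; apply: le_lt_trans (ltry c).
  by under eq_integral do rewrite gee0_abs//.
rewrite E; split => //.
rewrite -(fineK (integrable_fin_num measurableT ig)); congr ((fine _)%:E).
by apply: eq_integral => x _; rewrite -[in LHS]E.
Qed.

Let occP (phi : euclid R d -> R) : measurable_fun setT phi -> (forall z, 0 <= phi z) ->
  leb.-integrable setT (EFin \o phi) ->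
  (forall x, exists r : R, occupation t p phi x = r%:E) ->
  exists f : euclid R d -> R, [/\ leb.-integrable setT (EFin \o f),
    \int[leb]_x f x = t * \int[leb]_x phi x &
    forall x, occupation t p phi x = (f x)%:E].
Proof.
move=> mphi phi0 iphi fin.
have H := integral_occupation t0 p_gt0 p_sym measurable_p p_CK mphi phi0.
have E : (t%:E * \int[leb]_z (phi z)%:E = (t * \int[leb]_x phi x)%:E)%E.
  by rewrite -(fineK (integrable_fin_num measurableT iphi)).
rewrite E in H; exists (fine \o occupation t p phi).
have [] := @integrable_fine (occupation t p phi) (t * \int[leb]_x phi x).
- exact: measurable_occupation.
- exact: fin.
- by move=> x; exact: occupation_ge0.
- by rewrite H.
move=> i; rewrite H => -[->]; split => // x /=.
by have [r ->] := fin x.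
Qed.

Let expansion x := bridge_expansion t0 gamma0 mV Vholder VN pE p_gt0 measurable_p (bridgeP x).

Let F x := feynman_kac_kernel alpha m V bridge t x x - heat_kernel alpha m t (vsub x x).

Lemma trace_difference_bound :
  `|trace_difference alpha m V bridge t + p t vzero * t * \int[leb]_x V x
     - p t vzero * (2^-1 * t ^+ 2) * \int[leb]_x (`|V x| ^+ 2)| <=
  p t vzero * L * (Q * t ^+ 2 / 2 + N ^+ 2 * t ^+ 3 * expR (t * N)).
Proof.
have pt0 := p_gt0 (vzero : euclid R d) t0.
have plus0 z : 0 <= `|V z| + V z by have := ler_norm (- V z); rewrite normrN; lra.
have [f1 [i1 I1 f1E]] : exists f : euclid R d -> R, [/\ leb.-integrable setT (EFin \o f),
    \int[leb]_x f x = t * \int[leb]_x (`|V x| + V x) &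
    forall x, occupation t p (fun z => `|V z| + V z) x = (f x)%:E].
  apply: occP => //; first by apply: measurable_funD => //; exact: measurableT_comp.
  by move=> x; have [l1 [_ [_ [_ [-> _ _ _ _]]]]] := expansion x; exists l1.
have [fb [ib Ib fbE]] : exists f : euclid R d -> R, [/\ leb.-integrable setT (EFin \o f),
    \int[leb]_x f x = t * L & forall x, occupation t p (fun z => `|V z|) x = (f x)%:E].
  apply: occP => //; first exact: measurableT_comp.
  by move=> x; have [_ [lb [_ [_ [_ -> _ _ _]]]]] := expansion x; exists lb.
have [f2 [i2 I2 f2E]] : exists f : euclid R d -> R, [/\ leb.-integrable setT (EFin \o f),
    \int[leb]_x f x = t * \int[leb]_x (V x ^+ 2) &
    forall x, occupation t p (fun z => V z ^+ 2) x = (f x)%:E].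
  apply: occP => //; [exact: measurable_funX|by move=> z; exact: sqr_ge0|].
  by move=> x; have [_ [_ [l2 [_ [_ _ -> _ _]]]]] := expansion x; exists l2.
have [D [iD DE ID0 IDle]] : exists D : euclid R d -> R, [/\ leb.-integrable setT (EFin \o D),
    forall x, increments t p V x = (D x)%:E,
    0 <= \int[leb]_x D x & \int[leb]_x D x <= 2 * Q * L * t ^+ 2].
  have VL : (\int[leb]_z `|V z|%:E = L%:E)%E.
    by rewrite -(fineK (integrable_fin_num measurableT iabs)).
  have H := integral_increments_le t0 p_gt0 p_sym measurable_p p_CK mV mkap kap0
    kap_sym V_kap Q0 kapQ VL.
  have [|||//|iD E] := @integrable_fine (increments t p V) (2 * Q * L * t ^+ 2).
  - exact: measurable_increments.
  - by move=> x; have [_ [_ [_ [D' [_ _ _ -> _]]]]] := expansion x; exists D'.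
  - by move=> x; exact: increments_ge0.
  exists (fine \o increments t p V); rewrite E in H; split => //.
  - by move=> x /=; have [_ [_ [_ [D' [_ _ _ -> _]]]]] := expansion x.
  - rewrite -lee_fin -E; apply: integral_ge0 => x _; exact: increments_ge0.
pose eps := N ^+ 2 * t ^+ 2 * expR (t * N).
pose p0 := p t vzero.
(* The expectation of [-A] is [fb - f1], so the expansion reads
   [F = p0 (fb - f1 + (t / 2) f2 - D / 4)] up to [p0 eps fb]. The error has the shape of the first
   term, so taking [c = 1 - eps] and [c = 1 + eps] encloses [F] between two integrable functions. *)
pose G c x := p0 * c * fb x + (- p0) * f1 x
  + p0 * (t / 2) * f2 x + (- p0 * 4^-1) * D x.
have Iplus : \int[leb]_x (`|V x| + V x) = L + \int[leb]_x V x by exact: RintegralD.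
have GP c : leb.-integrable setT (EFin \o G c) /\ \int[leb]_x G c x =
    p0 * c * (t * L) + (- p0) * (t * (L + \int[leb]_x V x))
      + p0 * (t / 2) * (t * \int[leb]_x (V x ^+ 2)) + (- p0 * 4^-1) * \int[leb]_x D x.
  have [iG EG] := Rintegral_lincomb4 (p0 * c) (- p0) (p0 * (t / 2)) (- p0 * 4^-1) ib i1 i2 iD.
  split; first exact: iG.
  rewrite Ib in EG.
  rewrite I1 in EG.
  rewrite I2 in EG.
  rewrite Iplus in EG.
  exact: EG.
have FG x : G (1 - eps) x <= F x <= G (1 + eps) x.
  rewrite /F /feynman_kac_kernel vsubxx !pE /G.
  have [l1 [lb [l2 [D' []]]]] := expansion x.
  rewrite f1E fbE f2E DE => -[->] [->] [->] [->].
  set E := fine _; rewrite -/eps => H.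
  have lin c : p0 * c * lb + - p0 * l1 + p0 * (t / 2) * l2 + - p0 * 4^-1 * D' =
      p0 * (c * lb - l1 + t / 2 * l2 - 4^-1 * D') by ring.
  rewrite -/p0 !lin -[X in _ <= _ - X <= _]mulr1 -mulrBr !ler_pM2l//.
  by move: H; rewrite ler_norml => /andP[H1 H2]; apply/andP; split; lra.
have [iG1 EG1] := GP (1 - eps); have [iG2 EG2] := GP (1 + eps).
rewrite -/p0 in pt0 *.
have := integral_sandwich iG1 iG2 FG; rewrite EG1 EG2.
rewrite -/(trace_difference alpha m V bridge t) => /andP[H1 H2].
have sqrE : \int[leb]_x (`|V x| ^+ 2) = \int[leb]_x (V x ^+ 2).
  by apply: eq_Rintegral => x _; rewrite real_normK ?num_real.
rewrite sqrE.
have L0 : 0 <= L by exact: Rintegral_ge0.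
have QL : p0 * (4^-1 * \int[leb]_x D x) <= p0 * (Q * L * t ^+ 2 / 2).
  by rewrite ler_pM2l//; lra.
have QL0 : 0 <= p0 * (4^-1 * \int[leb]_x D x) by rewrite mulr_ge0 ?mulr_ge0 ?(ltW pt0).
have QL1 : 0 <= p0 * (Q * L * t ^+ 2 / 2).
  by rewrite mulr_ge0 ?(ltW pt0)// divr_ge0// mulr_ge0 ?sqr_ge0// mulr_ge0.
rewrite ler_norml; move: QL QL0 QL1 H1 H2; rewrite /eps.
move: (trace_difference _ _ _ _ _) (\int[leb]_x D x) (\int[leb]_x V x) (\int[leb]_x (V x ^+ 2)).
move: (expR _) => e Tr I I' I'' QL QL0 QL1 H1 H2; apply/andP; split.
- have E : Tr + p0 * t * I' - p0 * (2^-1 * t ^+ 2) * I'' +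
      p0 * L * (Q * t ^+ 2 / 2 + N ^+ 2 * t ^+ 3 * e) =
      (Tr - (p0 * (1 - N ^+ 2 * t ^+ 2 * e) * (t * L) + - p0 * (t * (L + I'))
        + p0 * (t / 2) * (t * I'') + - p0 * 4^-1 * I))
      + (p0 * (Q * L * t ^+ 2 / 2) - p0 * (4^-1 * I)) by field.
  by rewrite -subr_ge0 opprK E addr_ge0// subr_ge0.
- have E : p0 * L * (Q * t ^+ 2 / 2 + N ^+ 2 * t ^+ 3 * e) -
      (Tr + p0 * t * I' - p0 * (2^-1 * t ^+ 2) * I'') =
      ((p0 * (1 + N ^+ 2 * t ^+ 2 * e) * (t * L) + - p0 * (t * (L + I'))
        + p0 * (t / 2) * (t * I'') + - p0 * 4^-1 * I) - Tr)
      + (p0 * (Q * L * t ^+ 2 / 2) + p0 * (4^-1 * I)) by field.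
  by rewrite -subr_ge0 E addr_ge0// ?subr_ge0// addr_ge0.
Qed.

End trace_bound.

(** * From the essential supremum to a pointwise bound *)

Section continuous_essential_bound.
Context {R : realType} {d : nat}.
Variables (gamma M : R) (V : euclid R d -> R).
Hypothesis gamma0 : 0 < gamma.
Hypothesis M0 : 0 < M.
Hypothesis Vholder : forall x y, `|V x - V y| <= M * enorm (vsub x y) `^ gamma.

(** If [|V x|] exceeded the norm, continuity would keep [|V|] above it on a small box at [x], which
    has positive measure. *)
Lemma holder_le_Linfnorm x : V \in Lfun leb +oo%E -> `|V x| <= Linfnorm V.
Proof.
move=> /sub_Lfun_finLfun/set_mem; rewrite /finite_norm /Linfnorm => Vfin.
rewrite leNgt; apply/negP => xN; set N := fine _ in xN.
have NE : ('N[leb]_+oo[EFin \o V] = N%:E)%E.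
  by rewrite fineK// ge0_fin_numE// Lnorm_ge0.
pose e := (`|V x| - N) / 2; have e0 : 0 < e by rewrite divr_gt0// subr_gt0.
pose delta := (e / M) `^ gamma^-1.
have delta0 : 0 < delta by rewrite powR_gt0// divr_gt0.
(* The diagonal of a box of side [r] is at most [delta]; the successor keeps the divisor nonzero in
   dimension 0. *)
pose r := delta / d.+1%:R; have r0 : 0 < r by rewrite divr_gt0.
set b := [set y : euclid R d | forall i : 'I_d, tnth x i <= (tnth y i : R) <= tnth x i + r].
have mub : leb b = (r ^+ d)%:E by exact: leb_box.
(* The norm of exponent [+oo] is the essential supremum only when the whole space has positive
   measure. *)
have mT : (0 < (leb : set (euclid R d) -> \bar R) setT)%E.
  apply: (@lt_le_trans _ _ (leb b)); first by rewrite mub lte_fin exprn_gt0.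
  by apply: le_measure => //; rewrite inE; [exact: measurable_box|exact: measurableT].
have : (\forall y \ae leb, (`|V y|%:E <= N%:E)%E).
  move: NE; rewrite unlock /= mT => <-; exact: ess_sup_ge.
case=> /= S [mS S0 HS].
have bS : b `<=` S.
  move=> y yb; apply: HS => /=; rewrite lee_fin => yN.
  have dist : enorm (vsub x y) <= delta.
    rewrite -(@ler_pXn2r _ 2) ?nnegrE ?enorm_ge0 ?(ltW delta0)//.
    apply: le_trans (enorm_box (ltW r0) _) _.
      move=> i; rewrite tnth_mktuple; have /andP[y1 y2] := yb i.
      by rewrite ler_norml; apply/andP; split; lra.
    rewrite /r expr_div_n mulrCA -[leRHS]mulr1 ler_wpM2l ?sqr_ge0//.
    rewrite ler_pdivrMr ?exprn_gt0// mul1r -natrX ler_nat.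
    by rewrite (leq_trans (leqnSn d))// leq_pmulr.
  have := Vholder x y; have := lerB_dist (V x) (V y).
  suff : M * enorm (vsub x y) `^ gamma <= e by move: xN yN e0; rewrite /e; lra.
  rewrite mulrC -ler_pdivlMr//.
  apply: (@le_trans _ _ (delta `^ gamma)).
    by rewrite ge0_ler_powR ?nnegrE ?enorm_ge0 ?powR_ge0// ltW.
  by rewrite -powRrM mulVf ?gt_eqF// powRr1// ltW// divr_gt0.
have : (leb b <= leb S)%E by apply: le_measure => //; rewrite inE//; exact: measurable_box.
by rewrite S0 mub lee_fin leNgt exprn_gt0.
Qed.

Lemma Lfun1_L1norm : V \in Lfun leb 1 ->
  leb.-integrable setT (EFin \o V) /\ L1norm V = \int[leb]_x `|V x|.
Proof.
by move=> /Lfun1_integrable iV; split => //; rewrite /L1norm Lnorm1.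
Qed.

End continuous_essential_bound.

Section bridge_mass.
Context {R : realType} {d : nat}.
Variables (alpha m : R).

(** The sign of the heat kernel is unknown when this is applied, so positive and negative parts are
    reduced separately. *)
Lemma integral_tuple_measure1 (f : 1.-tuple (euclid R d) -> R) :
  measurable_fun setT f ->
  (\int[tuple_measure leb 1]_z (f z)%:E = \int[leb]_z (f [tuple z])%:E)%E.
Proof.
move=> mf; rewrite integralE [RHS]integralE.
have m1 : measurable_fun setT (EFin \o f) by exact/measurable_EFinP.
congr (_ - _)%E; rewrite ge0_integral_tuple_measure1//.
- by apply: eq_integral => z _; rewrite !funeposE.
- exact: (measurable_funepos m1).
- by apply: eq_integral => z _; rewrite !funenegE.
- exact: (measurable_funeneg m1).
Qed.

Lemma bridge_mass1 (bridge : R -> euclid R d -> euclid R d -> process R d) :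
  (forall t x y, 0 < t -> is_bridge alpha m t x y (bridge t x y)) ->
  forall t s (x y : euclid R d), 0 < s < t ->
  (\int[leb]_z ((heat_kernel alpha m t (vsub x y))^-1 *
     (heat_kernel alpha m s (vsub z x) * heat_kernel alpha m (t - s) (vsub y z)))%:E = 1)%E.
Proof.
move=> bridgeP t s x y /andP[s0 st].
have bB := bridgeP t x y (lt_trans s0 st).
have := bridge_fdd bB (s := [tuple s]) isT _ measurableT.
rewrite /= s0 st/= => /(_ isT).
rewrite (_ : [set w | _] = setT); last by apply/seteqP.
rewrite [LHS]probability_setT => ->.
rewrite (eq_integral (fun q => ((heat_kernel alpha m t (vsub x y))^-1 *
     (heat_kernel alpha m s (vsub (tnth q ord0) x) *
      heat_kernel alpha m (t - s) (vsub y (tnth q ord0))))%:E)); last first.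
  move=> q _; congr EFin; rewrite /bridge_density.
  rewrite !big_ord_recl big_ord0/= subr0 mulr1 (tnth_nth x).
  by case: q => -[|z []].
rewrite integral_tuple_measure1//.
have mq : measurable_fun setT (fun q : 1.-tuple (euclid R d) => tnth q ord0) by exact: measurable_tnth.
apply: measurable_funM => //; apply: measurable_funM.
- by apply: measurable_fun_heat_kernel => //; exact: measurable_fun_vsub.
- by apply: measurable_fun_heat_kernel => //; exact: measurable_fun_vsub.
Qed.

End bridge_mass.

(** * A modulus for [V] and its integral against products of kernels *)

Section holder_modulus.
Context {R : realType} {d : nat}.
Variables (gamma M N : R).
Hypothesis M0 : 0 < M.
Hypothesis N0 : 0 <= N.
Implicit Types y z w : euclid R d.

(* The two indicators overlap on the unit sphere, which only enlarges the bound. *)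
Definition holder_modulus y : R :=
  M * (enorm y `^ gamma * \1_[set y : euclid R d | enorm y <= 1] y) +
  2 * N * \1_[set y : euclid R d | 1 <= enorm y] y.

Lemma measurable_holder_modulus : measurable_fun setT holder_modulus.
Proof.
have mne : measurable_fun setT (@enorm R d) by exact: measurable_enorm.
apply: measurable_funD; apply: measurable_funM => //.
- apply: measurable_funM; first exact: (measurableT_comp (measurable_powR _)).
  apply: measurable_indic; rewrite (_ : mkset _ = (@enorm R d) @^-1` `]-oo, 1]%classic).
    by rewrite -[X in measurable X]setTI; exact: mne.
  by apply/seteqP; split => z/=; rewrite in_itv/=.
- apply: measurable_indic; rewrite (_ : mkset _ = (@enorm R d) @^-1` `[1, +oo[%classic).
    by rewrite -[X in measurable X]setTI; exact: mne.
  by apply/seteqP; split => z/=; rewrite in_itv/= andbT.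
Qed.

Lemma holder_modulus_ge0 y : 0 <= holder_modulus y.
Proof.
by rewrite addr_ge0// mulr_ge0 ?(ltW M0)// ?mulr_ge0 ?powR_ge0// indicE ler0n.
Qed.

Lemma holder_modulus_sym z w : holder_modulus (vsub z w) = holder_modulus (vsub w z).
Proof.
have E1 y : (y \in [set y : euclid R d | enorm y <= 1]) = (enorm y <= 1).
  by apply/idP/idP => [/set_mem|/mem_set].
have E2 y : (y \in [set y : euclid R d | 1 <= enorm y]) = (1 <= enorm y).
  by apply/idP/idP => [/set_mem|/mem_set].
by rewrite /holder_modulus !indicE !E1 !E2 enorm_vsubC.
Qed.

Lemma le_holder_modulus (V : euclid R d -> R) z w :
  (forall x y, `|V x - V y| <= M * enorm (vsub x y) `^ gamma) ->
  (forall x, `|V x| <= N) -> `|V z - V w| <= holder_modulus (vsub w z).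
Proof.
move=> Vholder VN; rewrite -holder_modulus_sym /holder_modulus !indicE.
have [le1|gt1] := leP (enorm (vsub z w)) 1.
  rewrite mem_set// mulr1; apply: le_trans (Vholder z w) _.
  by rewrite lerDl !mulr_ge0// ler0n.
rewrite memNset/=; last by apply/negP; rewrite -ltNge.
rewrite mem_set/= ?(ltW gt1)// !mulr0 mulr1 add0r.
by apply: le_trans (ler_normB _ _) _; rewrite mulr2n mulrDl mul1r lerD.
Qed.

Section product_kernel.
Variables (alpha t CM CT CD : R) (p : R -> euclid R d -> R).
Hypothesis t01 : 0 < t <= 1.
Hypothesis alpha0 : 0 < alpha.
Hypothesis gamma0 : 0 < gamma.
Hypothesis CM0 : 0 <= CM.
Hypothesis CT0 : 0 <= CT.
Hypothesis CD0 : 0 <= CD.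
Hypothesis p_gt0 : forall s x, 0 < s -> 0 < p s x.
Hypothesis p_le0 : forall s x, 0 < s -> p s x <= p s vzero.
Hypothesis p_anti : forall s r, 0 < s -> s <= r -> p r vzero <= p s vzero.
Hypothesis measurable_p_shift : forall t x,
  measurable_fun setT (fun z : euclid R d => p t (vsub z x)).
Hypothesis p_moment : forall u x, 0 < u <= 1 ->
  (\int[leb]_z (enorm (vsub z x) `^ gamma * \1_[set z | (enorm (vsub z x) <= 1)%R] z
      * p u (vsub z x))%:E <= (CM * u `^ (gamma / alpha))%:E)%E.
Hypothesis p_tail : forall u x, 0 < u ->
  (\int[leb]_z (\1_[set z | (1 <= enorm (vsub z x))%R] z * p u (vsub z x))%:E
    <= (CT * u)%:E)%E.
Hypothesis p_half : p (t / 2) vzero <= CD * p t vzero.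

Lemma integral_holder_modulus v x : 0 < v <= 1 ->
  (\int[leb]_z (holder_modulus (vsub z x) * p v (vsub z x))%:E <=
   (M * (CM * v `^ (gamma / alpha)) + 2 * N * (CT * v))%:E)%E.
Proof.
move=> /andP[v0 v1].
have mne : measurable_fun setT (fun z : euclid R d => enorm (vsub z x)).
  by apply: (measurableT_comp measurable_enorm) => //; exact: measurable_fun_vsub.
have mA : measurable [set z : euclid R d | (enorm (vsub z x) <= 1)%R].
  rewrite (_ : mkset _ = (fun z => enorm (vsub z x)) @^-1` `]-oo, 1]%classic).
    by rewrite -[X in measurable X]setTI; exact: mne.
  by apply/seteqP; split => z/=; rewrite in_itv/=.
have mB : measurable [set z : euclid R d | (1 <= enorm (vsub z x))%R].
  rewrite (_ : mkset _ = (fun z => enorm (vsub z x)) @^-1` `[1, +oo[%classic).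
    by rewrite -[X in measurable X]setTI; exact: mne.
  by apply/seteqP; split => z/=; rewrite in_itv/= andbT.
have m1 : measurable_fun setT (fun z : euclid R d =>
    (enorm (vsub z x) `^ gamma * \1_[set z | (enorm (vsub z x) <= 1)%R] z * p v (vsub z x))%:E).
  apply/measurable_EFinP; apply: measurable_funM => //; apply: measurable_funM.
    exact: (measurableT_comp (measurable_powR _)).
  exact: measurable_indic.
have m2 : measurable_fun setT (fun z : euclid R d =>
    (\1_[set z | (1 <= enorm (vsub z x))%R] z * p v (vsub z x))%:E).
  by apply/measurable_EFinP; apply: measurable_funM => //; exact: measurable_indic.
have n1 z : (0 <= (enorm (vsub z x) `^ gamma *
    \1_[set z | (enorm (vsub z x) <= 1)%R] z * p v (vsub z x))%:E)%E.
  by rewrite lee_fin !mulr_ge0 ?powR_ge0 ?(ltW (p_gt0 _ v0))// indicE ler0n.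
have n2 z : (0 <= (\1_[set z | (1 <= enorm (vsub z x))%R] z * p v (vsub z x))%:E)%E.
  by rewrite lee_fin !mulr_ge0 ?(ltW (p_gt0 _ v0))// indicE ler0n.
have N20 : 0 <= 2 * N by rewrite mulr_ge0.
have EE z : ((holder_modulus (vsub z x) * p v (vsub z x))%:E =
  M%:E * (enorm (vsub z x) `^ gamma *
    \1_[set z | (enorm (vsub z x) <= 1)%R] z * p v (vsub z x))%:E +
  (2 * N)%:E * (\1_[set z | (1 <= enorm (vsub z x))%R] z * p v (vsub z x))%:E)%E.
  rewrite -!EFinM -EFinD; congr EFin; rewrite /holder_modulus !indicE.
  by rewrite mulrDl !mulrA.
under eq_integral do rewrite EE.
rewrite ge0_integralD//; last 4 first.
- by move=> z _; rewrite mule_ge0// lee_fin ltW.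
- exact: emeasurable_funM.
- by move=> z _; rewrite mule_ge0// lee_fin.
- exact: emeasurable_funM.
rewrite ge0_integralZl//; last by rewrite lee_fin ltW.
rewrite ge0_integralZl//.
rewrite EFinD (EFinM M) (EFinM (2 * N)); apply: leeD.
  by rewrite lee_wpmul2l ?lee_fin ?(ltW M0)// p_moment// v0.
by rewrite lee_wpmul2l ?lee_fin// p_tail.
Qed.

Lemma integral_holder_modulus_product u z : 0 < u < t ->
  (\int[leb]_w (holder_modulus (vsub w z) * (p u (vsub w z) * p (t - u) (vsub w z)))%:E <=
   (CD * (M * (CM * t `^ (gamma / alpha)) + 2 * N * (CT * t)) * p t vzero)%:E)%E.
Proof.
move=> /andP[u0 ut]; have /andP[t0 t1] := t01.
have pt0 := p_gt0 (vzero : euclid R d) t0.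
(* Here [b] is the longer leg, so [b >= t / 2]: its kernel is replaced by a constant, and the
   modulus is integrated against the kernel of the shorter leg. *)
have main a b : 0 < a -> 0 < b -> a + b = t -> a <= b ->
  (\int[leb]_w (holder_modulus (vsub w z) * (p a (vsub w z) * p b (vsub w z)))%:E <=
   (CD * (M * (CM * t `^ (gamma / alpha)) + 2 * N * (CT * t)) * p t vzero)%:E)%E.
  move=> a0 b0 abt ab.
  have at1 : 0 < a <= 1 by rewrite a0/=; lra.
  have mv : measurable_fun setT (fun w => vsub w z) by exact: measurable_fun_vsub.
  have mk := measurableT_comp measurable_holder_modulus mv.
  apply: (@le_trans _ _ (\int[leb]_w ((CD * p t vzero)%:E *
      (holder_modulus (vsub w z) * p a (vsub w z))%:E))%E).
    apply: ge0_le_integral_pointwise => w.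
      by rewrite lee_fin mulr_ge0 ?holder_modulus_ge0// mulr_ge0// ltW// p_gt0.
    rewrite -EFinM lee_fin mulrA [leRHS]mulrC ler_wpM2l//.
      by rewrite mulr_ge0 ?holder_modulus_ge0// ltW// p_gt0.
    apply: le_trans p_half; apply: le_trans (p_le0 _ b0) _.
    by apply: p_anti; lra.
  rewrite ge0_integralZl//; last 3 first.
  - by apply/measurable_EFinP; exact: measurable_funM.
  - by move=> w _; rewrite lee_fin mulr_ge0 ?holder_modulus_ge0// ltW// p_gt0.
  - by rewrite lee_fin mulr_ge0// ltW.
  apply: le_trans (lee_wpmul2l _ (integral_holder_modulus z at1)) _.
    by rewrite lee_fin mulr_ge0// ltW.
  rewrite -EFinM lee_fin mulrAC ler_wpM2r ?(ltW pt0)// ler_wpM2l//.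
  apply: lerD; rewrite ler_wpM2l ?(ltW M0) ?mulr_ge0// ler_wpM2l//.
    rewrite ge0_ler_powR ?nnegrE ?(ltW a0) ?(ltW t0)//; last by lra.
    by rewrite divr_ge0 ?ltW.
  by lra.
have [h|h] := leP u (t - u).
  by apply: main => //; lra.
under eq_integral do rewrite (mulrC (p u _)).
by apply: main; lra.
Qed.

End product_kernel.

End holder_modulus.

(** * Explicit constants for the heat kernel *)

Section moments_of_heat_kernel.
Context {R : realType} {d : nat}.
Variables (alpha m gamma M : R).
Hypothesis alpha02 : 0 < alpha < 2.
Hypothesis m0 : 0 < m.
Hypothesis gamma_alpha : 0 < gamma < alpha.
Hypothesis M0 : 0 < M.

Definition heat_tail_constant : R :=
  tail_constant (gap_constant (d := d) alpha) (decrease_constant (d := d) alpha m).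

Definition heat_moment_constant : R :=
  moment_constant alpha (gap_constant (d := d) alpha)
    (decrease_constant (d := d) alpha m) gamma.

Definition half_constant : R := expR m * ((1 / 2) `^ (- alpha^-1)) ^+ d.

(** The terms pay for the increments within distance 1, for the longer ones, and for the Taylor
    remainder. Of [V] only the Hoelder constant [M] enters, and the bridges not at all; they serve
    to prove the estimates in which these constants appear. *)
Definition trace_constant : R :=
  half_constant * (M * heat_moment_constant) + half_constant * heat_tail_constant + 1.

Let a0 : 0 < alpha. Proof. by case/andP: alpha02. Qed.

Variable bridge : R -> euclid R d -> euclid R d -> process R d.
Hypothesis bridgeP : forall t x y, 0 < t -> is_bridge alpha m t x y (bridge t x y).
Let mass1 := bridge_mass1 bridgeP.

Let c0 := @gap_constant_gt0 R d alpha.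
Let K0 := decrease_constant_ge0 mass1.
Let e_gt0 (h : R) : 0 < h -> 0 < (h `^ (- alpha^-1)) ^+ d.
Proof. by move=> h0; rewrite exprn_gt0// powR_gt0. Qed.
Let mshift t (x : euclid R d) :
  measurable_fun setT (fun z : euclid R d => heat_kernel alpha m t (vsub z x)).
Proof. by apply: measurable_fun_heat_kernel => //; exact: measurable_fun_vsub. Qed.
Let CKsym s t (x : euclid R d) (s0 : 0 < s) (t0 : 0 < t) :=
  heat_kernel_CKsym mass1 x s0 t0.

Lemma heat_tail_constant_ge0 : 0 <= heat_tail_constant.
Proof. exact: (tail_constant_ge0 c0 K0). Qed.

Lemma half_constant_ge0 : 0 <= half_constant.
Proof. by rewrite mulr_ge0 ?expR_ge0// exprn_ge0// powR_ge0. Qed.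

Lemma heat_moment_constant_ge0 : 0 <= heat_moment_constant.
Proof.
case/andP: gamma_alpha => g0 ga.
rewrite addr_ge0// divr_ge0//.
  by rewrite mulr_ge0 ?powR_ge0// heat_tail_constant_ge0.
rewrite subr_ge0 -opprB powRN invf_le1 ?powR_gt0//.
have {1}<- : 1 `^ (alpha - gamma) = 1 :> R by rewrite powR1.
by rewrite ge0_ler_powR ?nnegrE ?subr_ge0 ?ler1n// ltW.
Qed.

Lemma heat_kernel_tail u (x : euclid R d) : 0 < u ->
  (\int[leb]_z (\1_[set z | (1 <= enorm (vsub z x))%R] z *
     heat_kernel alpha m u (vsub z x))%:E <= (heat_tail_constant * u)%:E)%E.
Proof.
move=> u0; have -> : heat_tail_constant * u = heat_tail_constant * u * 1 `^ (- alpha).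
  by rewrite powR1 mulr1.
apply: (kernel_tail a0 c0 e_gt0 (heat_kernel_gt0 mass1) (heat_kernel_le0 mass1) mshift
  (heat_kernel_mass_le1 alpha02 m0 mass1) CKsym (heat_kernel_gap alpha02 m0 mass1)
  (heat_kernel0_decrease_le alpha02 m0 mass1)) => //.
by rewrite ltr01/=.
Qed.

Lemma heat_kernel_moment u (x : euclid R d) : 0 < u <= 1 ->
  (\int[leb]_z (enorm (vsub z x) `^ gamma * \1_[set z | (enorm (vsub z x) <= 1)%R] z
      * heat_kernel alpha m u (vsub z x))%:E <=
   (heat_moment_constant * u `^ (gamma / alpha))%:E)%E.
Proof.
exact: (kernel_moment a0 c0 K0 e_gt0 (heat_kernel_gt0 mass1) (heat_kernel_le0 mass1) mshift
  (heat_kernel_mass_le1 alpha02 m0 mass1) CKsym (heat_kernel_gap alpha02 m0 mass1)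
  (heat_kernel0_decrease_le alpha02 m0 mass1)).
Qed.

Variable V : euclid R d -> R.
Hypothesis V1 : V \in Lfun leb 1.
Hypothesis Voo : V \in Lfun leb +oo%E.
Hypothesis Vholder : forall x y, `|V x - V y| <= M * enorm (vsub x y) `^ gamma.

Let N := Linfnorm V.
Let g0 : 0 < gamma. Proof. by case/andP: gamma_alpha. Qed.

Let VN x : `|V x| <= N.
Proof. exact: (holder_le_Linfnorm g0 M0 Vholder). Qed.

Lemma trace_difference_bound_heat t : 0 < t <= 1 ->
  `|trace_difference alpha m V bridge t
     + heat_kernel alpha m t (vzero : euclid R d) * t * \int[leb]_x V x
     - heat_kernel alpha m t (vzero : euclid R d) * (2^-1 * t ^+ 2) *
       \int[leb]_x (`|V x| ^+ 2)| <=
  trace_constant * L1norm V * heat_kernel alpha m t (vzero : euclid R d) *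
    (N ^+ 2 * expR (t * N) * t ^+ 3 + t `^ (gamma / alpha + 2)).
Proof.
move=> t01; have /andP[t0 t1] := t01.
have N0 : 0 <= N by exact: le_trans (VN vzero).
have [iV L1E] := Lfun1_L1norm V1.
set CM := heat_moment_constant; set CT := heat_tail_constant; set CD := half_constant.
have CM0 : 0 <= CM by exact: heat_moment_constant_ge0.
have CT0 : 0 <= CT by exact: heat_tail_constant_ge0.
have CD0 : 0 <= CD by exact: half_constant_ge0.
have half := heat_kernel0_half alpha02 m0 mass1 t01.
have kapQ u (z : euclid R d) (ut : 0 < u < t) :=
  integral_holder_modulus_product M0 N0 t01 a0 g0 CM0 CT0 CD0 (heat_kernel_gt0 mass1)
    (heat_kernel_le0 mass1) (heat_kernel0_anti alpha02 m0 mass1) mshift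
    heat_kernel_moment heat_kernel_tail half z ut.
set Q := CD * (M * (CM * t `^ (gamma / alpha)) + 2 * N * (CT * t)) in kapQ.
have Q0 : 0 <= Q.
  have tp : 0 <= t `^ (gamma / alpha) := powR_ge0 _ _.
  apply: mulr_ge0 => //; apply: addr_ge0.
    by apply: mulr_ge0; [exact: ltW|exact: mulr_ge0].
  by apply: mulr_ge0; apply: mulr_ge0 => //; exact: ltW.
have main := @trace_difference_bound R d alpha m gamma M t N Q V (holder_modulus gamma M N)
  (heat_kernel alpha m) bridge t0 g0 Vholder iV VN (fun _ _ => erefl)
  (heat_kernel_gt0 mass1) (heat_kernel_sym alpha m)
  (measurable_fun_heat_kernel alpha m) (heat_kernel_CK mass1)
  (measurable_holder_modulus gamma M N) (holder_modulus_ge0 gamma M0 N0)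
  (holder_modulus_sym gamma M N) (fun z w => le_holder_modulus N0 z w Vholder VN)
  Q0 kapQ (fun x => bridgeP x x t0).
apply: le_trans main _; rewrite L1E.
have pt0 := heat_kernel0_gt0 mass1 t0.
have L0 : 0 <= \int[leb]_x `|V x| by exact: Rintegral_ge0.
rewrite (_ : trace_constant * _ * _ = heat_kernel alpha m t (vzero : euclid R d) *
  \int[leb]_x `|V x| * trace_constant); last by rewrite mulrC mulrA mulrAC.
rewrite -[leRHS]mulrA; apply: ler_wpM2l; first by apply: mulr_ge0 => //; exact: ltW pt0.
have -> : t `^ (gamma / alpha + 2) = t `^ (gamma / alpha) * t ^+ 2.
  rewrite powRD; last by apply/implyP => _; rewrite gt_eqF.
  by rewrite -(powR_mulrn 2 (ltW t0)).
(* True because [t <= 1] and [gamma < alpha]; the linear tail term thus fits into the error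
   exponent. *)
have ts : t <= t `^ (gamma / alpha).
  rewrite -[leLHS](powRr1 (ltW t0)); apply: ger_powR; first by rewrite t0.
  by rewrite ler_pdivrMr// mul1r ltW//; case/andP: gamma_alpha.
have e1 : 1 <= expR (t * N).
  by rewrite -expR0 ler_expR mulr_ge0 ?(ltW t0).
rewrite /Q /trace_constant -/CM -/CT -/CD.
have a1 : 0 <= CD * (M * CM) by rewrite !mulr_ge0 ?(ltW M0).
have a2 : 0 <= CD * CT by rewrite mulr_ge0.
move: (t `^ (gamma / alpha)) (expR (t * N)) ts e1 => s e ts e1.
have X0 : 0 <= N ^+ 2 * e * t ^+ 3.
  by rewrite !mulr_ge0 ?sqr_ge0 ?exprn_ge0 ?(ltW t0)// (le_trans _ e1).
have Y0 : 0 <= s * t ^+ 2.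
  by rewrite mulr_ge0 ?sqr_ge0// (le_trans _ ts)// ltW.
(* The long increments are linear in [N]. Through [N <= N^2 + 1] they are shared between the two
   error terms, which keeps [N] out of the constant. *)
have NXY : N * t ^+ 3 <= N ^+ 2 * e * t ^+ 3 + s * t ^+ 2.
  apply: (@le_trans _ _ ((N ^+ 2 + 1) * t ^+ 3)).
    rewrite ler_wpM2r ?exprn_ge0 ?(ltW t0)//.
    by have := sqr_ge0 (N - 1); rewrite sqrrB1; lra.
  rewrite mulrDl mul1r lerD//.
    rewrite ler_wpM2r ?exprn_ge0 ?(ltW t0)//.
    by rewrite -[leLHS]mulr1 ler_wpM2l ?sqr_ge0.
  by rewrite exprS ler_wpM2r ?sqr_ge0.
move: a1 a2; set A1 := CD * (M * CM); set A2 := CD * CT => a1 a2.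
have -> : CD * (M * (CM * s) + 2 * N * (CT * t)) * t ^+ 2 / 2 + N ^+ 2 * t ^+ 3 * e =
  A1 * (s * t ^+ 2) / 2 + A2 * (N * t ^+ 3) + N ^+ 2 * e * t ^+ 3.
  by rewrite /A1 /A2; field.
have b1 : 0 <= A1 * (s * t ^+ 2) by rewrite mulr_ge0.
have b2 := ler_wpM2l a2 NXY.
have b3 : 0 <= A1 * (N ^+ 2 * e * t ^+ 3) by rewrite mulr_ge0.
rewrite !mulrDl mul1r (mulrDr A1); move: b1 b2 b3 X0 Y0; lra.
Qed.

End moments_of_heat_kernel.

Theorem theorem5p2 (R : realType) (d : nat) (alpha m gamma M : R) :
  (1 <= d)%N -> 0 < alpha < 2 -> 0 < m -> 0 < gamma ->
  (alpha <= 1 -> gamma < Num.min alpha 1) -> (1 < alpha -> gamma <= 1) ->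
  0 < M ->
  exists C : R,
  forall V : euclid R d -> R,
    V \in Lfun leb 1 -> V \in Lfun leb +oo%E ->
    (forall x y, `|V x - V y| <= M * enorm (vsub x y) `^ gamma) ->
  forall bridge : R -> euclid R d -> euclid R d -> process R d,
    (forall t x y, 0 < t -> is_bridge alpha m t x y (bridge t x y)) ->
  let Tr := trace_difference alpha m V bridge in
  let p0 := fun t => heat_kernel alpha m t (vzero : euclid R d) in
  let I1 := \int[leb]_x V x in
  let I2 := \int[leb]_x (`|V x| ^+ 2) in
  (forall t, 0 < t <= 1 ->
     `|Tr t + p0 t * t * I1 - p0 t * (2^-1 * t ^+ 2) * I2| <=
     C * L1norm V * p0 t *
       (Linfnorm V ^+ 2 * expR (t * Linfnorm V) * t ^+ 3
        + t `^ (gamma / alpha + 2))) /\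
  (exists2 r : R -> R,
     r =O_ (0^'+) (fun t : R => t `^ (gamma / alpha + 2)) &
     forall t, 0 < t ->
       Tr t = p0 t * (- t * I1 + 2^-1 * t ^+ 2 * I2 + r t)).
Proof.
move=> _ alpha02 m0 g0 gle1 ggt1 M0.
(* Both ranges of [alpha] reduce to [gamma < alpha], which is what makes the dyadic series
   converge. *)
have ga : 0 < gamma < alpha.
  rewrite g0/=; have [a1|a1] := leP alpha 1; last exact: le_lt_trans (ggt1 a1) a1.
  by have := gle1 a1; rewrite lt_min => /andP[].
exists (trace_constant (d := d) alpha m gamma M) => V V1 Voo Vholder bridge bridgeP Tr p0 I1 I2.
have bound t : 0 < t <= 1 ->
    `|Tr t + p0 t * t * I1 - p0 t * (2^-1 * t ^+ 2) * I2| <=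
     trace_constant (d := d) alpha m gamma M * L1norm V * p0 t *
       (Linfnorm V ^+ 2 * expR (t * Linfnorm V) * t ^+ 3
        + t `^ (gamma / alpha + 2)).
  exact: (trace_difference_bound_heat alpha02 m0 ga M0 bridgeP V1 Voo Vholder).
split=> //.
have p0_gt0 t : 0 < t -> 0 < p0 t.
  by move=> t0; exact: (heat_kernel0_gt0 (bridge_mass1 bridgeP)).
(* Dividing by [p0 t > 0] makes the expansion an identity for every positive time; only the size of
   this remainder near 0 is left to estimate. *)
exists (fun t => Tr t / p0 t + t * I1 - 2^-1 * t ^+ 2 * I2); last first.
  by move=> t /p0_gt0 pt0; field; rewrite gt_eqF.
set K := trace_constant (d := d) alpha m gamma M * L1norm V; set N := Linfnorm V.
have N0 : 0 <= N.
  exact: le_trans (holder_le_Linfnorm g0 M0 Vholder vzero Voo).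
(* For [t <= 1] the exponential is at most [expR N] and [t ^+ 3] is at most the target power; the
   final 1 makes the constant strictly positive. *)
apply/eqO_exP; exists (`|K| * (N ^+ 2 * expR N + 1) + 1).
  by rewrite ltr_wpDl// mulr_ge0// addr_ge0// mulr_ge0 ?sqr_ge0 ?expR_ge0.
near=> t.
have t0 : 0 < t by near: t; exact: nbhs_right_gt.
have t1 : t <= 1 by near: t; exact: nbhs_right_le.
have pt0 := p0_gt0 _ t0.
have t01 : 0 < t <= 1 by rewrite t0.
have := bound t t01; rewrite -/K -/N.
set tau := t `^ (gamma / alpha + 2).
have tau0 : 0 <= tau by exact: powR_ge0.
(* Again [gamma / alpha <= 1] and [t <= 1]. *)
have t3 : t ^+ 3 <= tau.
  rewrite -powR_mulrn ?(ltW t0)//; apply: ger_powR; first exact: t01.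
  rewrite (_ : 3%:R = 1 + 2); last by ring.
  by rewrite lerD2r ler_pdivrMr ?mul1r; case/andP: ga; [move=> _ /ltW|exact: lt_trans].
have -> : Tr t + p0 t * t * I1 - p0 t * (2^-1 * t ^+ 2) * I2 =
    p0 t * (Tr t / p0 t + t * I1 - 2^-1 * t ^+ 2 * I2).
  by field; rewrite gt_eqF.
rewrite normrM gtr0_norm// -[K * _ * _]mulrAC [K * _ * _]mulrC ler_pM2l// => He.
apply: le_trans He _; apply: le_trans (ler_norm _) _; rewrite normrM (ger0_norm tau0).
apply: (@le_trans _ _ (`|K| * ((N ^+ 2 * expR N + 1) * tau))); last first.
  by rewrite mulrA ler_wpM2r// lerDl.
apply: ler_wpM2l => //; rewrite ger0_norm; last first.
  rewrite addr_ge0// mulr_ge0 ?exprn_ge0 ?(ltW t0)//.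
  by rewrite mulr_ge0 ?sqr_ge0 ?expR_ge0.
rewrite mulrDl mul1r lerD2r; apply: ler_pM => //.
- by rewrite mulr_ge0 ?sqr_ge0 ?expR_ge0.
- by rewrite exprn_ge0// ltW.
rewrite ler_wpM2l ?sqr_ge0// ler_expR.
by rewrite -[leRHS]mul1r ler_wpM2r.
Unshelve. all: by end_near. Qed.
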